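(* Let $n\ge 2$, let $f(x)=\frac1N\sum_{i=1}^N f_i(x,y_i,a_i)$ be of finite-sum form on $\mathbb{R}^n$, and consider iteration $k$ of the StOFFAR$2$ algorithm (see context) in which the derivatives are approximated by sampling, $$\overline{\nabla_x^1 f}(X_k)=\frac{1}{b_{g,k}}\sum_{i\in\mathcal{B}_{g,k}}\nabla_x^1 f_i(X_k,y_i,a_i),\qquad \overline{\nabla_x^2 f}(X_k)=\frac{1}{b_{H,k}}\sum_{i\in\mathcal{B}_{H,k}}\nabla_x^2 f_i(X_k,y_i,a_i),$$ where $\mathcal{B}_{g,k},\mathcal{B}_{H,k}$ are batches of cardinality $b_{g,k}$ and $b_{H,k}$. Suppose that there exist non-negative constants $\sigma_g,\sigma_H$ such that, for each $i\in\{1,\ldots,N\}$, $$\mathbb{E}_k\big[\|\nabla_x^1 f_i(X_k,y_i,a_i)-\nabla_x^1 f(X_k)\|^2\big]\le\sigma_g^2\quad\text{and}\quad\mathbb{E}_k\big[\|\nabla_x^2 f_i(X_k,y_i,a_i)-\nabla_x^2 f(X_k)\|^3\big]\le\sigma_H^3.$$ If $$b_{g,k}\ge\frac{\sigma_g^2}{\kappa_D^{4/3}\,\xi_k^{4/3}}\qquad\text{and}\qquad b_{H,k}\ge\frac{9\,\sigma_H^2\,e\,\log(n)}{2\,\kappa_D^{2/3}\,\xi_k^{2/3}},$$ then $$\mathbb{E}_k\big[\|\nabla_x^1 f(X_k)-\overline{\nabla_x^1 f}(X_k)\|^{3/2}\big]\le\kappa_D\,\xi_k\qquad\text{and}\qquad\mathbb{E}_k\big[\|\nabla_x^2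 f(X_k)-\overline{\nabla_x^2 f}(X_k)\|^{3}\big]\le\kappa_D\,\xi_k.$$
   Context: StOFFAR$2$ algorithm: given an integer memory $m\ge1$, $\sigma_0>0$, $\theta_1>1$, a (possibly random) $X_0\in\mathbb{R}^n$ and $\Sigma_0=\sigma_0$, at each iteration $k\ge 0$ random approximations $\overline{\nabla_x^1 f}(X_k)$, $\overline{\nabla_x^2 f}(X_k)$ of the gradient and Hessian are evaluated; with $\overline{T_{f,2}}(x,s)=f(x)+\overline{\nabla_x^1 f}(x)[s]+\frac12\overline{\nabla_x^2 f}(x)[s]^2$ and $m_k(s)=\overline{T_{f,2}}(X_k,s)+\frac{\Sigma_k}{6}\|s\|^3$, a step $S_k$ is computed with $m_k(S_k)\le m_k(0)$ and $\|\nabla_s\overline{T_{f,2}}(X_k,S_k)\|\le\frac{\theta_1\Sigma_k}{2}\|S_k\|^2$; then $X_{k+1}=X_k+S_k$ and $\Sigma_{k+1}=\Sigma_k+\Sigma_k\|S_k\|^3$. $\xi_k=\sum_{i=1}^m\|S_{k-i}\|^3$ with the convention $\|S_{-1}\|=\cdots=\|S_{-m}\|=1$; $\kappa_D>0$ is a given constant (and $\xi_k>0$ so that the bounds make sense). $\mathbb{E}_k$ is conditional expectation given the approximate derivatives computed at iterations $0,\ldots,k-1$; $\xi_k$ is determined by this past. Norms are Euclidean for vectors and the spectral (subordinate) norm for matrices. Sampling model: the pairs $(a_i,y_i)$ are i.i.d. from an unknown distribution and, conditionally on the past, the sampled gradients $\nabla_x^1 f_i(X_k,y_i,a_i)$ ($i\in\mathcal{B}_{g,k}$)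 are i.i.d. random vectors with mean $\nabla_x^1 f(X_k)$, and the sampled Hessians $\nabla_x^2 f_i(X_k,y_i,a_i)$ ($i\in\mathcal{B}_{H,k}$) are i.i.d. random self-adjoint $n\times n$ matrices with mean $\nabla_x^2 f(X_k)$. *)

(* Defs.v *)
From HB Require Import structures.
From mathcomp Require Import all_boot all_order all_algebra.
From mathcomp Require Import all_classical all_reals all_analysis.
From mathcomp Require Import measurable_realfun.
Set Implicit Arguments.
Unset Strict Implicit.
Unset Printing Implicit Defensive.
Import Order.TTheory GRing.Theory Num.Theory.
Import numFieldNormedType.Exports.
Local Open Scope classical_set_scope.
Local Open Scope ring_scope.

(* Vectors are rows, so that ['J] of the library applies; the library norm on
   matrices is the sup norm, hence the two definitions below. *)
Definition enorm (R : realType) (n : nat) (v : 'rV[R]_n) : R :=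
  Num.sqrt (\sum_i v 0 i ^+ 2).

(* [v *m A^T] is the row form of the column vector [A v]. *)
Definition spnorm (R : realType) (n : nat) (A : 'M[R]_n) : R :=
  sup [set enorm (v *m A^T) | v in [set v : 'rV[R]_n | enorm v <= 1]].

Definition grad (R : realType) (n : nat) (f : 'rV[R]_n -> R) (x : 'rV[R]_n) :
    'rV[R]_n :=
  \row_i 'D_(delta_mx 0 i) f x.

Definition hess (R : realType) (n : nat) (f : 'rV[R]_n -> R) (x : 'rV[R]_n) :
    'M[R]_n :=
  'J (grad f) x.

Definition twice_differentiable (R : realType) (n : nat)
    (f : 'rV[R]_n -> R) : Prop :=
  forall x, differentiable f x /\ differentiable (grad f) x.

(* [V] is a version of the expectation of the nonnegative [Z] given the
   sigma-algebra generated by [G]; [V] may take the value [+oo]. *)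
Definition is_cond_exp (d : measure_display) (T : measurableType d)
    (R : realType) (P : probability T R) (G : set (set T)) (Z : T -> R)
    (V : T -> \bar R) : Prop :=
  [/\ forall w, (0 <= V w)%E,
      measurable_fun [set: g_sigma_algebraType G] (V : g_sigma_algebraType G -> \bar R) &
      forall A : set T, G.-sigma.-measurable A ->
        (\int[P]_(w in A) V w = \int[P]_(w in A) (Z w)%:E)%E].

Lemma sub_gen_measurable (d : measure_display) (T : measurableType d)
    (G : set (set T)) :
  (forall A, G A -> d.-measurable A) ->
  forall A : set T, G.-sigma.-measurable A -> d.-measurable A.
Proof.
move=> Gm; apply: smallest_sub => //.
by split=> // [A mA|F mF]; [rewrite setTD; exact: measurableC|
  exact: bigcupT_measurable].
Qed.

Lemma finite_cond_exp (d : measure_display) (T : measurableType d)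
    (R : realType) (P : probability T R) (G : set (set T)) (Z : T -> \bar R) :
  (forall A, G A -> d.-measurable A) -> measurable_fun setT Z ->
  (forall w, 0 <= Z w)%E -> (\int[P]_w Z w < +oo)%E ->
  exists V : T -> \bar R, [/\ forall w, (0 <= V w)%E,
    measurable_fun [set: g_sigma_algebraType G]
      (V : g_sigma_algebraType G -> \bar R) &
    forall A : set T, G.-sigma.-measurable A ->
      (\int[P]_(w in A) V w = \int[P]_(w in A) Z w)%E].
Proof.
move=> Gm mZ Z0 Zoo; have mG := sub_gen_measurable Gm.
pose phi : T -> g_sigma_algebraType G := id.
have mphi : measurable_fun setT phi by move=> _ B mB; rewrite setTI; exact: mG.
pose mphiM := isMeasurableFun.Build _ _ _ _ phi mphi.
pose phi' : {mfun T >-> g_sigma_algebraType G} := HB.pack phi mphiM.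
have iZ : P.-integrable setT Z.
  by apply/integrableP; split=> //; under eq_integral do rewrite gee0_abs//.
have Zpos E : (0 <= induced_charge iZ E)%E by exact: integral_ge0.
pose mZ1 := measure_of_charge _ Zpos.
pose mu1 := pushforward P phi'.
pose nu1 := pushforward mZ1 phi'.
have fmu : fin_num_fun mu1 by move=> A mA; apply: fin_num_measure; exact: mG.
have fnu : fin_num_fun nu1.
  by move=> A mA; rewrite /nu1 /pushforward/= fin_num_measure//; exact: mG.
pose mu0 :=
  HB.pack_for (FiniteMeasure.type (g_sigma_algebraType G) R) mu1 (Measure_isFinite.Build _ _ _ mu1 fmu).
pose nu0 :=
  HB.pack_for (FiniteMeasure.type (g_sigma_algebraType G) R) nu1 (Measure_isFinite.Build _ _ _ nu1 fnu).
pose mu := mu0 mphi mphi mphi mphi.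
pose nu := nu0 mphi mphi mphi mphi.
have dom : nu `<< mu.
  apply/null_content_dominatesP => A mA muA.
  rewrite /nu/= /nu1 /pushforward /= /mZ1 /measure_of_charge /induced_charge.
  apply: null_set_integral => //; first exact: mG.
  exact: measurable_funTS.
have [V [V0 iV HV]] := radon_nikodym_finite dom.
exists V; split=> //; first exact: measurable_int iV.
move=> A mA; have := HV A mA.
rewrite {1}/nu/= {1}/nu1 /pushforward /= /mZ1 /measure_of_charge /induced_charge => ->.
rewrite (ge0_integral_pushforward (phi := phi') mphi P)//.
by apply: measurable_funTS; exact: measurable_int iV.
Qed.

Lemma is_cond_exp_exists (d : measure_display) (T : measurableType d)
    (R : realType) (P : probability T R) (G : set (set T)) (Z : T -> R) :
  (forall A, G A -> d.-measurable A) -> measurable_fun setT Z ->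
  (forall w, 0 <= Z w) -> exists V, is_cond_exp P G Z V.
Proof.
move=> Gm mZ Z0; have mG := sub_gen_measurable Gm.
pose D (i : nat) : set T := Z @^-1` `[i%:R, i.+1%:R[.
have mD i : measurable (D i).
  by rewrite -[D i]setTI; apply: mZ => //; exact: measurable_itv.
have UD : \bigcup_i D i = setT.
  apply/seteqP; split=> // w _; exists (Num.truncn (Z w)) => //=.
  rewrite /D /preimage /= in_itv /=; exact: truncn_itv.
have tD : trivIset setT D.
  apply/trivIsetP => i j _ _ ij; apply/seteqP; split=> // w [] /=.
  rewrite /D /preimage /= !in_itv /= => /truncn_def E1 /truncn_def E2.
  by move: ij; rewrite -E1 -E2 eqxx.
pose Zi i : T -> \bar R := (EFin \o Z) \_ (D i).
have mZE : measurable_fun setT (EFin \o Z) by exact/measurable_EFinP.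
have mZi i : measurable_fun setT (Zi i).
  by apply/(measurable_restrictT _ (mD i)); exact: measurable_funTS.
have Zi0 i w : (0 <= Zi i w)%E.
  by rewrite /Zi patchE; case: ifPn => // _; rewrite lee_fin.
have Zioo i : (\int[P]_w Zi i w < +oo)%E.
  apply: (@le_lt_trans _ _ (\int[P]_w (cst (i.+1%:R%:E) w))%E); last first.
    by rewrite integral_cst//= (@probability_setT _ _ _ P) mule1 ltry.
  apply: ge0_le_integral => //= w _; rewrite /Zi patchE; case: ifPn => [|_].
    by rewrite inE /D /= in_itv/= lee_fin => /andP[_ /ltW].
  by rewrite lee_fin.
have /choice [V HV] i := finite_cond_exp Gm (mZi i) (Zi0 i) (Zioo i).
have V0 i w : (0 <= V i w)%E by have [] := HV i.
have mV i : measurable_fun [set: g_sigma_algebraType G]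
      (V i : g_sigma_algebraType G -> \bar R) by have [] := HV i.
have mVT i : measurable_fun setT (V i).
  by move=> _ B mB; have := mV i measurableT B mB; exact: mG.
exists (fun w => (\sum_(i <oo) V i w)%E); split.
- by move=> w; apply: nneseries_ge0.
- by apply: ge0_emeasurable_sum => //.
move=> A mA; have mA' := mG _ mA.
rewrite integral_nneseries//; last by move=> i; exact: measurable_funTS.
have -> : A = \bigcup_i (A `&` D i) by rewrite -setI_bigcupr UD setIT.
rewrite ge0_integral_bigcup//; last first.
- by apply: trivIset_setIl.
- by move=> w _; rewrite lee_fin.
- by apply: measurable_funTS.
- by move=> i; exact: measurableI.
apply: eq_eseriesr => i _; have [_ _ ->] := HV i; last first.
  by rewrite -setI_bigcupr UD setIT.
by rewrite -setI_bigcupr UD setIT /Zi integral_mkcondr.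
Qed.

Definition cond_exp_nneg (d : measure_display) (T : measurableType d)
    (R : realType) (P : probability T R) (G : set (set T)) (Z : T -> R) :
    T -> \bar R :=
  xget (cst 0%E) [set V | is_cond_exp P G Z V].

Lemma cond_exp_nnegP (d : measure_display) (T : measurableType d)
    (R : realType) (P : probability T R) (G : set (set T)) (Z : T -> R) :
  (forall A, G A -> d.-measurable A) -> measurable_fun setT Z ->
  (forall w, 0 <= Z w) -> is_cond_exp P G Z (cond_exp_nneg P G Z).
Proof.
move=> Gm mZ Z0; have [V HV] := is_cond_exp_exists P Gm mZ Z0.
exact: (@xgetPex _ (cst 0%E) [set V | is_cond_exp P G Z V] (ex_intro _ V HV)).
Qed.

(* The generalized conditional expectation E[Z^+ | G] - E[Z^- | G]: [Z] need
   not be integrable.  It is [E[Z | G]] up to a negligible set when [0 <= Z].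
   Equality with a real number forces both terms to be finite. *)
Definition cond_exp (d : measure_display) (T : measurableType d)
    (R : realType) (P : probability T R) (G : set (set T)) (Z : T -> R)
    (w : T) : \bar R :=
  (cond_exp_nneg P G (Z^\+)%R w - cond_exp_nneg P G (Z^\-)%R w)%E.

Definition cond_prob (d : measure_display) (T : measurableType d)
    (R : realType) (P : probability T R) (G : set (set T)) (A : set T) :
    T -> \bar R :=
  cond_exp P G (\1_A : T -> R).

(* Generated by the entries: the Borel sets of R^(p x q). *)
Definition mx_borel (R : realType) (p q : nat) : set (set 'M[R]_(p, q)) :=
  <<s [set A | exists i j (B : set R),
         measurable B /\ A = [set M : 'M[R]_(p, q) | B (M i j)]] >>.

Definition random_mx (d : measure_display) (T : measurableType d)
    (R : realType) (p q : nat) (Z : T -> 'M[R]_(p, q)) : Prop :=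
  forall i j, measurable_fun setT (fun w => Z w i j).

Definition iid (d d' : measure_display) (T : measurableType d)
    (E : measurableType d') (R : realType) (P : probability T R) (N : nat)
    (Z : 'I_N -> T -> E) : Prop :=
  [/\ forall i, measurable_fun setT (Z i),
      forall B : 'I_N -> set E, (forall i, measurable (B i)) ->
        P (\bigcap_i (Z i @^-1` B i)) = (\prod_i P (Z i @^-1` B i))%E &
      forall i j (B : set E), measurable B ->
        P (Z i @^-1` B) = P (Z j @^-1` B)].

Definition finite_sum (R : realType) (n N : nat) (Y A : Type)
    (phi : 'I_N -> 'rV[R]_n -> Y -> A -> R) (y : 'I_N -> Y) (a : 'I_N -> A)
    (x : 'rV[R]_n) : R :=
  N%:R^-1 * \sum_i phi i x (y i) (a i).

Definition taylor2 (R : realType) (n : nat) (fx : R) (g : 'rV[R]_n)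
    (H : 'M[R]_n) (s : 'rV[R]_n) : R :=
  fx + (g *m s^T) 0 0 + 2^-1 * (s *m H *m s^T) 0 0.

Definition cubic_model (R : realType) (n : nat) (fx : R) (g : 'rV[R]_n)
    (H : 'M[R]_n) (sigma : R) (s : 'rV[R]_n) : R :=
  taylor2 fx g H s + sigma / 6 * enorm s ^+ 3.

(* A run of StOFFAR2 from [X 0]; the objective [f w] depends on the outcome
   because the data [(a_i, y_i)] are random. *)
Record stoffar2 (d : measure_display) (T : measurableType d) (R : realType)
    (n : nat) (f : T -> 'rV[R]_n -> R) (sigma0 theta1 : R)
    (gbar : nat -> T -> 'rV[R]_n) (Hbar : nat -> T -> 'M[R]_n)
    (X S : nat -> T -> 'rV[R]_n) (Sigma : nat -> T -> R) : Prop := {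
  start_random : random_mx (X 0%N) ;
  grad_random : forall k, random_mx (gbar k) ;
  hess_random : forall k, random_mx (Hbar k) ;
  step_random : forall k, random_mx (S k) ;
  sigma_init : forall w, Sigma 0%N w = sigma0 ;
  step_decrease : forall k w,
    let model := cubic_model (f w (X k w)) (gbar k w) (Hbar k w) (Sigma k w) in
    model (S k w) <= model 0 ;
  step_stationary : forall k w,
    enorm (grad (taylor2 (f w (X k w)) (gbar k w) (Hbar k w)) (S k w))
      <= theta1 * Sigma k w / 2 * enorm (S k w) ^+ 2 ;
  iterate_update : forall k w, X k.+1 w = X k w + S k w ;
  sigma_update : forall k w,
    Sigma k.+1 w = Sigma k w + Sigma k w * enorm (S k w) ^+ 3
}.

(* The branch [k < i] is the convention ||S_(-1)|| = ... = ||S_(-m)|| = 1. *)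
Definition xi (T : Type) (R : realType) (n m : nat)
    (S : nat -> T -> 'rV[R]_n) (k : nat) (w : T) : R :=
  \sum_(1 <= i < m.+1) (if (i <= k)%N then enorm (S (k - i)%N w) ^+ 3 else 1).

(* Generates the sigma-algebra of the derivatives computed before iteration
   [k]; [cond_exp P (past gbar Hbar k)] is the operator E_k. *)
Definition past (d : measure_display) (T : measurableType d) (R : realType)
    (n : nat) (gbar : nat -> T -> 'rV[R]_n) (Hbar : nat -> T -> 'M[R]_n)
    (k : nat) : set (set T) :=
  \bigcup_(j in [set j | (j < k)%N])
    (preimage_set_system setT (gbar j) (@mx_borel R 1 n) `|`
     preimage_set_system setT (Hbar j) (@mx_borel R n n)).

Definition batch_mean (T : Type) (R : realType) (N p q : nat) (b : T -> nat)
    (I : nat -> T -> 'I_N) (Z : 'I_N -> T -> 'M[R]_(p, q)) (w : T) :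
    'M[R]_(p, q) :=
  (b w)%:R^-1 *: \sum_(j < b w) Z (I j w) w.

(* A batch of [b w] draws [I 0 w, ..., I (b w).-1 w] from the indices of the
   sum: its size may depend on the past, and the draws may be deterministic (a
   fixed batch) or random, with possible repetitions.  [Z i] is the derivative
   of the [i]-th term and [M] the exact derivative.  The draws are made without
   looking at the sampled values ([draw_indep], automatic for a fixed batch);
   the remaining fields say that, given the past, the sampled derivatives are
   independent, identically distributed and of mean [M].  Taking some [B j] to
   be [setT] in [sample_indep] gives the product rule for subfamilies. *)
Record conditional_sampling (d : measure_display) (T : measurableType d)
    (R : realType) (P : probability T R) (G : set (set T)) (N p q : nat)
    (b : T -> nat) (I : nat -> T -> 'I_N) (Z : 'I_N -> T -> 'M[R]_(p, q))
    (M : T -> 'M[R]_(p, q)) : Prop := {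
  size_gt0 : forall w, (0 < b w)%N ;
  size_past : forall l, G.-sigma.-measurable [set w | b w = l] ;
  draw_random : forall j i, measurable [set w | I j w = i] ;
  term_random : forall i, random_mx (Z i) ;
  draw_indep : forall j i (B : set 'M[R]_(p, q)), mx_borel B ->
    {ae P, forall w, (j < b w)%N ->
       cond_prob P G ([set w | I j w = i] `&` (Z i @^-1` B)) w =
       (cond_prob P G [set w | I j w = i] w *
        cond_prob P G (Z i @^-1` B) w)%E} ;
  sample_indep : forall (l : nat) (B : 'I_l -> set 'M[R]_(p, q)),
    (forall j, mx_borel (B j)) ->
    {ae P, forall w, b w = l ->
       cond_prob P G (\bigcap_j [set w | B j (Z (I j w) w)]) w =
       (\prod_j cond_prob P G [set w | B j (Z (I j w) w)] w)%E} ;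
  sample_ident : forall (j l : nat) (B : set 'M[R]_(p, q)), mx_borel B ->
    {ae P, forall w, (j < b w)%N -> (l < b w)%N ->
       cond_prob P G [set w | B (Z (I j w) w)] w =
       cond_prob P G [set w | B (Z (I l w) w)] w} ;
  sample_mean : forall (j : nat) (r : 'I_p) (c : 'I_q),
    {ae P, forall w, (j < b w)%N ->
       cond_exp P G (fun w => Z (I j w) w r c) w = (M w r c)%:E}
}.

(* Main.v *)
(* Conditionally on the past, the errors of the sampled derivatives are
   martingale differences along the batch.  For the gradient, orthogonality
   gives E|S_b|^2 <= b sigma_g^2, and Jensen's inequality (in the form of a
   tangent line) gives the moment of order 3/2.

   For the Hessian the spectral norm is replaced by the smooth norm
   N(X) = (tr X^(2p) + eps)^(1/(2p)), which dominates it and has size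
   n^(1/(2p)) |X|.  A second-order expansion of N^3 with constant proportional
   to (2p - 1) n^(1/p) turns the third moments of the partial sums into a
   recursion solved by (delta + 3/2 (2p - 1) n^(1/p) sigma_H^2 k)^(3/2), where
   delta comes from eps.  Choosing p close to ln n makes (2p - 1) n^(1/p) at
   most 3 e ln n. *)
Require Import Defs.
From HB Require Import structures.
From mathcomp Require Import all_boot all_order all_algebra.
From mathcomp Require Import all_classical all_reals all_analysis.
From mathcomp Require Import measurable_realfun.
From mathcomp Require Import ring lra zify.
Import Order.TTheory GRing.Theory Num.Theory.
Import numFieldNormedType.Exports.
Set Implicit Arguments.
Unset Strict Implicit.
Unset Printing Implicit Defensive.
Local Open Scope classical_set_scope.
Local Open Scope ring_scope.

(** Conditional expectations are versions determined up to negligible sets, and no regular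
    conditional law is introduced. Conditional claims are therefore handled as comparisons of
    integrals over events of the past, extended by pi-system arguments to the past joined with the
    earlier draws, and turned back into almost sure bounds at the end. Working inside an event
    [b w = l] makes the random batch size constant. Two obstacles remain. The exact derivative
    depends on the random data and is not known to be measurable for the past; the conditional mean
    of the first draw supplies a measurable version to center with. The sampled entries are not
    assumed integrable, so positive and negative parts stay apart until finiteness is known. The
    matrix inequalities use Cauchy-Schwarz for traces and log-convex sequences in place of
    eigenvalues. The expansion of N^3 leaves a mixed remainder |Y|^2 N; AM-GM at the sizes predicted
    by the recursion makes it affine in |Y|^3 and in N^3, so third moments suffice. *)

(** * Log-convex sequences *)

Section log_convex.
Variable R : realFieldType.
Implicit Types c : nat -> R.

(** Successive ratios of a log-convex sequence do not decrease; denominators are cleared because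
    terms may vanish. *)
Lemma logconvex_ratio c : (forall i, 0 <= c i) ->
  (forall i, c i.+1 ^+ 2 <= c i * c i.+2) ->
  forall k, c 1%N * c k <= c 0%N * c k.+1.
Proof.
move=> c0 cc; elim=> [|k IH]; first by rewrite mulrC.
have [ck0|ckp] := eqVneq (c k) 0.
  have := cc k; rewrite ck0 mul0r => H.
  have : c k.+1 ^+ 2 == 0 by rewrite eq_le H sqr_ge0.
  by rewrite sqrf_eq0 => /eqP ->; rewrite mulr0 mulr_ge0.
have kp : 0 < c k by rewrite lt_neqAle eq_sym ckp c0.
rewrite -(ler_pM2l kp).
apply: (@le_trans _ _ (c 0%N * c k.+1 * c k.+1)).
  by rewrite mulrA [c k * _]mulrC ler_wpM2r.
by rewrite -mulrA -expr2 [leRHS]mulrCA ler_wpM2l.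
Qed.

(** The ratio c_(k+1) / c_0 is a product of k + 1 successive ratios, the first of which is the
    smallest. *)
Lemma logconvex_head c : (forall i, 0 <= c i) ->
  (forall i, c i.+1 ^+ 2 <= c i * c i.+2) ->
  forall k, c 1%N ^+ k.+1 <= c 0%N ^+ k * c k.+1.
Proof.
move=> c0 cc; elim=> [|k IH]; first by rewrite expr0 expr1 mul1r.
rewrite exprS (le_trans (ler_wpM2l (c0 1%N) IH))//.
rewrite mulrCA exprSr -mulrA.
by rewrite ler_wpM2l ?exprn_ge0// logconvex_ratio.
Qed.

(** Dual to the previous bound: c_k / c_0 is a product of k ratios, none larger than the next one,
    c_(k+1) / c_k. For c_i = tr X^(2i) this is a Hölder inequality. *)
Lemma logconvex_tail c : (forall i, 0 <= c i) ->
  (forall i, c i.+1 ^+ 2 <= c i * c i.+2) ->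
  forall k, c k ^+ k.+1 <= c 0%N * c k.+1 ^+ k.
Proof.
move=> c0 cc; elim=> [|k IH]; first by rewrite expr0 expr1 mulr1.
have [ck0|ckp] := eqVneq (c k.+1) 0.
  by rewrite ck0 expr0n/= mulr_ge0 ?exprn_ge0.
have kp : 0 < c k.+1 ^+ k by rewrite exprn_gt0// lt_neqAle eq_sym ckp c0.
rewrite -(ler_pM2l kp) -exprD.
rewrite (_ : (k + k.+2 = 2 * k.+1)%N); last by lia.
rewrite exprM (@le_trans _ _ ((c k * c k.+2) ^+ k.+1))//.
  by rewrite lerXn2r ?nnegrE ?mulr_ge0 ?sqr_ge0.
rewrite exprMn (le_trans (ler_wpM2r _ IH)) ?exprn_ge0//.
by rewrite mulrCA mulrA.
Qed.

(** Once such a sequence goes up it keeps going up until [q], so an interior value is below one of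
    the two ends. *)
Lemma logconvex_max c q : (forall i, 0 <= c i) ->
  (forall i, (i.+2 <= q)%N -> c i.+1 ^+ 2 <= c i * c i.+2) ->
  forall i, (i <= q)%N -> c i <= Num.max (c 0%N) (c q).
Proof.
move=> c0 cc.
have step i : (i.+2 <= q)%N -> c i <= c i.+1 -> c i.+1 <= c i.+2.
  move=> iq ci; have [->//|cp] := eqVneq (c i.+1) 0.
  have {}cp : 0 < c i.+1 by rewrite lt_neqAle eq_sym cp c0.
  rewrite -(ler_pM2l cp) -expr2 (le_trans (cc _ iq))//.
  by rewrite ler_wpM2r.
have up d i : (i + d.+1 = q)%N -> c i <= c i.+1 -> c i.+1 <= c q.
  elim: d i => [|d IH] i iq ci; first by rewrite -iq addn1.
  apply: le_trans (IH i.+1 _ _); [|lia|]; apply: step => //; lia.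
elim=> [_|i IH iq]; first by rewrite le_max lexx.
have [ci|/ltW ci] := leP (c i) (c i.+1); last exact: le_trans ci (IH (ltnW iq)).
rewrite le_max (up (q - i.+1)%N i)// ?orbT//; lia.
Qed.

End log_convex.

(** * Matrix norms *)

Section frobenius.
Variable R : realType.

Definition frob p q (A B : 'M[R]_(p, q)) : R := \tr (A *m B^T).

Lemma frobE p q (A B : 'M[R]_(p, q)) :
  frob A B = \sum_i \sum_j A i j * B i j.
Proof.
apply: eq_bigr => i _; rewrite mxE; apply: eq_bigr => j _; by rewrite mxE.
Qed.

Lemma frob_ge0 p q (A : 'M[R]_(p, q)) : 0 <= frob A A.
Proof.
by rewrite frobE; do 2![apply: sumr_ge0 => ? _]; rewrite -expr2 sqr_ge0.
Qed.

Lemma frobC p q (A B : 'M[R]_(p, q)) : frob A B = frob B A.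
Proof.
by rewrite !frobE; do 2![apply: eq_bigr => ? _]; rewrite mulrC.
Qed.

Lemma frobDl p q (A B C : 'M[R]_(p, q)) :
  frob (A + B) C = frob A C + frob B C.
Proof. by rewrite /frob mulmxDl mxtraceD. Qed.

Lemma frobZl p q a (A C : 'M[R]_(p, q)) : frob (a *: A) C = a * frob A C.
Proof. by rewrite /frob -scalemxAl mxtraceZ. Qed.

Lemma frobDr p q (A B C : 'M[R]_(p, q)) :
  frob C (A + B) = frob C A + frob C B.
Proof. by rewrite ![frob C _]frobC frobDl. Qed.

Lemma frobZr p q a (A C : 'M[R]_(p, q)) : frob C (a *: A) = a * frob C A.
Proof. by rewrite ![frob C _]frobC frobZl. Qed.

Lemma frob_CS p q (A B : 'M[R]_(p, q)) :
  frob A B ^+ 2 <= frob A A * frob B B.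
Proof.
have [B0|Bp] := eqVneq (frob B B) 0.
  suff -> : B = 0 by rewrite /frob trmx0 !mulmx0 mxtrace0 expr0n mulr0.
  move: B0; rewrite frobE => /eqP; rewrite psumr_eq0 => [|i _]; last first.
    by apply: sumr_ge0 => ? _; rewrite -expr2 sqr_ge0.
  move=> /allP H; apply/matrixP => i j; rewrite mxE.
  have /eqP := H i (mem_index_enum _) => /eqP.
  rewrite psumr_eq0 => [|k _]; last by rewrite -expr2 sqr_ge0.
  by move=> /allP /(_ j (mem_index_enum _)) /=; rewrite mulf_eq0 orbb => /eqP.
have {}Bp : 0 < frob B B by rewrite lt_neqAle eq_sym Bp frob_ge0.
have := frob_ge0 (frob B B *: A - frob A B *: B).
rewrite -scaleN1r !(frobDl, frobDr, frobZl, frobZr) (frobC B A).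
set a := frob A A; set b := frob B B; set c := frob A B => H.
have : 0 <= b * (a * b - c ^+ 2) by rewrite (le_trans H)// le_eqVlt; apply/orP; left; apply/eqP; ring.
by rewrite pmulr_rge0// subr_ge0.
Qed.

Lemma frob_enorm n (v : 'rV[R]_n) : frob v v = enorm v ^+ 2.
Proof.
rewrite /enorm sqr_sqrtr; last by apply: sumr_ge0 => ? _; rewrite sqr_ge0.
by rewrite frobE big_ord1; apply: eq_bigr => j _; rewrite expr2.
Qed.

Lemma frob_row p q (A : 'M[R]_(p, q)) :
  frob A A = \sum_i enorm (row i A) ^+ 2.
Proof.
rewrite frobE; apply: eq_bigr => i _; rewrite -frob_enorm frobE big_ord1.
by apply: eq_bigr => j _; rewrite !mxE.
Qed.

Lemma enorm_ge0 n (v : 'rV[R]_n) : 0 <= enorm v.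
Proof. exact: sqrtr_ge0. Qed.

Lemma enormZ n a (v : 'rV[R]_n) : enorm (a *: v) = `|a| * enorm v.
Proof.
apply/eqP; rewrite -(@eqrXn2 _ 2)// ?mulr_ge0 ?enorm_ge0//.
by rewrite exprMn -!frob_enorm frobZl frobZr mulrA -expr2 real_normK// num_real.
Qed.

Lemma enorm0 n : enorm (0 : 'rV[R]_n) = 0.
Proof. by rewrite -(scale0r (0 : 'rV[R]_n)) enormZ normr0 mul0r. Qed.

Lemma enormD n (u v : 'rV[R]_n) : enorm (u + v) <= enorm u + enorm v.
Proof.
rewrite -(@ler_pXn2r _ 2)// ?nnegrE ?addr_ge0 ?enorm_ge0//.
rewrite sqrrD -!frob_enorm !(frobDl, frobDr) (frobC v u).
have : frob u v <= enorm u * enorm v.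
  rewrite (le_trans (ler_norm _))// -(@ler_pXn2r _ 2)// ?nnegrE ?mulr_ge0 ?enorm_ge0//.
  by rewrite real_normK ?num_real// exprMn -!frob_enorm frob_CS.
lra.
Qed.

Lemma enorm_entry n (v : 'rV[R]_n) i : `|v 0 i| <= enorm v.
Proof.
rewrite -(@ler_pXn2r _ 2)// ?nnegrE ?enorm_ge0// real_normK ?num_real//.
rewrite -frob_enorm frobE big_ord1 (bigD1 i)//= -expr2 lerDl.
by apply: sumr_ge0 => j _; rewrite -expr2 sqr_ge0.
Qed.

Lemma enorm_mulmx n p (v : 'rV[R]_n) (A : 'M[R]_(p, n)) :
  enorm (v *m A^T) <= Num.sqrt (frob A A) * enorm v.
Proof.
rewrite -(@ler_pXn2r _ 2)// ?nnegrE ?mulr_ge0 ?sqrtr_ge0 ?enorm_ge0//.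
rewrite exprMn (sqr_sqrtr (frob_ge0 A)) -!frob_enorm [leLHS]frobE big_ord1.
rewrite (frob_row A) mulr_suml; apply: ler_sum => i _.
rewrite -expr2 mulrC -frob_enorm.
suff -> : (v *m A^T) 0 i = frob v (row i A) by exact: frob_CS.
by rewrite frobE big_ord1 mxE; apply: eq_bigr => j _; rewrite !mxE.
Qed.

End frobenius.

Section spectral_norm.
Variable R : realType.

(** [sup] is meaningful only for a nonempty bounded set; the Frobenius norm provides the bound. *)
Lemma spnorm_has_sup n (A : 'M[R]_n) :
  has_sup [set enorm (v *m A^T) | v in [set v : 'rV[R]_n | enorm v <= 1]].
Proof.
split; first by exists (enorm (0 *m A^T)), 0 => //=; rewrite enorm0.
exists (Num.sqrt (frob A A)) => _ [v /= v1 <-].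
by rewrite (le_trans (enorm_mulmx _ _))// ler_piMr ?sqrtr_ge0.
Qed.

Lemma spnorm_ge0 n (A : 'M[R]_n) : 0 <= spnorm A.
Proof.
apply: ub_le_sup; first by have [] := spnorm_has_sup A.
by exists 0; rewrite /= ?mul0mx enorm0.
Qed.

Lemma spnorm_ub n (A : 'M[R]_n) (v : 'rV[R]_n) :
  enorm (v *m A^T) <= spnorm A * enorm v.
Proof.
have [v0|vp] := eqVneq (enorm v) 0.
  by rewrite v0 mulr0 (le_trans (enorm_mulmx _ _))// v0 mulr0.
have {}vp : 0 < enorm v by rewrite lt_neqAle eq_sym vp enorm_ge0.
rewrite -ler_pdivrMr//; apply: ub_le_sup; first by have [] := spnorm_has_sup A.
exists ((enorm v)^-1 *: v).
  by rewrite /= enormZ ger0_norm ?invr_ge0 ?enorm_ge0// mulVf// gt_eqF.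
by rewrite -scalemxAl enormZ ger0_norm ?invr_ge0 ?enorm_ge0// mulrC.
Qed.

Lemma spnorm_le n (A : 'M[R]_n) c : 0 <= c ->
  (forall v : 'rV[R]_n, enorm (v *m A^T) <= c * enorm v) -> spnorm A <= c.
Proof.
move=> c0 H; apply: ge_sup; first by have [] := spnorm_has_sup A.
by move=> _ [v /= v1 <-]; rewrite (le_trans (H v))// ler_piMr.
Qed.

Lemma spnormZ n a (A : 'M[R]_n) : spnorm (a *: A) = `|a| * spnorm A.
Proof.
have H b (B : 'M[R]_n) : spnorm (b *: B) <= `|b| * spnorm B.
  apply: spnorm_le => [|v]; first by rewrite mulr_ge0// spnorm_ge0.
  rewrite linearZ/= -scalemxAr enormZ -mulrA ler_wpM2l// spnorm_ub//.
apply/eqP; rewrite eq_le H/=.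
have [->|a0] := eqVneq a 0; first by rewrite normr0 mul0r spnorm_ge0.
rewrite -ler_pdivlMl ?normr_gt0//.
by rewrite -normfV (le_trans _ (H _ _))// scalerA mulVf// scale1r.
Qed.

Lemma spnorm_entry n (A : 'M[R]_n) i j : `|A i j| <= spnorm A.
Proof.
have := enorm_entry (delta_mx 0 j *m A^T) i.
rewrite -rowE !mxE => /le_trans; apply.
rewrite rowE (le_trans (spnorm_ub _ _))//.
suff -> : enorm (delta_mx 0 j : 'rV[R]_n) = 1 by rewrite mulr1.
rewrite /enorm (bigD1 j)//= big1 => [|k kj]; rewrite mxE eqxx/=.
  by rewrite eqxx addr0 expr1n sqrtr1.
by rewrite (negbTE kj) expr0n.
Qed.

Lemma frob_mulmx_spnorm p n (B : 'M[R]_(p, n)) (A : 'M[R]_n) :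
  frob (B *m A^T) (B *m A^T) <= spnorm A ^+ 2 * frob B B.
Proof.
rewrite !frob_row mulr_sumr; apply: ler_sum => i _.
rewrite -exprMn row_mul lerXn2r ?nnegrE ?enorm_ge0 ?mulr_ge0 ?spnorm_ge0 ?enorm_ge0//.
exact: spnorm_ub.
Qed.

End spectral_norm.

(** * Trace inequalities for symmetric matrices *)

Section trace_powers.
Variables (R : realType) (n : nat).
Implicit Types X Y : 'M[R]_n.

Lemma trmxX X k : X^T = X -> (X ^+ k)^T = X ^+ k.
Proof.
move=> XT; elim: k => [|k IH]; first by rewrite expr0 trmx1.
by rewrite [in LHS]exprS [X * _]/(X *m _) trmx_mul IH XT [RHS]exprSr.
Qed.

Lemma frobX X i j : X^T = X -> frob (X ^+ i) (X ^+ j) = \tr (X ^+ (i + j)).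
Proof. by move=> XT; rewrite /frob trmxX// exprD. Qed.

Lemma trX_ge0 X k : X^T = X -> 0 <= \tr (X ^+ (k + k)).
Proof. by move=> XT; rewrite -frobX// frob_ge0. Qed.

Lemma trX_logconvex X k : X^T = X ->
  \tr (X ^+ (k.+1 + k.+1)) ^+ 2 <= \tr (X ^+ (k + k)) * \tr (X ^+ (k.+2 + k.+2)).
Proof.
move=> XT; rewrite (_ : (k.+1 + k.+1 = k + k.+2)%N); last by lia.
by rewrite -!frobX// frob_CS.
Qed.

(** The first term of the log-convex sequence of traces is tr 1 = n: this is where the dimension
    enters the estimates. *)
Lemma trX_holder X k : X^T = X ->
  \tr (X ^+ (k + k)) ^+ k.+1 <= n%:R * \tr (X ^+ (k.+1 + k.+1)) ^+ k.
Proof.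
move=> XT; have := @logconvex_tail _ (fun i => \tr (X ^+ (i + i))).
rewrite /= addn0 expr0 mxtrace1; apply => i; first exact: trX_ge0.
exact: trX_logconvex.
Qed.

(** For a fixed row v the numbers u_i = |v X^i|^2 are log-convex, so u_1^(k+1) <= u_0^k u_(k+1), and
    the Frobenius norm of X^(k+1) controls the last factor. *)
Lemma spnormX_le X k : X^T = X ->
  spnorm X ^+ (k.+1 + k.+1) <= \tr (X ^+ (k.+1 + k.+1)).
Proof.
move=> XT; set t := \tr _.
have t0 : 0 <= t by exact: trX_ge0.
have H (v : 'rV[R]_n) :
    enorm (v *m X^T) ^+ (k.+1 + k.+1) <= t * enorm v ^+ (k.+1 + k.+1).
  have E i j : frob (v *m X ^+ i) (v *m X ^+ j) = (v *m X ^+ (i + j) *m v^T) 0 0.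
    rewrite /frob trmx_mul trmxX// mulmxA -(mulmxA v).
    by rewrite -[_ *m X ^+ j]/(_ * X ^+ j) -exprD /mxtrace big_ord1.
  pose u i := frob (v *m X ^+ i) (v *m X ^+ i).
  have u0 i : 0 <= u i by exact: frob_ge0.
  have uu i : u i.+1 ^+ 2 <= u i * u i.+2.
    rewrite /u !E (_ : (i.+1 + i.+1 = i + i.+2)%N); last by lia.
    by rewrite -!E frob_CS.
  have uk : u k.+1 <= t * u 0%N.
    have := enorm_mulmx v (X ^+ k.+1); rewrite trmxX// => H2.
    rewrite /u expr0 mulmx1 !frob_enorm /t -frobX//.
    rewrite -(sqr_sqrtr (frob_ge0 (X ^+ k.+1))) -exprMn.
    by rewrite lerXn2r ?nnegrE ?mulr_ge0 ?sqrtr_ge0 ?enorm_ge0.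
  have := logconvex_head u0 uu k.
  move=> /le_trans /(_ (ler_wpM2l (exprn_ge0 _ (u0 _)) uk)).
  rewrite mulrCA -exprSr /u expr0 expr1 mulmx1 !frob_enorm -!exprM XT.
  by rewrite mul2n addnn.
have m0 : (k.+1 + k.+1)%:R != 0 :> R by rewrite pnatr_eq0.
(* The root of the trace is the constant for which the bound on powers becomes the linear one
   required by [spnorm_le]. *)
pose c := t `^ (k.+1 + k.+1)%:R^-1.
have ct : c ^+ (k.+1 + k.+1) = t.
  by rewrite -powR_mulrn ?powR_ge0// -powRrM mulVf// powRr1.
rewrite -ct lerXn2r ?nnegrE ?spnorm_ge0 ?powR_ge0//.
apply: spnorm_le; first exact: powR_ge0.
move=> v; rewrite -(@ler_pXn2r _ (k.+1 + k.+1)%N)//; last 2 first.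
- by rewrite nnegrE enorm_ge0.
- by rewrite nnegrE mulr_ge0 ?powR_ge0 ?enorm_ge0.
by rewrite exprMn ct.
Qed.

(** With B_i = X^i Y X^(q-i), the product of B_i and B_i' depends only on i + i'. Cauchy-Schwarz
    then makes |B_i|^2 log-convex on 0..q, hence largest at the ends, where Y stands outside the
    power of X. *)
Lemma tr_sandwich_le X Y q j : X^T = X -> Y^T = Y -> (j <= q + q)%N ->
  \tr (X ^+ j * Y * X ^+ (q + q - j) * Y) <= spnorm Y ^+ 2 * \tr (X ^+ (q + q)).
Proof.
move=> XT YT jq.
pose B i := X ^+ i *m Y *m X ^+ (q - i).
have BE i i' : (i <= q)%N -> (i' <= q)%N ->
    frob (B i) (B i') = \tr (X ^+ (i + i') * Y * X ^+ (q + q - (i + i')) * Y).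
  move=> iq iq'; rewrite /frob /B !trmx_mul !trmxX// YT.
  rewrite !mulmxA mxtrace_mulC !mulmxA -[X ^+ i' *m X ^+ i]/(X ^+ i' * X ^+ i) -exprD addnC.
  rewrite -(mulmxA _ (X ^+ (q - i))) -[X ^+ (q - i) *m _]/(X ^+ (q - i) * _) -exprD.
  by congr (\tr (_ *m X ^+ _ *m _)); lia.
have Bq : frob (B q) (B q) <= spnorm Y ^+ 2 * \tr (X ^+ (q + q)).
  rewrite /B subnn expr0 mulmx1 -{1 2}YT -frobX//; exact: frob_mulmx_spnorm.
have B0 : frob (B 0) (B 0) = frob (B q) (B q).
  by rewrite !BE// addn0 subn0 subnn expr0 mul1r mulr1 -[in LHS]mulrA mxtrace_mulC.
have Bi i : (i <= q)%N -> frob (B i) (B i) <= spnorm Y ^+ 2 * \tr (X ^+ (q + q)).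
  move=> iq; apply: le_trans Bq; rewrite -[leRHS]maxxx -{1}B0.
  apply: (@logconvex_max _ (fun i => frob (B i) (B i))) => // [k|k kq].
    exact: frob_ge0.
  rewrite BE ?(ltnW kq)// (_ : (k.+1 + k.+1 = k + k.+2)%N); last by lia.
  by rewrite -BE ?frob_CS//; lia.
(* Any splitting of [j] into two indices at most [q] would do; a last Cauchy-Schwarz reduces to the
   two squares. *)
have D : (j = j./2 + (j - j./2))%N by lia.
rewrite D -BE; [|lia|lia].
have T0 : 0 <= spnorm Y ^+ 2 * \tr (X ^+ (q + q)) by rewrite mulr_ge0 ?sqr_ge0 ?trX_ge0.
rewrite -(ger0_norm T0) (le_trans (ler_norm _))//.
rewrite -(@ler_pXn2r _ 2)// ?nnegrE// !real_normK ?num_real//.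
rewrite (le_trans (frob_CS _ _))// (expr2 (_ * \tr _)).
by rewrite ler_pM ?frob_ge0// Bi//; lia.
Qed.

End trace_powers.

(** * Smoothness of the Schatten norm *)

Section calculus.
Variable R : realType.
Implicit Types (f g h dh ddh : R -> R) (t K : R).

Lemma is_derive_add f g t df dg : is_derive t 1 f df -> is_derive t 1 g dg ->
  is_derive t 1 (fun s => f s + g s) (df + dg).
Proof. by move=> hf hg; exact: is_deriveD. Qed.

Lemma is_derive_mul f g t df dg : is_derive t 1 f df -> is_derive t 1 g dg ->
  is_derive t 1 (fun s => f s * g s) (df * g t + f t * dg).
Proof.
by move=> hf hg; apply: is_derive_eq (is_deriveM hf hg) _; rewrite /GRing.scale/=; ring.
Qed.

Lemma is_derive_cmul f t df K : is_derive t 1 f df ->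
  is_derive t 1 (fun s => K * f s) (K * df).
Proof. by move=> hf; exact: (is_deriveZ K hf). Qed.

Lemma is_derive_const t K : is_derive t 1 (fun=> K) 0.
Proof. exact: is_derive_cst. Qed.

Lemma is_derive_bigsum n (F : 'I_n -> R -> R) dF t :
  (forall i, is_derive t 1 (F i) (dF i)) ->
  is_derive t 1 (fun s => \sum_i F i s) (\sum_i dF i).
Proof.
move=> hF; have := @is_derive_sum _ _ _ n F t 1 dF hF.
by rewrite (_ : \sum_(i < n) F i = fun s => \sum_i F i s)//; apply/funext => s; rewrite fct_sumE.
Qed.

Lemma mvt_le h dh K t : (forall s : R, is_derive s 1 h (dh s)) ->
  (forall s : R, 0 <= s <= 1 -> dh s <= K) -> 0 <= t <= 1 -> h t <= h 0 + K * t.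
Proof.
move=> hd hK /andP[t0 t1].
have [|c] := @MVT_segment R h dh 0 t t0 (fun x _ => hd x).
  apply: continuous_subspaceT => x.
  by apply: differentiable_continuous; apply/derivable1_diffP; exact: ex_derive.
rewrite in_itv/= subr0 => /andP[c0 ct] /eqP; rewrite subr_eq => /eqP ->.
by rewrite addrC lerD2l ler_wpM2r// hK// c0 (le_trans ct).
Qed.

(** The mean value bound is used twice: on [dh], then on h(s) - K s^2 / 2, whose derivative stays
    below dh(0). *)
Lemma taylor2_le h dh ddh K : (forall s : R, is_derive s 1 h (dh s)) ->
  (forall s : R, is_derive s 1 dh (ddh s)) ->
  (forall s : R, 0 <= s <= 1 -> ddh s <= K) -> h 1 <= h 0 + dh 0 + K / 2.
Proof.
move=> hd hdd hK.
have H (s : R) : is_derive s 1 (fun s => h s + - (K / 2) * (s * s)) (dh s + - (K * s)).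
  have I : is_derive s (1 : R) (fun s : R => s) 1 by exact: is_derive_id.
  apply: is_derive_eq (is_derive_add (hd s) (is_derive_cmul (- (K / 2)) (is_derive_mul I I))) _.
  by field.
have := mvt_le H (K := dh 0) (t := 1).
rewrite ler01 lexx/= => /(_ _ isT) H'.
have {}H' : h 1 + - (K / 2) * (1 * 1) <= h 0 + - (K / 2) * (0 * 0) + dh 0 * 1.
  apply: H' => s s01; have := mvt_le hdd hK s01; lra.
lra.
Qed.

Lemma is_derive_mulmx m n p (A : R -> 'M[R]_(m, n)) (B : R -> 'M[R]_(n, p))
    (A' : 'M[R]_(m, n)) (B' : 'M[R]_(n, p)) t :
  (forall i j, is_derive t 1 (fun s => A s i j) (A' i j)) ->
  (forall i j, is_derive t 1 (fun s => B s i j) (B' i j)) ->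
  forall i j, is_derive t 1 (fun s => (A s *m B s) i j) ((A' *m B t + A t *m B') i j).
Proof.
move=> hA hB i j; rewrite (_ : (fun _ => _) = (fun s => \sum_k A s i k * B s k j)); last first.
  by apply/funext => s; rewrite mxE.
apply: is_derive_eq (is_derive_bigsum (fun k => is_derive_mul (hA i k) (hB k j))) _.
by rewrite !mxE -big_split.
Qed.

Lemma is_derive_mxtrace n (A : R -> 'M[R]_n) (A' : 'M[R]_n) t :
  (forall i j, is_derive t 1 (fun s => A s i j) (A' i j)) ->
  is_derive t 1 (fun s => \tr (A s)) (\tr A').
Proof. by move=> hA; exact: is_derive_bigsum. Qed.

Section line.
Variables (n : nat) (X Y : 'M[R]_n).
Let Z s := X + s *: Y.

Lemma is_derive_line t i j : is_derive t 1 (fun s => Z s i j) (Y i j).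
Proof.
rewrite /Z (_ : (fun _ => _) = (fun s => X i j + Y i j * s)); last first.
  by apply/funext => s; rewrite !mxE mulrC.
have I : is_derive t (1 : R) (fun s : R => s) 1 by exact: is_derive_id.
apply: is_derive_eq (is_derive_add (is_derive_const _ _) (is_derive_cmul _ I)) _.
by rewrite add0r mulr1.
Qed.

Lemma is_derive_lineX m t i j : is_derive t 1 (fun s => (Z s ^+ m) i j)
  ((\sum_(a < m) Z t ^+ a * Y * Z t ^+ (m - a.+1)) i j).
Proof.
elim: m i j => [|m IH] i j; first by rewrite big_ord0 [X in is_derive _ _ _ X]mxE; exact: is_derive_const.
rewrite (_ : (fun _ => _) = (fun s => (Z s *m Z s ^+ m) i j)); last first.
  by apply/funext => s; rewrite exprS.
apply: is_derive_eq (is_derive_mulmx (is_derive_line t) IH i j) _.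
congr (fun_of_matrix _ _ _).
rewrite big_ord_recl expr0 mul1r subn1/=; congr (_ + _).
rewrite -[_ *m _]/(_ * _) mulr_sumr; apply: eq_bigr => a _.
by rewrite exprS subSS !mulrA.
Qed.

(** Cyclicity of the trace merges all terms of the noncommutative power rule. *)
Lemma is_derive_trX m t :
  is_derive t 1 (fun s => \tr (Z s ^+ m.+1)) (m.+1%:R * \tr (Z t ^+ m * Y)).
Proof.
apply: is_derive_eq (is_derive_mxtrace (is_derive_lineX m.+1 t)) _.
rewrite raddf_sum/= -[in RHS]mulr_natl mulr_natl.
rewrite (eq_bigr (fun=> \tr (Z t ^+ m * Y))).
  by rewrite sumr_const card_ord mulr_natl.
move=> a _; rewrite mxtrace_mulC -[_ *m _]/(_ * _) mulrA -exprD.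
by congr (\tr (_ ^+ _ * _)); have := ltn_ord a; lia.
Qed.

(** Here two factors Y are separated by powers, so the terms do not merge; [tr_sandwich_le] is made
    for these summands. *)
Lemma is_derive_trXY m t :
  is_derive t 1 (fun s => \tr (Z s ^+ m * Y))
    (\sum_(a < m) \tr (Z t ^+ a * Y * Z t ^+ (m - a.+1) * Y)).
Proof.
have hY i j : is_derive t 1 (fun=> Y i j) ((0 : 'M[R]_n) i j).
  by rewrite mxE; exact: is_derive_const.
have H := is_derive_mulmx (is_derive_lineX m t) hY.
have H2 : forall i j, is_derive t 1 (fun s => (Z s ^+ m *m Y) i j)
    (((\sum_(a < m) Z t ^+ a * Y * Z t ^+ (m - a.+1)) *m Y) i j).
  move=> i j; apply: is_derive_eq (H i j) _.
  by rewrite mulmx0 addr0.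
apply: is_derive_eq (is_derive_mxtrace H2) _.
by rewrite mulmx_suml raddf_sum.
Qed.
End line.

Lemma is_derive_div f g t df dg : is_derive t 1 f df -> is_derive t 1 g dg ->
  g t != 0 -> is_derive t 1 (fun s => f s / g s) (df / g t - f t * dg / g t ^+ 2).
Proof.
move=> hf hg g0; apply: is_derive_eq (is_derive_mul hf (is_deriveV g0 hg)) _.
by rewrite /GRing.scale/= !mulrA mulrN mulNr -exprVn; congr (_ - _); rewrite mulrAC.
Qed.
End calculus.

Section schatten_smoothness.
Variables (R : realType) (n q : nat) (eps : R).
Hypothesis eps_gt0 : 0 < eps.
Implicit Types X Y : 'M[R]_n.

Let beta : R := (q.+1 + q.+1)%:R^-1.

(** The exponent is the even number 2p with p = q + 1. The term [eps] keeps the value positive at X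
    = 0, where the root would not be differentiable. *)
Definition sch_pow X : R := \tr (X ^+ (q.+1 + q.+1)) + eps.
Definition sch_norm X : R := sch_pow X `^ beta.
(** The Schatten 2p-norm of the identity, that is, the loss when a spectral norm is replaced by a
    Schatten norm. *)
Definition sch_dim : R := n%:R `^ beta.

Lemma sch_pow_gt0 X : X^T = X -> 0 < sch_pow X.
Proof. by move=> XT; rewrite ltr_wpDl// trX_ge0. Qed.

Lemma sch_norm_gt0 X : X^T = X -> 0 < sch_norm X.
Proof. by move=> XT; rewrite powR_gt0// sch_pow_gt0. Qed.

Lemma sch_dim_ge0 : 0 <= sch_dim. Proof. exact: powR_ge0. Qed.

Lemma sch_normX X : X^T = X -> sch_norm X ^+ (q.+1 + q.+1) = sch_pow X.
Proof.
move=> XT; rewrite -powR_mulrn ?powR_ge0// -powRrM mulVf ?pnatr_eq0//.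
by rewrite powRr1// ltW// sch_pow_gt0.
Qed.

Lemma sch_dimX : sch_dim ^+ (q.+1 + q.+1) = n%:R.
Proof.
by rewrite -powR_mulrn ?powR_ge0// -powRrM mulVf ?pnatr_eq0// powRr1.
Qed.

Lemma spnorm_le_sch X : X^T = X -> spnorm X <= sch_norm X.
Proof.
move=> XT; rewrite -(@ler_pXn2r _ (q.+1 + q.+1)%N)//; last 2 first.
- by rewrite nnegrE spnorm_ge0.
- by rewrite nnegrE ltW// sch_norm_gt0.
by rewrite sch_normX// (le_trans (spnormX_le q XT))// lerDl ltW.
Qed.

(** This is [trX_holder] after extraction of a root; adding [eps] only enlarges the right-hand
    side. *)
Lemma trX_le_sch X : X^T = X ->
  \tr (X ^+ (q + q)) <= sch_dim ^+ 2 * sch_norm X ^+ (q + q).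
Proof.
move=> XT; rewrite -(@ler_pXn2r _ q.+1)//; last 2 first.
- by rewrite nnegrE trX_ge0.
- by rewrite nnegrE mulr_ge0// exprn_ge0// ?sch_dim_ge0// ltW// sch_norm_gt0.
rewrite (le_trans (trX_holder q XT))// exprMn -!exprM.
rewrite (_ : (2 * q.+1 = q.+1 + q.+1)%N); last by lia.
rewrite sch_dimX (_ : ((q + q) * q.+1 = (q.+1 + q.+1) * q)%N); last by lia.
rewrite ler_wpM2l// exprM sch_normX// lerXn2r// ?nnegrE ?trX_ge0//.
  by rewrite ltW// sch_pow_gt0.
by rewrite lerDl ltW.
Qed.

(** Cauchy-Schwarz for X^p and Y X^(p-1). The quotient on the right is N^(2p-1), so the bound says
    that the derivative of N in the direction Y is at most n^(1/2p) |Y|. *)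
Lemma trXY_le_sch X Y : X^T = X -> Y^T = Y ->
  `|\tr (X ^+ (q + q).+1 * Y)| <=
    sch_dim * spnorm Y * (sch_pow X / sch_norm X).
Proof.
move=> XT YT; have N0 := sch_norm_gt0 XT.
have r0 : 0 <= sch_dim * spnorm Y * (sch_pow X / sch_norm X).
  by rewrite !mulr_ge0 ?sch_dim_ge0 ?spnorm_ge0 ?invr_ge0 ?ltW// sch_pow_gt0.
rewrite -(@ler_pXn2r _ 2)// ?nnegrE//.
rewrite real_normK ?num_real//.
have -> : \tr (X ^+ (q + q).+1 * Y) = frob (X ^+ q.+1) (Y *m X ^+ q).
  rewrite /frob trmx_mul trmxX// YT mulmxA.
  by rewrite -[X ^+ q.+1 *m _]/(X ^+ q.+1 * _) -exprD.
apply: le_trans (frob_CS _ _) _.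
have -> : frob (Y *m X ^+ q) (Y *m X ^+ q) = frob (X ^+ q *m Y^T) (X ^+ q *m Y^T).
  by rewrite /frob !trmx_mul trmxX// trmxK YT mxtrace_mulC.
rewrite frobX//.
have H1 : \tr (X ^+ (q.+1 + q.+1)) <= sch_pow X by rewrite lerDl ltW.
have H2 : frob (X ^+ q *m Y^T) (X ^+ q *m Y^T) <=
    spnorm Y ^+ 2 * (sch_dim ^+ 2 * sch_norm X ^+ (q + q)).
  rewrite (le_trans (frob_mulmx_spnorm _ _))// ler_wpM2l ?sqr_ge0//.
  by rewrite frobX// trX_le_sch.
rewrite (le_trans (ler_pM _ _ H1 H2)) ?frob_ge0 ?trX_ge0//.
rewrite -(sch_normX XT) addSn exprS addnS exprS.
rewrite le_eqVlt; apply/orP; left; apply/eqP; field.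
by rewrite gt_eqF.
Qed.

Section line.
Variables (X Y : 'M[R]_n).
Hypotheses (XT : X^T = X) (YT : Y^T = Y).
Let Z s := X + s *: Y.
Let ZT s : (Z s)^T = Z s. Proof. by rewrite linearD linearZ/= XT YT. Qed.
Let tau s := \tr (Z s ^+ (q + q).+1 * Y).

Lemma is_derive_sch_pow (t : R) : is_derive t 1 (fun s => sch_pow (Z s))
  ((q.+1 + q.+1)%:R * tau t).
Proof.
have := is_derive_add (is_derive_trX X Y (q + q).+1 t) (is_derive_const t eps).
by rewrite addr0 /sch_pow addSn addnS.
Qed.

Lemma is_derive_sch_norm (t : R) : is_derive t 1 (fun s => sch_norm (Z s))
  (sch_norm (Z t) * tau t / sch_pow (Z t)).
Proof.
have Pt := sch_pow_gt0 (ZT t).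
have hP := is_derive_sch_pow t.
have := @is_derive1_comp R (fun x : R => x `^ beta) (fun s => sch_pow (Z s)) t _ _
  (is_derive1_powR beta Pt) hP.
move=> H; apply: is_derive_eq H _.
rewrite /GRing.scale/= powRB ?(gt_eqF Pt) ?implybT//.
rewrite powRr1 ?ltW// /sch_norm /beta; field.
by rewrite gt_eqF// gt_eqF// ltr0n.
Qed.

(** The derivative bound is integrated along the segment, which takes the place of a triangle
    inequality. *)
Lemma sch_norm_lip t : 0 <= t <= 1 ->
  sch_norm (Z t) <= sch_norm X + sch_dim * spnorm Y.
Proof.
move=> t01; have := mvt_le (K := sch_dim * spnorm Y) is_derive_sch_norm _ t01.
rewrite /= /Z scale0r addr0 => H; apply: le_trans (H _) _.
  move=> s _; have P := sch_pow_gt0 (ZT s); have N := sch_norm_gt0 (ZT s).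
  rewrite ler_pdivrMr// -ler_pdivlMl// (le_trans (ler_norm _))//.
  rewrite (le_trans (trXY_le_sch (ZT s) YT))// le_eqVlt; apply/orP; left.
  by apply/eqP; ring.
by rewrite lerD2l ler_piMr ?mulr_ge0 ?sch_dim_ge0 ?spnorm_ge0//; case/andP: t01.
Qed.

(* [3/2 (2p - 1) n^(1/p) |Y|^2 (N X + n^(1/2p) |Y|)] bounds half of the second
   derivative of [N^3] along the segment; [2p = 2q + 2]. *)
Lemma sch_norm3_taylor : (0 < q)%N ->
  sch_norm (X + Y) ^+ 3 <= sch_norm X ^+ 3
    + 3 * (sch_norm X ^+ 3 / sch_pow X) * \tr (X ^+ (q + q).+1 * Y)
    + 3 / 2 * (q + q).+1%:R * sch_dim ^+ 2 * spnorm Y ^+ 2 *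
      (sch_norm X + sch_dim * spnorm Y).
Proof.
move=> q0; pose N s := sch_norm (Z s); pose P s := sch_pow (Z s).
pose tau' s := \sum_(a < (q + q).+1) \tr (Z s ^+ a * Y * Z s ^+ ((q + q).+1 - a.+1) * Y).
have P0 s : 0 < P s by exact: sch_pow_gt0.
have N0 s : 0 < N s by exact: sch_norm_gt0.
have hP (t : R) : is_derive t 1 P ((q.+1 + q.+1)%:R * tau t) := is_derive_sch_pow t.
have hN (t : R) : is_derive t 1 N (N t * tau t / P t) := is_derive_sch_norm t.
have hN3 (t : R) : is_derive t 1 (fun s => N s * N s * N s) (3 * (N t * N t * N t * tau t / P t)).
  apply: is_derive_eq (is_derive_mul (is_derive_mul (hN t) (hN t)) (hN t)) _.
  by ring.
have hdN3 (t : R) : is_derive t 1 (fun s => 3 * (N s * N s * N s * tau s / P s))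
    (3 * N t ^+ 3 * (tau' t / P t - (q + q).-1%:R * tau t ^+ 2 / P t ^+ 2)).
  have htau : is_derive t 1 tau (tau' t) := is_derive_trXY X Y (q + q).+1 t.
  have hNt := is_derive_mul (is_derive_mul (is_derive_mul (hN t) (hN t)) (hN t)) htau.
  apply: is_derive_eq (is_derive_cmul 3 (is_derive_div hNt (hP t) _)) _; first by rewrite gt_eqF.
  have -> : (q.+1 + q.+1)%:R = (q + q).-1%:R + 3 :> R.
    by rewrite -natrD; congr (_%:R); lia.
  by field; rewrite gt_eqF.
pose K := 3 * (q + q).+1%:R * sch_dim ^+ 2 * spnorm Y ^+ 2 * (sch_norm X + sch_dim * spnorm Y).
have hK (s : R) : 0 <= s <= 1 ->
    3 * N s ^+ 3 * (tau' s / P s - (q + q).-1%:R * tau s ^+ 2 / P s ^+ 2) <= K.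
  move=> s01.
  (* The factor 2p - 1 counts the summands, all of which obey the same sandwich bound. *)
  have tau's : tau' s <= (q + q).+1%:R * (spnorm Y ^+ 2 * (sch_dim ^+ 2 * N s ^+ (q + q))).
    rewrite /tau' -[X in X%:R * _]card_ord -sum1_card natr_sum mulr_suml.
    apply: ler_sum => a _; rewrite mul1r subSS.
    apply: le_trans (@tr_sandwich_le _ _ _ _ _ _ (ZT s) YT _) _; first by rewrite -ltnS.
    by rewrite ler_wpM2l ?sqr_ge0// trX_le_sch.
  have N3 : 0 <= 3 * N s ^+ 3 by rewrite mulr_ge0// exprn_ge0// ltW.
  apply: (@le_trans _ _ (3 * N s ^+ 3 * (tau' s / P s))).
    rewrite (ler_wpM2l N3)// gerBl.
    by rewrite mulr_ge0 ?invr_ge0 ?sqr_ge0// mulr_ge0 ?sqr_ge0.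
  apply: (@le_trans _ _ (3 * (q + q).+1%:R * sch_dim ^+ 2 * spnorm Y ^+ 2 * N s)).
    apply: (@le_trans _ _ (3 * N s ^+ 3 * ((q + q).+1%:R * (spnorm Y ^+ 2 * (sch_dim ^+ 2 * N s ^+ (q + q))) / P s))).
      by rewrite (ler_wpM2l N3)// ler_wpM2r// invr_ge0 ltW.
    rewrite /P -sch_normX// -/(N s) addSn addnS (exprSr _ (q + q).+1) (exprSr _ (q + q)).
    move: (N0 s); move: (N s) => x x0.
    rewrite le_eqVlt; apply/orP; left; apply/eqP; field.
    by rewrite expf_neq0 gt_eqF.
  by rewrite /K ler_wpM2l ?sch_norm_lip// !mulr_ge0 ?sqr_ge0 ?sch_dim_ge0 ?spnorm_ge0.
have := taylor2_le hN3 hdN3 hK; rewrite /K.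
have -> : sch_norm (X + Y) = N 1 by rewrite /N /Z scale1r.
have -> : sch_norm X = N 0 by rewrite /N /Z scale0r addr0.
have -> : \tr (X ^+ (q + q).+1 * Y) = tau 0 by rewrite /tau /Z scale0r addr0.
have -> : sch_pow X = P 0 by rewrite /P /Z scale0r addr0.
move: (N 1) (N 0) (tau 0) (P 0) (P0 0) sch_dim (spnorm Y) ((q + q).+1%:R : R).
move=> a b c e e0 u v w; rewrite !mulrA.
have cube (x : R) : x * x * x = x ^+ 3 by ring.
rewrite !cube => /le_trans; apply.
rewrite le_eqVlt; apply/orP; left; apply/eqP; field.
by rewrite gt_eqF.
Qed.
End line.
End schatten_smoothness.

(** * Conditional expectation and independence *)

Section sub_sigma_algebra.
Import HBNNSimple.
Context d (T : measurableType d) (R : realType) (mu : {measure set T -> \bar R}).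
Implicit Types (C : set (set T)) (f g h : T -> \bar R).
Local Open Scope ereal_scope.

Definition ind (A : set T) (w : T) : \bar R := (\1_A w)%:E.

Lemma ind_ge0 A w : 0 <= ind A w.
Proof. by rewrite lee_fin indicE. Qed.

Lemma measurable_ind A : measurable A -> measurable_fun setT (ind A).
Proof. by move=> mA; apply/measurable_EFinP; exact: measurable_indic. Qed.

Lemma ind_patch A f : f \_ A = (fun w => ind A w * f w).
Proof.
apply/funext => w; rewrite patchE /ind indicE; case: ifPn => _.
  by rewrite mul1e.
by rewrite mul0e.
Qed.

Lemma integral_ind A f : \int[mu]_(w in A) f w = \int[mu]_w (ind A w * f w).
Proof. by rewrite integral_mkcond ind_patch. Qed.

Lemma indI A B w : ind (A `&` B) w = ind A w * ind B w.
Proof. by rewrite /ind indicI. Qed.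

Definition sub_measurable_fun C h :=
  measurable_fun [set: g_sigma_algebraType C] (h : g_sigma_algebraType C -> \bar R).

Lemma sub_measurable_funT C h : (forall A, C A -> d.-measurable A) ->
  sub_measurable_fun C h -> measurable_fun setT h.
Proof.
by move=> Cm mh _ B mB; apply: (sub_gen_measurable Cm); exact: mh.
Qed.

Lemma sub_measurable_ind C A : C.-sigma.-measurable A -> sub_measurable_fun C (ind A).
Proof.
move=> mA; apply/measurable_EFinP.
exact: (@measurable_indic _ (g_sigma_algebraType C)).
Qed.

Lemma sub_measurable_funM C f g :
  sub_measurable_fun C f -> sub_measurable_fun C g ->
  sub_measurable_fun C (fun w => f w * g w).
Proof. by move=> mf mg; exact: emeasurable_funM. Qed.

Lemma integral_nnsfun_mul C (Cm : forall A, C A -> d.-measurable A)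
    (phi : {nnsfun g_sigma_algebraType C >-> R}) f :
  measurable_fun setT f -> (forall w, 0 <= f w) ->
  \int[mu]_w ((phi w)%:E * f w) =
  \sum_(y \in range phi)
    (y%:E * \int[mu]_(w in (phi @^-1` [set y] : set T)) f w).
Proof.
move=> mf f0.
have mphi y : d.-measurable (phi @^-1` [set y] : set T).
  by apply: (sub_gen_measurable Cm); exact: (measurable_sfunP phi).
have t0 y w : 0 <= y%:E * ind (phi @^-1` [set y]) w.
  exact: (nnfun_muleindic_ge0 phi y w).
transitivity (\int[mu]_w (\sum_(y \in range phi)
    (y%:E * (ind (phi @^-1` [set y]) w * f w)))).
  apply: eq_integral => w _; rewrite [in LHS]fimfunE -fsumEFin//.
  rewrite ge0_mule_fsuml//; last by move=> y; rewrite EFinM; exact: t0.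
  by apply: eq_fsbigr => y _; rewrite EFinM muleA.
rewrite ge0_integral_fsum//; last 2 first.
- move=> y; apply: measurable_funeM; apply: emeasurable_funM => //.
  exact: measurable_ind.
- by move=> y w _; rewrite muleA mule_ge0.
apply: eq_fsbigr => y; rewrite inE => -[x _ <-].
rewrite ge0_integralZl_EFin//.
- by rewrite -integral_ind.
- by move=> w _; rewrite mule_ge0// ind_ge0.
- by apply: emeasurable_funM => //; exact: measurable_ind.
Qed.

(** Simple functions and monotone convergence pass from events to weights. This is how known factors
    are taken out of a conditional expectation, with values +oo allowed. *)
Lemma le_integral_weight C (Cm : forall A, C A -> d.-measurable A) f g h :
  measurable_fun setT f -> (forall w, 0 <= f w) ->
  measurable_fun setT g -> (forall w, 0 <= g w) ->
  sub_measurable_fun C h -> (forall w, 0 <= h w) ->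
  (forall A, C.-sigma.-measurable A ->
     \int[mu]_(w in A) f w <= \int[mu]_(w in A) g w) ->
  \int[mu]_w (h w * f w) <= \int[mu]_w (h w * g w).
Proof.
move=> mf f0 mg g0 mh h0 fg.
pose phi := nnsfun_approx measurableT mh.
have mphi n : measurable_fun setT (fun w : T => (phi n w)%:E).
  by apply: (sub_measurable_funT Cm); apply/measurable_EFinP.
have cvg e (me : measurable_fun setT e) (e0 : forall w, 0 <= e w) :
    \int[mu]_w ((phi n w)%:E * e w) @[n --> \oo]
    --> \int[mu]_w (h w * e w).
  have lime w : (phi n w)%:E * e w @[n --> \oo] --> h w * e w.
    have ph := cvg_nnsfun_approx measurableT mh (fun w _ => h0 w) (x := w) I.
    (* The limit law for products excludes 0 times infinity, so zero factors are treated apart; the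
       approximants lie below [h] and vanish with it. *)
    have [hw0|hw0] := eqVneq (h w) 0.
      rewrite hw0 mul0e.
      have -> : (fun n => (phi n w)%:E * e w) = cst 0.
        apply/funext => n /=.
        have : (phi n w)%:E <= h w by rewrite nnsfun_approxE; apply: le_approx.
        rewrite hw0 lee_fin => H.
        have : (phi n w) == 0%R by rewrite eq_le H/=.
        by move=> /eqP ->; rewrite mul0e.
      exact: cvg_cst.
    have [ew0|ew0] := eqVneq (e w) 0.
      rewrite ew0 mule0; under eq_fun do rewrite mule0.
      exact: cvg_cst.
    apply: cvgeM => //; last exact: cvg_cst.
    have [hf|hi] := boolP (h w \is a fin_num); last exact: mule_def_infty_neq0.
    have [ef|ei] := boolP (e w \is a fin_num); first exact: mule_def_fin.
    exact: mule_def_neq0_infty.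
  have := @cvg_monotone_convergence _ _ _ mu setT measurableT
     (fun n w => (phi n w)%:E * e w).
  rewrite (_ : (fun w => limn _) = (fun w => h w * e w)); last first.
    by apply/funext => w; apply/cvg_lim.
  apply => [n|n w _|w _ m n mn].
  - exact: emeasurable_funM.
  - by rewrite mule_ge0// lee_fin.
  - by rewrite lee_wpmul2r// lee_fin;
    have /lefP := nd_nnsfun_approx measurableT mh mn; apply.
rewrite -(cvg_lim _ (cvg f mf f0))// -(cvg_lim _ (cvg g mg g0))//.
apply: lee_lim.
- by apply: cvgP (cvg f mf f0).
- by apply: cvgP (cvg g mg g0).
apply: nearW => n; rewrite !integral_nnsfun_mul//.
apply: lee_fsum => //.
move=> _ [w _ <-]; rewrite lee_wpmul2l ?lee_fin//.
by apply: fg; exact: (measurable_sfunP (phi n)).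
Qed.

Lemma eq_integral_weight C (Cm : forall A, C A -> d.-measurable A) f g h :
  measurable_fun setT f -> (forall w, 0 <= f w) ->
  measurable_fun setT g -> (forall w, 0 <= g w) ->
  sub_measurable_fun C h -> (forall w, 0 <= h w) ->
  (forall A, C.-sigma.-measurable A ->
     \int[mu]_(w in A) f w = \int[mu]_(w in A) g w) ->
  \int[mu]_w (h w * f w) = \int[mu]_w (h w * g w).
Proof.
move=> mf f0 mg g0 mh h0 fg; apply/eqP; rewrite eq_le.
by rewrite !(le_integral_weight Cm)// => A mA; rewrite fg.
Qed.

(** Dynkin's argument. The finite integral of [f] permits the subtraction needed for differences of
    events. *)
Lemma pi_system_integral_eq C (Cm : forall A, C A -> d.-measurable A) f g :
  measurable_fun setT f -> (forall w, 0 <= f w) ->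
  measurable_fun setT g -> (forall w, 0 <= g w) ->
  \int[mu]_w f w < +oo -> setI_closed C -> C setT ->
  (forall A, C A -> \int[mu]_(w in A) f w = \int[mu]_(w in A) g w) ->
  forall A, C.-sigma.-measurable A ->
    \int[mu]_(w in A) f w = \int[mu]_(w in A) g w.
Proof.
move=> mf f0 mg g0 integral_fin CI CT fg.
pose H := [set A : set T | d.-measurable A /\
  \int[mu]_(w in A) f w = \int[mu]_(w in A) g w].
suff lH : lambda_system setT H.
  move=> A mA; suff [] : H A by [].
  by apply: (lambda_system_subset CI lH) => // B CB; split; [exact: Cm|exact: fg].
split => //.
- by split => //; exact: fg.
- move=> A B BA [mA IA] [mB IB]; split; first exact: measurableD.
  have fB : \int[mu]_(w in B) f w \is a fin_num.
    rewrite ge0_fin_numE; last exact: integral_ge0.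
    by apply: le_lt_trans integral_fin; apply: ge0_subset_integral.
  have D e (me : measurable_fun setT e) (e0 : forall w, 0 <= e w) :
      \int[mu]_(w in A) e w = \int[mu]_(w in B) e w + \int[mu]_(w in A `\` B) e w.
    rewrite -ge0_integral_setU//.
    + by rewrite setDUK.
    + exact: measurableD.
    + exact: measurable_funTS.
    + by rewrite disj_set2E setDIK.
  have := IA; rewrite (D f mf f0) (D g mg g0) -IB.
  move=> /(congr1 (fun x => x - \int[mu]_(w in B) f w)).
  by rewrite !(addeC (\int[mu]_(w in B) f w)) !addeK.
- move=> F ndF HF; have mF n : d.-measurable (F n) by have [] := HF n.
  split; first exact: bigcupT_measurable.
  have L e (me : measurable_fun setT e) (e0 : forall w, 0 <= e w) :=
    @ge0_nondecreasing_set_cvg_integral _ _ _ F e mu ndF mF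
      (fun=> measurable_funTS me) (fun _ w _ => e0 w).
  rewrite -(cvg_lim _ (L f mf f0))// -(cvg_lim _ (L g mg g0))//.
  by congr (limn _); apply/funext => n; have [] := HF n.
Qed.
End sub_sigma_algebra.

Arguments ind {d T R} A w.
Arguments sub_measurable_fun {d T R} C h.

Section cond_exp_theory.
Context d (T : measurableType d) (R : realType) (P : probability T R).
Variables (G : set (set T)) (Gm : forall A, G A -> d.-measurable A).
Implicit Types (Z : T -> R) (V : T -> \bar R).
Local Open Scope ereal_scope.

Lemma is_cond_exp_measurable Z V : is_cond_exp P G Z V -> measurable_fun setT V.
Proof. by move=> [_ mV _]; exact: (sub_measurable_funT Gm). Qed.

(** For a nonnegative variable [cond_exp] still subtracts a chosen version of E[0 | G], which is
    zero only almost surely. *)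
Lemma cond_exp_nneg0 : {ae P, forall w, cond_exp_nneg P G (cst 0%R) w = 0}.
Proof.
have HV := cond_exp_nnegP P Gm (measurable_cst (0%R : R)) (fun=> lexx _).
have mV := is_cond_exp_measurable HV; have [V0 _ VI] := HV.
have := VI setT (@measurableT _ (g_sigma_algebraType G)).
rewrite [RHS]integral0_eq// => I0.
have := ae_eq_integral_abs P measurableT mV.
under eq_integral do rewrite gee0_abs//.
move=> [/(_ I0) + _]; apply: filterS => w H; exact: H.
Qed.

Lemma cond_exp_nnegE Z : (forall w, 0 <= Z w)%R ->
  {ae P, forall w, cond_exp P G Z w = cond_exp_nneg P G Z w}.
Proof.
move=> Z0; have := cond_exp_nneg0; apply: filterS => w H.
rewrite /cond_exp.
have -> : (Z^\+)%R = Z by apply/funext => x; rewrite /funrpos; apply/max_idPl.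
have -> : (Z^\-)%R = cst 0%R.
  by apply/funext => x; rewrite /funrneg; apply/max_idPr; rewrite oppr_le0.
by rewrite H sube0.
Qed.

(** The events of [A0] where V exceeds s by 1/(n+1) belong to the past, and the integral bound on
    them forces probability zero. *)
Lemma ae_le_cst V (s : R) A0 : sub_measurable_fun G V ->
  G.-sigma.-measurable A0 ->
  (forall A, G.-sigma.-measurable A -> A `<=` A0 ->
     \int[P]_(w in A) V w <= s%:E * P A) ->
  (forall w, 0 <= V w) -> (0 <= s)%R ->
  {ae P, forall w, A0 w -> V w <= s%:E}.
Proof.
move=> mV mA0 H V0 s0.
pose A n := [set w | (s + n.+1%:R^-1)%:E <= V w] `&` A0.
have mA n : G.-sigma.-measurable (A n).
  apply: (@measurableI _ (g_sigma_algebraType G)) => //.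
  by rewrite -[X in _ X]setTI; exact: (@measurable_lee _ (g_sigma_algebraType G)).
have PA n : P (A n) = 0.
  have mA' := sub_gen_measurable Gm (mA n).
  have := H _ (mA n) (@subIsetr _ _ _).
  have : (s + n.+1%:R^-1)%:E * P (A n) <= \int[P]_(w in A n) V w.
    rewrite -(integral_cst P mA').
    apply: ge0_le_integral => //.
    - by move=> w _; rewrite lee_fin addr_ge0.
    - by apply: measurable_funTS; exact: (sub_measurable_funT Gm).
    - by move=> w [].
  move=> /le_trans/[apply]; rewrite -(fineK (fin_num_measure P _ mA')).
  rewrite -!EFinM lee_fin mulrDl gerDl pmulr_rle0 ?invr_gt0// => h.
  by congr EFin; apply/eqP; rewrite eq_le h fine_ge0.
apply: (@negligibleS _ _ _ P (\bigcup_n A n)); last first.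
  apply: negligible_bigcup => n.
  by apply/negligibleP; [exact: sub_gen_measurable Gm _ (mA _)|exact: PA].
move=> w /= /not_implyP[A0w /negP]; rewrite -ltNge => h.
have [n Bn] : exists n, (s + n.+1%:R^-1)%:E <= V w.
  move: h; case: (V w) => [r| |]//; last by exists 0%N; rewrite leey.
  by rewrite lte_fin => /ltr_add_invr[n /ltW]; exists n; rewrite lee_fin.
by exists n.
Qed.

(** A random batch size takes countably many values, so the exceptional sets of its levels have a
    negligible union. *)
Lemma cond_exp_le_piecewise Z (b : T -> nat) (B : nat -> R) :
  measurable_fun setT Z -> (forall w, 0 <= Z w)%R -> (forall l, 0 <= B l)%R ->
  (forall l, G.-sigma.-measurable [set w | b w = l]) ->
  (forall l A, G.-sigma.-measurable A -> A `<=` [set w | b w = l] ->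
     \int[P]_(w in A) (Z w)%:E <= (B l)%:E * P A) ->
  {ae P, forall w, cond_exp P G Z w <= (B (b w))%:E}.
Proof.
move=> mZ Z0 B0 mb H.
have [V0 mV VI] := cond_exp_nnegP P Gm mZ Z0.
have HB l : {ae P, forall w, b w = l -> cond_exp_nneg P G Z w <= (B l)%:E}.
  by apply: ae_le_cst (mb l) _ V0 (B0 l) => // A mA Ab; rewrite VI// H.
have : {ae P, forall w, cond_exp_nneg P G Z w <= (B (b w))%:E}.
  apply: negligibleS (negligible_bigcup HB) => w /= h.
  by exists (b w) => //= /(_ erefl).
by apply: filterS2 (cond_exp_nnegE Z0) => w ->.
Qed.

(** Events [setT] serve as fillers in the product rule, and their conditional probability has to be
    one. A version below 1 with total integral 1 equals 1 almost surely. *)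
Lemma cond_exp_nnegT :
  {ae P, forall w, cond_exp_nneg P G (\1_setT : T -> R) w = 1}.
Proof.
have mT := @measurableT _ (g_sigma_algebraType G).
have HV : is_cond_exp P G (\1_setT : T -> R) (cond_exp_nneg P G (\1_setT : T -> R)).
  by apply: (cond_exp_nnegP P Gm) => // w; rewrite indicE.
have mV := is_cond_exp_measurable HV; have [V0 mVG VI] := HV.
set V := cond_exp_nneg _ _ _ in HV mV V0 mVG VI *.
have V1 : {ae P, forall w, V w <= 1}.
  have := @ae_le_cst V 1%R setT mVG mT; move=> /(_ _ V0 ler01) H.
  have : {ae P, forall w, setT w -> V w <= 1%:E}.
    apply: H => A mA _; rewrite VI// -(integral_cst P (sub_gen_measurable Gm mA)).
    by rewrite le_eqVlt; apply/orP; left; apply/eqP; apply: eq_integral => w _;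
      rewrite indicE in_setT.
  by apply: filterS => w; exact.
have IV : \int[P]_w V w = 1.
  rewrite VI//; under eq_integral do rewrite indicE in_setT.
  by rewrite (integral_cst P (@measurableT _ T)) mul1e; exact: probability_setT.
have iV : P.-integrable setT V.
  by apply/integrableP; split => //; under eq_integral do rewrite gee0_abs//; rewrite IV ltry.
have i1 : P.-integrable setT (cst 1%:E : T -> \bar R).
  exact: finite_measure_integrable_cst.
have mB : measurable_fun setT (fun w => 1%:E - V w) by apply: emeasurable_funB.
have : \int[P]_w `|1%:E - V w| = 0.
  rewrite (ae_eq_integral (fun w => 1%:E - V w))//.
  - rewrite integralB// integral_cst// mul1e IV.
    by rewrite /= (@probability_setT _ _ _ P) subee.
  - exact: measurableT_comp.
  - move: V1; apply: filterS => w Vw _; rewrite gee0_abs//.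
    by rewrite subre_ge0.
move=> /(ae_eq_integral_abs _ measurableT mB).
move: V1; apply: filterS2 => w Vw /(_ Logic.I) /=.
have /fineK <- : V w \is a fin_num by rewrite ge0_fin_numE// (le_lt_trans Vw)// ltry.
by move=> -[] /eqP; rewrite subr_eq0 => /eqP <-.
Qed.

Lemma cond_probE A : d.-measurable A ->
  {ae P, forall w, cond_prob P G A w = cond_exp_nneg P G (\1_A : T -> R) w}.
Proof. by move=> mA; apply: cond_exp_nnegE => w; rewrite indicE. Qed.

Lemma cond_exp_nneg_indP A : d.-measurable A ->
  is_cond_exp P G (\1_A : T -> R) (cond_exp_nneg P G (\1_A : T -> R)).
Proof.
by move=> mA; apply: (cond_exp_nnegP P Gm) => // w; rewrite indicE.
Qed.

End cond_exp_theory.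

Lemma random_mx_preimage d (T : measurableType d) (R : realType) p q
    (Z : T -> 'M[R]_(p, q)) (B : set 'M[R]_(p, q)) :
  random_mx Z -> mx_borel B -> measurable (Z @^-1` B).
Proof.
move=> mZ; move: B; suff : @mx_borel R p q `<=` [set B | measurable (Z @^-1` B)] by [].
apply: smallest_sub.
  split => /= [|A mA|F mF].
  - by rewrite preimage_set0.
  - by rewrite setTD preimage_setC; exact: measurableC.
  - by rewrite preimage_bigcup; exact: bigcupT_measurable.
move=> _ [i [j [A [mA ->]]]] /=.
by rewrite -[X in measurable X]setTI; exact: mZ.
Qed.

(** * Conditional independence given the past *)

Section conditional_independence.
Context d (T : measurableType d) (R : realType) (P : probability T R).
Variables (G : set (set T)) (Gm : forall A, G A -> d.-measurable A).
Variables (p q : nat) (U : T -> 'M[R]_(p, q)) (mU : random_mx U).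
Local Open Scope ereal_scope.

(** Rectangles, which form a pi-system generating the joint information of [G] and [U]. *)
Definition join_mx : set (set T) :=
  [set E | exists A B, [/\ G.-sigma.-measurable A, mx_borel B & E = A `&` U @^-1` B]].

Lemma mx_borelT : mx_borel (setT : set 'M[R]_(p, q)).
Proof. exact: (@measurableT _ (g_sigma_algebraType _)). Qed.

Lemma mx_borelI (A B : set 'M[R]_(p, q)) : mx_borel A -> mx_borel B -> mx_borel (A `&` B).
Proof. exact: (@measurableI _ (g_sigma_algebraType _)). Qed.

Lemma join_mx_measurable E : join_mx E -> d.-measurable E.
Proof.
move=> [A [B [mA mB ->]]]; apply: measurableI; first exact: sub_gen_measurable mA.
exact: random_mx_preimage.
Qed.

Lemma join_mxI : setI_closed join_mx.
Proof.
move=> _ _ [A [B [mA mB ->]]] [A' [B' [mA' mB' ->]]].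
exists (A `&` A'), (B `&` B'); split; [|exact: mx_borelI|].
  exact: (@measurableI _ (g_sigma_algebraType _)).
by rewrite setIACA preimage_setI.
Qed.

Lemma join_mxT : join_mx setT.
Proof.
exists setT, setT; split; [|exact: mx_borelT|by rewrite preimage_setT setTI].
exact: (@measurableT _ (g_sigma_algebraType _)).
Qed.

(** On [A0] the densities 1_D and P(D | G) have equal integrals over rectangles, by conditional
    independence, hence over all events of the joint sigma-algebra; [g] then acts as a weight. *)
Lemma cond_indep_weight (A0 D : set T) (g : T -> R) :
  G.-sigma.-measurable A0 -> d.-measurable D ->
  (forall B, mx_borel B -> {ae P, forall w, A0 w ->
     cond_prob P G (D `&` U @^-1` B) w =
     cond_prob P G D w * cond_prob P G (U @^-1` B) w}) ->
  measurable_fun [set: g_sigma_algebraType join_mx] (g : g_sigma_algebraType join_mx -> R) ->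
  (forall w, 0 <= g w)%R ->
  \int[P]_(w in A0 `&` D) (g w)%:E =
  \int[P]_w ((g w)%:E * (ind A0 w * cond_exp_nneg P G (\1_D : T -> R) w)).
Proof.
move=> mA0 mD ci mg g0.
have mA0' := sub_gen_measurable Gm mA0.
have HD := cond_exp_nneg_indP P Gm mD; have [pD0 mpD pDI] := HD.
set pD := cond_exp_nneg P G (\1_D : T -> R) in HD pD0 mpD pDI.
have mpD' := is_cond_exp_measurable Gm HD.
have mgE : sub_measurable_fun join_mx (EFin \o g) by apply/measurable_EFinP.
have mg' : measurable_fun setT (EFin \o g).
  exact: sub_measurable_funT join_mx_measurable mgE.
pose f1 w : \bar R := ind A0 w * ind D w; pose f2 w := ind A0 w * pD w.
have mA0s : sub_measurable_fun G (ind A0 : T -> \bar R) by exact: sub_measurable_ind.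
have mf1 : measurable_fun setT f1 by apply: emeasurable_funM; exact: measurable_ind.
have mf2s : sub_measurable_fun G f2 by exact: sub_measurable_funM.
have mf2 : measurable_fun setT f2 := sub_measurable_funT Gm mf2s.
have f10 w : 0 <= f1 w by rewrite mule_ge0 ?ind_ge0.
have f20 w : 0 <= f2 w by rewrite mule_ge0 ?ind_ge0.
have f1oo : \int[P]_w f1 w < +oo.
  apply: (@le_lt_trans _ _ (\int[P]_w (cst 1 w))).
    apply: ge0_le_integral => // w _.
    by rewrite /f1 -indI lee_fin indicE; case: (_ \in _).
  by rewrite integral_cst// mul1e; exact: le_lt_trans (probability_le1 _ _) (ltry _).
have f12 : forall E, join_mx.-sigma.-measurable E ->
    \int[P]_(w in E) f1 w = \int[P]_(w in E) f2 w.
  apply: (pi_system_integral_eq join_mx_measurable) => //;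
    [exact: join_mxI|exact: join_mxT|].
  move=> _ [A [B [mA mB ->]]].
  set UB := U @^-1` B.
  have mUB : d.-measurable UB by exact: random_mx_preimage.
  have mA' := sub_gen_measurable Gm mA.
  have HB := cond_exp_nneg_indP P Gm mUB; have [pB0 mpB pBI] := HB.
  have HDB := cond_exp_nneg_indP P Gm (measurableI _ _ mD mUB).
  have [pDB0 mpDB pDBI] := HDB.
  have mA0A : G.-sigma.-measurable (A0 `&` A).
    exact: (@measurableI _ (g_sigma_algebraType _)).
  transitivity (\int[P]_(w in A0 `&` A) (\1_(D `&` UB) w)%:E).
    rewrite (integral_ind P (A `&` UB) f1) (integral_ind P (A0 `&` A)).
    apply: eq_integral => w _; rewrite -/(ind (D `&` UB) w).
    by rewrite /f1 !indI [LHS]muleC muleACA.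
  rewrite -pDBI//.
  transitivity (\int[P]_(w in A0 `&` A) (pD w * cond_exp_nneg P G (\1_UB : T -> R) w)).
    apply: ge0_ae_eq_integral => //.
    - exact: sub_gen_measurable mA0A.
    - exact: measurable_funTS (is_cond_exp_measurable Gm HDB).
    - apply: measurable_funTS; apply: emeasurable_funM => //.
      exact: is_cond_exp_measurable HB.
    - by move=> w _; rewrite mule_ge0.
    have : {ae P, forall w, A0 w -> cond_exp_nneg P G (\1_(D `&` UB) : T -> R) w =
        cond_prob P G D w * cond_prob P G UB w}.
      by move: (cond_probE P Gm (measurableI _ _ mD mUB)) (ci _ mB); apply: filterS2 => w <-.
    move: (cond_probE P Gm mD) (cond_probE P Gm mUB).
    by apply: filterS3 => w E1 E2 E3 [A0w _]; rewrite /pD -E1 -E2 E3.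
  transitivity (\int[P]_w ((ind (A0 `&` A) w * pD w) * cond_exp_nneg P G (\1_UB : T -> R) w)).
    by rewrite (integral_ind P (A0 `&` A)); apply: eq_integral => w _; rewrite muleA.
  (* The remaining weight is measurable for the past, so P(U in B | G) can be exchanged for the
     indicator. *)
  rewrite (eq_integral_weight (mu := P) Gm (g := ind UB))//.
  - rewrite (integral_ind P (A `&` UB) f2); apply: eq_integral => w _.
    by rewrite /f2 !indI [RHS]muleC [RHS]muleACA muleA.
  - exact: is_cond_exp_measurable HB.
  - exact: measurable_ind.
  - by move=> w; exact: ind_ge0.
  - by apply: sub_measurable_funM => //; exact: sub_measurable_ind.
  - by move=> w; rewrite mule_ge0 ?ind_ge0.
rewrite (integral_ind P (A0 `&` D)).
transitivity (\int[P]_w ((g w)%:E * f1 w)).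
  by apply: eq_integral => w _; rewrite indI muleC.
exact: (eq_integral_weight join_mx_measurable mf1 f10 mf2 f20 mgE).
Qed.

(** Adding [D] to the conditioning leaves E[g | G] unchanged. Once 1_D has become P(D | G), a weight
    of the past, [g] is exchanged for V and P(D | G) goes back to 1_D. *)
Lemma cond_indep_integral (A0 D : set T) (g : T -> R) (V : T -> \bar R) :
  G.-sigma.-measurable A0 -> d.-measurable D ->
  (forall B, mx_borel B -> {ae P, forall w, A0 w ->
     cond_prob P G (D `&` U @^-1` B) w =
     cond_prob P G D w * cond_prob P G (U @^-1` B) w}) ->
  measurable_fun [set: g_sigma_algebraType join_mx] (g : g_sigma_algebraType join_mx -> R) ->
  (forall w, 0 <= g w)%R -> is_cond_exp P G g V ->
  \int[P]_(w in A0 `&` D) (g w)%:E = \int[P]_(w in A0 `&` D) V w.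
Proof.
move=> mA0 mD ci mg g0 HV; have [V0 mV VI] := HV.
rewrite cond_indep_weight//.
have HD := cond_exp_nneg_indP P Gm mD; have [pD0 mpD pDI] := HD.
set pD := cond_exp_nneg P G (\1_D : T -> R) in HD pD0 mpD pDI *.
have mpD' := is_cond_exp_measurable Gm HD.
have mV' := is_cond_exp_measurable Gm HV.
have mA0s : sub_measurable_fun G (ind A0 : T -> \bar R) by exact: sub_measurable_ind.
have mg' : measurable_fun setT (EFin \o g).
  by apply: (sub_measurable_funT join_mx_measurable); exact/measurable_EFinP.
have mf2s : sub_measurable_fun G (fun w => ind A0 w * pD w) by exact: sub_measurable_funM.
transitivity (\int[P]_w ((ind A0 w * pD w) * (g w)%:E)).
  by apply: eq_integral => w _; rewrite muleC.
rewrite (eq_integral_weight (mu := P) Gm (f := EFin \o g) (g := V))//; last 2 first.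
- by move=> w; rewrite mule_ge0 ?ind_ge0.
- by move=> A mA; rewrite VI.
transitivity (\int[P]_w ((V w * ind A0 w) * pD w)).
  by apply: eq_integral => w _; rewrite muleC muleA.
rewrite (eq_integral_weight (mu := P) Gm (f := pD) (g := ind D)
  (h := fun w => V w * ind A0 w))//.
- rewrite (integral_ind P (A0 `&` D)).
  by apply: eq_integral => w _; rewrite indI [RHS]muleC muleA.
- exact: measurable_ind.
- by move=> w; exact: ind_ge0.
- exact: sub_measurable_funM.
- by move=> w; rewrite mule_ge0 ?ind_ge0.
Qed.

End conditional_independence.

(** * Random matrices *)

Section random_matrices.
Context d (T : measurableType d) (R : realType).

Lemma random_mxD p q (U V : T -> 'M[R]_(p, q)) :
  random_mx U -> random_mx V -> random_mx (fun w => U w + V w).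
Proof.
move=> mU mV i j; under eq_fun do rewrite mxE.
exact: measurable_funD.
Qed.

Lemma random_mxZ p q (a : T -> R) (V : T -> 'M[R]_(p, q)) :
  measurable_fun setT a -> random_mx V -> random_mx (fun w => a w *: V w).
Proof.
move=> ma mV i j; under eq_fun do rewrite mxE.
exact: measurable_funM.
Qed.

Lemma random_mxB p q (U V : T -> 'M[R]_(p, q)) :
  random_mx U -> random_mx V -> random_mx (fun w => U w - V w).
Proof.
move=> mU mV i j; under eq_fun do rewrite !mxE.
exact: measurable_funB.
Qed.

Lemma random_mx_cst p q (A : 'M[R]_(p, q)) : random_mx (fun _ : T => A).
Proof. by move=> i j; exact: measurable_cst. Qed.

Lemma random_mx_sum p q n (U : nat -> T -> 'M[R]_(p, q)) :
  (forall k, (k < n)%N -> random_mx (U k)) ->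
  random_mx (fun w => \sum_(k < n) U k w).
Proof.
elim: n => [|n IH] mU.
  by under eq_fun do rewrite big_ord0; exact: random_mx_cst.
under eq_fun do rewrite big_ord_recr /=.
apply: random_mxD; last exact: mU.
by apply: IH => k kn; apply: mU; rewrite ltnS ltnW.
Qed.

Lemma random_mxM p q r (U : T -> 'M[R]_(p, q)) (V : T -> 'M[R]_(q, r)) :
  random_mx U -> random_mx V -> random_mx (fun w => U w *m V w).
Proof.
move=> mU mV i j; under eq_fun do rewrite mxE.
by apply: measurable_sum => k; exact: measurable_funM.
Qed.

Lemma random_mxX n (U : T -> 'M[R]_n) k :
  random_mx U -> random_mx (fun w => U w ^+ k).
Proof.
move=> mU; elim: k => [|k IH].
  by under eq_fun do rewrite expr0; exact: random_mx_cst.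
by under eq_fun do rewrite exprS; exact: random_mxM.
Qed.

Lemma measurable_mxtrace n (U : T -> 'M[R]_n) :
  random_mx U -> measurable_fun setT (fun w => \tr (U w)).
Proof. by move=> mU; apply: measurable_sum => i; exact: mU. Qed.

Lemma measurable_enorm n (U : T -> 'rV[R]_n) :
  random_mx U -> measurable_fun setT (fun w => enorm (U w)).
Proof.
move=> mU; rewrite /enorm.
apply: (@measurableT_comp _ _ _ _ _ _ (@Num.sqrt R)).
  by apply: continuous_measurable_fun; exact: sqrt_continuous.
by apply: measurable_sum => i; apply: measurable_funX; exact: mU.
Qed.

End random_matrices.

(** * Measurability of the spectral norm *)

Section spnorm_measurable.
Context (R : realType).

Lemma enorm_le_sum n (v : 'rV[R]_n) : enorm v <= \sum_i `|v 0 i|.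
Proof.
have s0 : 0 <= \sum_i `|v 0 i| by apply: sumr_ge0.
rewrite -(@ler_pXn2r _ 2)// ?nnegrE ?enorm_ge0// -frob_enorm frobE big_ord1.
rewrite expr2 mulr_suml; apply: ler_sum => i _.
rewrite -expr2 -real_normK ?num_real// expr2 ler_wpM2l//.
by rewrite (bigD1 i)//= lerDl sumr_ge0.
Qed.

Lemma rat_row_dense n (v : 'rV[R]_n) e : 0 < e ->
  exists u : 'rV[rat]_n, enorm (v - map_mx ratr u) <= e.
Proof.
move=> e0; have e1 : 0 < e / n.+1%:R by rewrite divr_gt0.
have H i : exists q : rat, `|v 0 i - ratr q| < e / n.+1%:R.
  have [|q] := @rat_in_itvoo R (v 0 i - e / n.+1%:R) (v 0 i + e / n.+1%:R).
    by rewrite ltrBlDr -addrA ltrDl addr_gt0.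
  rewrite in_itv/= => /andP[q1 q2]; exists q; by rewrite distrC ltr_distl q1 q2.
have /choice[q Hq] := H.
exists (\row_i q i); rewrite (le_trans (enorm_le_sum _))//.
apply: (@le_trans _ _ (\sum_(i < n) e / n.+1%:R)).
  by apply: ler_sum => i _; rewrite !mxE ltW.
rewrite sumr_const card_ord -[_ *+ n]mulr_natr mulrAC ler_pdivrMr//.
by rewrite ler_wpM2l ?ler_nat// ltW.
Qed.

(** Reduces an uncountable supremum to countably many vectors. The homogeneous form avoids
    normalizing a rational vector. *)
Lemma spnorm_gt_rat n (A : 'M[R]_n) x : 0 <= x -> x < spnorm A ->
  exists u : 'rV[rat]_n,
    x * enorm (map_mx ratr u : 'rV[R]_n) < enorm (map_mx ratr u *m A^T).
Proof.
move=> x0 xA; apply/not_existsP => H.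
have {}H u : enorm (map_mx ratr u *m A^T) <= x * enorm (map_mx ratr u : 'rV[R]_n).
  by rewrite leNgt; apply/negP => h; exact: (H u).
suff : spnorm A <= x by rewrite leNgt xA.
apply: spnorm_le => // v; apply/ler_addgt0Pr => e e0.
have K0 : 0 < spnorm A + x + 1 by rewrite ltr_wpDl// addr_ge0// spnorm_ge0.
have [u uv] := rat_row_dense v (divr_gt0 e0 K0).
set r := map_mx ratr u in uv.
have -> : v = r + (v - r) by rewrite addrC subrK.
rewrite {1}mulmxDl (le_trans (enormD _ _))//.
have h1 := H u; have h2 := spnorm_ub A (v - r).
have h3 : enorm r <= enorm (r + (v - r)) + enorm (v - r).
  have -> : enorm (v - r) = enorm (r - v).
    by rewrite -opprB -scaleN1r enormZ normrN1 mul1r.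
  rewrite (_ : r + (v - r) = v); last by rewrite addrC subrK.
  by rewrite {1}(_ : r = v + (r - v)) ?enormD// addrC subrK.
have h4 := ler_wpM2l x0 h3.
have h5 : (spnorm A + x + 1) * enorm (v - r) <= e by rewrite mulrC -ler_pdivlMr.
have := enorm_ge0 (v - r); rewrite -/r in h1; nra.
Qed.

Lemma measurable_spnorm d (T : measurableType d) n (U : T -> 'M[R]_n) :
  random_mx U -> measurable_fun setT (fun w => spnorm (U w)).
Proof.
move=> mU mD; apply: (measurability _ (RGenOInfty.measurableE R)) => //.
move=> _ [_ [x ->] <-]; rewrite setTI.
have [x0|x0] := ltP x 0.
  rewrite (_ : _ @^-1` _ = setT)//; apply/seteqP; split => // w _ /=.
  by rewrite in_itv/= andbT (lt_le_trans x0)// spnorm_ge0.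
pose F k : set T := if @unpickle 'rV[rat]_n k is Some u then
  [set w | x * enorm (map_mx ratr u : 'rV[R]_n) < enorm (map_mx ratr u *m (U w)^T)]
  else set0.
rewrite (_ : _ @^-1` _ = \bigcup_k F k); last first.
  apply/seteqP; split => w /=; rewrite in_itv/= andbT.
    move=> /(spnorm_gt_rat x0)[u hu]; exists (pickle u) => //.
    by rewrite /F pickleK.
  move=> [k _]; rewrite /F; case: unpickle => // u /= /lt_le_trans/(_ (spnorm_ub _ _)).
  rewrite -subr_gt0 -mulrBl => h.
  rewrite ltNge; apply/negP => h'; move: h; rewrite ltNge => /negP; apply.
  by rewrite mulr_le0_ge0 ?subr_le0 ?enorm_ge0.
apply: bigcupT_measurable => k; rewrite /F; case: unpickle => // u.
rewrite -[X in measurable X]setTI; apply: measurable_fun_ltr => //.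
apply: measurable_enorm; apply: random_mxM; first exact: random_mx_cst.
by move=> i j; under eq_fun do rewrite mxE; exact: mU.
Qed.

Lemma spnorm_mulmx n (A B : 'M[R]_n) : spnorm (A *m B) <= spnorm A * spnorm B.
Proof.
apply: spnorm_le => [|v]; first by rewrite mulr_ge0 ?spnorm_ge0.
rewrite trmx_mul mulmxA (le_trans (spnorm_ub _ _))// -mulrA ler_wpM2l ?spnorm_ge0//.
exact: spnorm_ub.
Qed.

Lemma spnormX n (A : 'M[R]_n) k : spnorm (A ^+ k) <= spnorm A ^+ k.
Proof.
elim: k => [|k IH].
  by apply: spnorm_le => // v; rewrite expr0 trmx1 mulmx1 mul1r.
by rewrite !exprS (le_trans (spnorm_mulmx _ _))// ler_wpM2l ?spnorm_ge0.
Qed.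

End spnorm_measurable.

Lemma maxrM0 (R : realDomainType) (a b : R) :
  Num.max (a * b) 0 = Num.max a 0 * Num.max b 0 + Num.max (- a) 0 * Num.max (- b) 0.
Proof.
have pos (x : R) : 0 <= x -> Num.max x 0 = x /\ Num.max (- x) 0 = 0.
  by move=> x0; split; [apply/max_idPl|apply/max_idPr; rewrite oppr_le0].
have neg (x : R) : x <= 0 -> Num.max x 0 = 0 /\ Num.max (- x) 0 = - x.
  by move=> x0; split; [apply/max_idPr|apply/max_idPl; rewrite oppr_ge0].
have /orP[a0|a0] := le_total 0 a; have /orP[b0|b0] := le_total 0 b.
- have [-> _] := pos _ (mulr_ge0 a0 b0).
  by have [-> ->] := pos _ a0; have [-> ->] := pos _ b0; rewrite mulr0 addr0.
- have [-> _] := neg _ (mulr_ge0_le0 a0 b0).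
  by have [-> ->] := pos _ a0; have [-> ->] := neg _ b0; rewrite mulr0 mul0r addr0.
- have [-> _] := neg _ (mulr_le0_ge0 a0 b0).
  by have [-> ->] := neg _ a0; have [-> ->] := pos _ b0; rewrite mulr0 mul0r addr0.
- have [-> _] := pos _ (mulr_le0 a0 b0).
  by have [-> ->] := neg _ a0; have [-> ->] := neg _ b0; rewrite mulr0 add0r mulrNN.
Qed.

Lemma maxr0E (R : realDomainType) (x : R) : (Num.max x 0 = x + Num.max (- x) 0).
Proof.
have /orP[x0|x0] := le_total 0 x.
  by rewrite (max_idPl x0) (max_idPr _) ?addr0// oppr_le0.
by rewrite (max_idPr x0) (max_idPl _) ?subrr// oppr_ge0.
Qed.

(** All terms are kept nonnegative, so the identity can be integrated before integrability is
    known. *)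
Lemma maxr0_sub (R : realDomainType) (u m : R) :
  (Num.max u 0 + Num.max (- m) 0 + Num.max (- (u - m)) 0 =
   Num.max (- u) 0 + Num.max m 0 + Num.max (u - m) 0).
Proof. by rewrite (maxr0E u) (maxr0E m) (maxr0E (u - m)); ring. Qed.

(** * Martingale differences *)

Section schatten_measurable.
Context d (T : measurableType d) (R : realType) (n q : nat) (eps : R).

Lemma measurable_sch_pow (U : T -> 'M[R]_n) :
  random_mx U -> measurable_fun setT (fun w => sch_pow q eps (U w)).
Proof.
by move=> mU; apply: measurable_funD => //; apply: measurable_mxtrace; exact: random_mxX.
Qed.

Lemma measurable_sch_norm (U : T -> 'M[R]_n) :
  random_mx U -> measurable_fun setT (fun w => sch_norm q eps (U w)).
Proof.
by move=> mU; apply: (measurableT_comp (measurable_powR _)); exact: measurable_sch_pow.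
Qed.

End schatten_measurable.

Section martingale.
Context d (T : measurableType d) (R : realType) (P : probability T R).
Variables (A0 : set T) (mA0 : measurable A0).
Local Open Scope ereal_scope.

Section weights.
Variables (C : set (set T)) (Cm : forall A, C A -> d.-measurable A).

Lemma le_weight (f g h : T -> R) :
  measurable_fun setT f -> (forall w, 0 <= f w)%R ->
  measurable_fun setT g -> (forall w, 0 <= g w)%R ->
  measurable_fun [set: g_sigma_algebraType C] (h : g_sigma_algebraType C -> R) ->
  (forall w, 0 <= h w)%R ->
  (forall D, C.-sigma.-measurable D ->
     \int[P]_(w in A0 `&` D) (f w)%:E <= \int[P]_(w in A0 `&` D) (g w)%:E) ->
  \int[P]_(w in A0) (h w * f w)%:E <= \int[P]_(w in A0) (h w * g w)%:E.
Proof.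
move=> mf f0 mg g0 mh h0 H.
have E (e : T -> R) : \int[P]_(w in A0) (h w * e w)%:E =
    \int[P]_w ((h w)%:E * (ind A0 w * (e w)%:E)).
  rewrite (integral_ind P A0); apply: eq_integral => w _.
  by rewrite EFinM muleCA.
have mA e : measurable_fun setT e -> measurable_fun setT (fun w => ind A0 w * (e w)%:E : \bar R).
  move=> me; apply: emeasurable_funM; first exact: measurable_ind.
  exact/measurable_EFinP.
rewrite !E; apply: (le_integral_weight Cm) => //.
- exact: mA.
- by move=> w; rewrite mule_ge0 ?ind_ge0 ?lee_fin.
- exact: mA.
- by move=> w; rewrite mule_ge0 ?ind_ge0 ?lee_fin.
- exact/measurable_EFinP.
move=> D mD; have := H D mD.
have E2 (e : T -> R) : \int[P]_(w in A0 `&` D) (e w)%:E =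
    \int[P]_(w in D) (ind A0 w * (e w)%:E).
  rewrite (integral_ind P D) (integral_ind P (A0 `&` D)).
  by apply: eq_integral => w _; rewrite indI [in RHS]muleA (muleC (ind A0 w)).
by rewrite !E2.
Qed.

Lemma eq_weight (f g h : T -> R) :
  measurable_fun setT f -> (forall w, 0 <= f w)%R ->
  measurable_fun setT g -> (forall w, 0 <= g w)%R ->
  measurable_fun [set: g_sigma_algebraType C] (h : g_sigma_algebraType C -> R) ->
  (forall w, 0 <= h w)%R ->
  (forall D, C.-sigma.-measurable D ->
     \int[P]_(w in A0 `&` D) (f w)%:E = \int[P]_(w in A0 `&` D) (g w)%:E) ->
  \int[P]_(w in A0) (h w * f w)%:E = \int[P]_(w in A0) (h w * g w)%:E.
Proof.
move=> mf f0 mg g0 mh h0 H; apply/eqP.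
by rewrite eq_le !le_weight// => D mD; rewrite H.
Qed.

(** States E[y | C] = 0 on [A0]. Comparing the two parts keeps it meaningful without
    integrability. *)
Definition centered (y : T -> R) := forall D, C.-sigma.-measurable D ->
  \int[P]_(w in A0 `&` D) (y^\+ w)%:E = \int[P]_(w in A0 `&` D) (y^\- w)%:E.

(** The positive part of a product is phi^+ y^+ + phi^- y^-, the negative part phi^+ y^- + phi^-
    y^+; they match term by term, and integrability is needed only to subtract them. *)
Lemma integral_centered_weight (phi y : T -> R) :
  measurable_fun setT y -> centered y ->
  measurable_fun [set: g_sigma_algebraType C] (phi : g_sigma_algebraType C -> R) ->
  P.-integrable A0 (fun w => (phi w * y w)%:E) ->
  \int[P]_(w in A0) (phi w * y w)%:E = 0.
Proof.
move=> my cy mphi iphi.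
have mphi' : measurable_fun setT phi.
  by move=> _ B mB; apply: (sub_gen_measurable Cm); exact: mphi.
have ppos := @funrpos_ge0 _ _ phi; have pneg := @funrneg_ge0 _ _ phi.
have ypos := @funrpos_ge0 _ _ y; have yneg := @funrneg_ge0 _ _ y.
have mp : measurable_fun setT phi^\+%R by exact: measurable_funrpos.
have mn : measurable_fun setT phi^\-%R by exact: measurable_funrneg.
have myp : measurable_fun setT y^\+%R by exact: measurable_funrpos.
have myn : measurable_fun setT y^\-%R by exact: measurable_funrneg.
have mul4 (u v : T -> R) : measurable_fun setT u -> measurable_fun setT v ->
    measurable_fun A0 (fun w => (u w * v w)%:E : \bar R).
  by move=> mu mv; apply/measurable_EFinP; apply: measurable_funTS; exact: measurable_funM.
have Epos w : (fun w => (phi w * y w)%:E)^\+ w =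
    (phi^\+ w * y^\+ w)%:E + (phi^\- w * y^\- w)%:E.
  by rewrite funeposE -EFin_max -EFinD maxrM0.
have Eneg w : (fun w => (phi w * y w)%:E)^\- w =
    (phi^\+ w * y^\- w)%:E + (phi^\- w * y^\+ w)%:E.
  by rewrite funenegE -EFinN -EFin_max -EFinD -mulrN maxrM0 opprK.
rewrite integralE.
have EE : \int[P]_(w in A0) (fun w => (phi w * y w)%:E)^\+ w =
    \int[P]_(w in A0) (fun w => (phi w * y w)%:E)^\- w.
  under eq_integral do rewrite Epos.
  under [RHS]eq_integral do rewrite Eneg.
  rewrite !ge0_integralD//; try by [move=> w _; rewrite lee_fin mulr_ge0|exact: mul4].
  congr (_ + _).
    apply: eq_weight => //; exact: (@measurable_funrpos _ (g_sigma_algebraType C)).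
  apply/esym/eq_weight => //; exact: (@measurable_funrneg _ (g_sigma_algebraType C)).
rewrite EE subee//.
exact: integrable_neg_fin_num.
Qed.

End weights.

Lemma integrable_dominated (f g : T -> R) :
  measurable_fun setT f -> measurable_fun setT g ->
  (forall w, `|f w| <= g w)%R -> \int[P]_(w in A0) (g w)%:E < +oo ->
  P.-integrable A0 (fun w => (f w)%:E).
Proof.
move=> mf mg fg goo.
have g0 w : (0 <= g w)%R by rewrite (le_trans _ (fg w)).
apply: (@le_integrable _ _ _ P A0 mA0 _ (EFin \o g)).
- by apply/measurable_EFinP; exact: measurable_funTS.
- by move=> w _; rewrite /= lee_fin (le_trans (fg w))// ler_norm.
apply/integrableP; split; first by apply/measurable_EFinP; exact: measurable_funTS.
by under eq_integral do rewrite /= ger0_norm//.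
Qed.

(** One induction step for a moment of partial sums. The linear part is a finite family because
    centering is known entry by entry. *)
Lemma integral_step (J : finType) (F0 F1 Q : T -> R) (L : J -> T -> R) :
  measurable_fun setT F0 -> measurable_fun setT F1 -> measurable_fun setT Q ->
  (forall w, 0 <= F0 w)%R -> (forall w, 0 <= F1 w)%R -> (forall w, 0 <= Q w)%R ->
  (forall w, F1 w <= F0 w + \sum_j L j w + Q w)%R ->
  (forall j, P.-integrable A0 (fun w => (L j w)%:E)) ->
  (forall j, \int[P]_(w in A0) (L j w)%:E = 0) ->
  \int[P]_(w in A0) (F1 w)%:E <=
    \int[P]_(w in A0) (F0 w)%:E + \int[P]_(w in A0) (Q w)%:E.
Proof.
move=> mF0 mF1 mQ F00 F10 Q0 H iL L0.
have [F0oo|] := ltP (\int[P]_(w in A0) (F0 w)%:E) +oo; last first.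
  rewrite leye_eq => /eqP ->; rewrite addye ?leey// gt_eqF//.
  by rewrite (lt_le_trans ltNy0)// integral_ge0// => w _; rewrite lee_fin.
have [Qoo|] := ltP (\int[P]_(w in A0) (Q w)%:E) +oo; last first.
  rewrite leye_eq => /eqP ->; rewrite addey ?leey// gt_eqF//.
  by rewrite (lt_le_trans ltNy0)// integral_ge0// => w _; rewrite lee_fin.
have iF0 : P.-integrable A0 (EFin \o F0).
  by apply: (integrable_dominated mF0 mF0) => // w; rewrite ger0_norm.
have iQ : P.-integrable A0 (EFin \o Q).
  by apply: (integrable_dominated mQ mQ) => // w; rewrite ger0_norm.
have iS : P.-integrable A0 (fun w => \sum_(j <- index_enum J) (L j w)%:E).
  by apply: integrable_sum.
have iR : P.-integrable A0 (fun w => (F0 w)%:E + \sum_(j <- index_enum J) (L j w)%:E + (Q w)%:E).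
  by apply: integrableD => //; exact: integrableD.
have mF1' : measurable_fun A0 (EFin \o F1).
  by apply/measurable_EFinP; exact: measurable_funTS.
have le w : (F1 w)%:E <= (F0 w)%:E + \sum_(j <- index_enum J) (L j w)%:E + (Q w)%:E.
  by rewrite sumEFin -!EFinD lee_fin.
have iF1 : P.-integrable A0 (EFin \o F1).
  apply: (le_integrable mA0 mF1' _ iR) => w _ /=.
  rewrite ger0_norm// (le_trans (le w))//.
  exact: lee_abs.
apply: le_trans (le_integral mA0 iF1 iR (fun w _ => le w)) _.
rewrite integralD//; last exact: integrableD.
rewrite integralD// integral_sum// big1// adde0//.
Qed.

Section martingale_differences.
Variables (p q : nat) (l : nat) (C : nat -> set (set T)).
Hypothesis Cm : forall k A, C k A -> d.-measurable A.
Variables (Y : nat -> T -> 'M[R]_(p, q)) (psi : 'M[R]_(p, q) -> R) (s : R).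

(* Martingale differences on the event [A0], for the filtration generated by
   the [C k], with conditional moments [E[psi (Y k) | C k] <= s]. *)
Record mart_diff : Prop := {
  diff_random : forall k, (k < l)%N -> random_mx (Y k) ;
  diff_adapted : forall j k, (j < k)%N -> (k < l)%N ->
    random_mx (Y j : g_sigma_algebraType (C k) -> 'M[R]_(p, q)) ;
  diff_centered : forall k, (k < l)%N ->
    forall i j, centered (C k) (fun w => Y k w i j) ;
  diff_moment : forall k, (k < l)%N ->
    forall D, (C k).-sigma.-measurable D ->
      \int[P]_(w in A0 `&` D) (psi (Y k w))%:E <= s%:E * P (A0 `&` D)
}.

Hypothesis Ymart : mart_diff.
Hypothesis s_ge0 : (0 <= s)%R.
Hypothesis psi_ge0 : forall M, (0 <= psi M)%R.
Hypothesis psi_measurable : forall k, (k < l)%N ->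
  measurable_fun setT (fun w => psi (Y k w)).

Lemma partial_sum_adapted k : (k < l)%N ->
  random_mx ((fun w => \sum_(j < k) Y j w)%R : g_sigma_algebraType (C k) -> 'M[R]_(p, q)).
Proof.
move=> kl.
apply: (@random_mx_sum _ (g_sigma_algebraType (C k)) R p q k Y) => j jk.
exact: diff_adapted.
Qed.

Lemma partial_sum_random k : (k <= l)%N -> random_mx (fun w => \sum_(j < k) Y j w)%R.
Proof.
move=> kl; apply: random_mx_sum => j jk; apply: (diff_random Ymart).
exact: leq_trans kl.
Qed.

Lemma diff_moment_weight k (h : T -> R) : (k < l)%N ->
  measurable_fun [set: g_sigma_algebraType (C k)] (h : g_sigma_algebraType (C k) -> R) ->
  (forall w, 0 <= h w)%R ->
  \int[P]_(w in A0) (h w * psi (Y k w))%:E <= s%:E * \int[P]_(w in A0) (h w)%:E.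
Proof.
move=> kl mh h0.
have mh' : measurable_fun setT h.
  by move=> _ B mB; apply: (sub_gen_measurable (@Cm k)); exact: mh.
apply: (@le_trans _ _ (\int[P]_(w in A0) (h w * s)%:E)).
  apply: (le_weight (C := C k)) => //; [exact: Cm|exact: psi_measurable|].
  move=> D mD; rewrite integral_cst; last first.
    by apply: measurableI => //; exact: (sub_gen_measurable (@Cm k)).
  exact: diff_moment.
rewrite -ge0_integralZl_EFin//.
- rewrite le_eqVlt; apply/orP; left; apply/eqP; apply: eq_integral => w _.
  by rewrite EFinM muleC.
- by move=> w _; rewrite lee_fin.
- by apply/measurable_EFinP; exact: measurable_funTS.
Qed.

Lemma integral_diff_weight k i j (phi : T -> R) : (k < l)%N ->
  measurable_fun [set: g_sigma_algebraType (C k)] (phi : g_sigma_algebraType (C k) -> R) ->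
  P.-integrable A0 (fun w => (phi w * Y k w i j)%:E) ->
  \int[P]_(w in A0) (phi w * Y k w i j)%:E = 0.
Proof.
move=> kl mphi iphi; apply: (integral_centered_weight (C := C k)) => //.
- exact: Cm.
- exact: (diff_random Ymart).
- exact: (diff_centered Ymart).
Qed.

Lemma diff_moment_total k : (k < l)%N ->
  \int[P]_(w in A0) (psi (Y k w))%:E <= s%:E * P A0.
Proof.
move=> kl; have := diff_moment Ymart kl (@measurableT _ (g_sigma_algebraType (C k))).
by rewrite setIT.
Qed.

End martingale_differences.

Lemma enorm_martingale n l C (Y : nat -> T -> 'rV[R]_n) (s : R) :
  (forall k A, C k A -> d.-measurable A) ->
  mart_diff l C Y (fun v => enorm v ^+ 2)%R s -> (0 <= s)%R ->
  forall k, (k <= l)%N ->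
  \int[P]_(w in A0) (enorm (\sum_(j < k) Y j w)%R ^+ 2)%:E <= (k%:R * s)%:E * P A0.
Proof.
move=> Cm YM s0; elim=> [_|k IH kl].
  rewrite mul0r mul0e integral0_eq// => w _.
  by rewrite big_ord0 enorm0 expr0n.
have mS := partial_sum_random YM (ltnW kl).
have mY := diff_random YM kl.
pose S w := (\sum_(j < k) Y j w)%R.
have m2 (U : T -> 'rV[R]_n) : random_mx U -> measurable_fun setT (fun w => enorm (U w) ^+ 2)%R.
  by move=> mU; apply: measurable_funX; exact: measurable_enorm.
have {}IH := IH (ltnW kl).
have IY := diff_moment_total YM kl.
have PA0 : P A0 < +oo by rewrite (le_lt_trans (probability_le1 _ _))// ltry.
have integral_fin (x : R) : x%:E * P A0 < +oo.
  by rewrite -(fineK (fin_num_measure P _ mA0)) -EFinM ltry.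
have iL i : P.-integrable A0 (fun w => (2 * S w 0%R i * Y k w 0%R i)%:E).
  apply: (@integrable_dominated _ (fun w => enorm (S w) ^+ 2 + enorm (Y k w) ^+ 2)%R).
  - by apply: measurable_funM => //; apply: measurable_funM => //; exact: mS.
  - by apply: measurable_funD; exact: m2.
  - move=> w; have := enorm_entry (S w) i; have := enorm_entry (Y k w) i.
    rewrite !normrM (ger0_norm (ler0n _ 2)).
    have := normr_ge0 (S w 0%R i); have := normr_ge0 (Y k w 0%R i).
    set x := `|_|%R; set y := `|_|%R; set u := enorm _; set v := enorm _.
    move=> x0 y0 xu yv.
    apply: (@le_trans _ _ (2 * v * u)%R); last by have := sqr_ge0 (u - v)%R; nra.
    by rewrite ler_pM ?mulr_ge0// ler_pM.
  - under eq_integral do rewrite EFinD.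
    rewrite ge0_integralD//.
    + rewrite lte_add_pinfty//; first exact: le_lt_trans IH (integral_fin _).
      exact: le_lt_trans IY (integral_fin _).
    + by move=> w _; rewrite lee_fin sqr_ge0.
    + by apply/measurable_EFinP; apply: measurable_funTS; exact: m2.
    + by move=> w _; rewrite lee_fin sqr_ge0.
    + by apply/measurable_EFinP; apply: measurable_funTS; exact: m2.
have step := @integral_step 'I_n (fun w => enorm (S w) ^+ 2)%R
  (fun w => enorm (\sum_(j < k.+1) Y j w) ^+ 2)%R
  (fun w => enorm (Y k w) ^+ 2)%R (fun i w => 2 * S w 0%R i * Y k w 0%R i)%R.
apply: (le_trans (step _ _ _ _ _ _ _ iL _)).
- exact: m2.
- by apply: m2; exact: (partial_sum_random YM).
- exact: m2.
- by move=> w; rewrite sqr_ge0.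
- by move=> w; rewrite sqr_ge0.
- by move=> w; rewrite sqr_ge0.
- move=> w; rewrite big_ord_recr/= -/(S w) -!frob_enorm !(frobDl, frobDr).
  rewrite (frobC (Y k w)) (_ : \sum_j _ = 2 * frob (S w) (Y k w))%R; last first.
    by rewrite frobE big_ord1 mulr_sumr; apply: eq_bigr => i _; rewrite mulrA.
  lra.
- move=> i; apply: (integral_diff_weight Cm YM) => //.
  apply: (@measurable_funM _ (g_sigma_algebraType (C k))) => //.
  exact: (partial_sum_adapted YM kl).
apply: (le_trans (leeD IH IY)).
by rewrite -ge0_muleDl ?lee_fin ?mulr_ge0// -EFinD mulrSr mulrDl mul1r.
Qed.

Lemma integral_affine (a b : R) (f : T -> R) : (0 <= a)%R -> (0 <= b)%R ->
  measurable_fun setT f -> (forall w, 0 <= f w)%R ->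
  \int[P]_(w in A0) (a * f w + b)%:E =
  a%:E * \int[P]_(w in A0) (f w)%:E + b%:E * P A0.
Proof.
move=> a0 b0 mf f0; under eq_integral do rewrite EFinD EFinM.
have mf' : measurable_fun A0 (fun w => (f w)%:E).
  by apply/measurable_EFinP; exact: measurable_funTS.
rewrite ge0_integralD//.
- rewrite ge0_integralZl_EFin//; first by rewrite integral_cst.
  by move=> w _; rewrite lee_fin.
- by move=> w _; rewrite -EFinM lee_fin mulr_ge0.
- exact: measurable_funeM.
Qed.

(** Shows that increasing the square of the size by 3c/2 absorbs the growth of the cube, including
    the term in [tau] from the size of a single increment. After squaring, the difference is [c]
    times a combination of squares whose coefficients are nonnegative by 3 tau^2 <= c. *)
Lemma cubic_recursion (s c tau t : R) : (0 <= s -> 0 <= tau -> 3 * tau ^+ 2 <= c ->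
  0 <= t -> t ^+ 2 = s ^+ 2 + 3 / 2 * c ->
  s ^+ 3 + 3 / 2 * c * s + 3 / 2 * c * tau <= t ^+ 3)%R.
Proof.
move=> s0 tau0 ctau t0 tE.
have c0 : (0 <= c)%R by rewrite (le_trans _ ctau)// mulr_ge0 ?sqr_ge0.
rewrite -(@ler_pXn2r _ 2)// ?nnegrE; last 2 first.
- by rewrite !addr_ge0 ?mulr_ge0 ?exprn_ge0.
- by rewrite exprn_ge0.
rewrite exprAC tE -subr_ge0.
set u := (tau ^+ 2)%R in ctau.
have -> : ((s ^+ 2 + 3 / 2 * c) ^+ 3 -
    (s ^+ 3 + 3 / 2 * c * s + 3 / 2 * c * tau) ^+ 2 =
  c * (3 / 2 * (s * (s - tau)) ^+ 2 + s ^+ 2 * (c / 2 - 3 / 2 * tau ^+ 2)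
    + c * (2 * s - 9 / 8 * tau) ^+ 2 + c * (27 / 8 * c - 225 / 64 * tau ^+ 2)))%R.
  by field.
rewrite -/u; move: u ctau (sqr_ge0 tau : 0 <= u)%R => u ctau u0 {tE}.
have h1 : (0 <= c / 2 - 3 / 2 * u)%R by lra.
have h2 : (0 <= 27 / 8 * c - 225 / 64 * u)%R by lra.
apply: (mulr_ge0 c0).
apply: addr_ge0 (mulr_ge0 c0 h2); apply: addr_ge0 (mulr_ge0 c0 (sqr_ge0 _)).
apply: addr_ge0 (mulr_ge0 (sqr_ge0 _) h1).
by apply: mulr_ge0 (sqr_ge0 _); rewrite divr_ge0.
Qed.

Lemma sqrM_le_cube (x y : R) : (0 <= x -> 0 <= y -> x ^+ 2 * y <= x ^+ 3 + y ^+ 3)%R.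
Proof.
move=> x0 y0; have x30 := exprn_ge0 3 x0; have y30 := exprn_ge0 3 y0.
have [xy|/ltW yx] := leP x y.
  apply: (@le_trans _ _ (y ^+ 3)%R); last by rewrite lerDr.
  by rewrite (exprSr y 2) ler_wpM2r// lerXn2r// nnegrE.
apply: (@le_trans _ _ (x ^+ 3)%R); last by rewrite lerDl.
by rewrite (exprSr x 2) ler_wpM2l// sqr_ge0.
Qed.

(* AM-GM, with equality at [x = b] and [y = sigma]. *)
Lemma cubic_young (x y b sigma nu kap : R) :
  (0 < x -> 0 <= y -> 0 < b -> 0 < sigma -> 0 <= kap ->
  kap * y ^+ 2 * (x + nu * y) <=
    (kap * 2 / (9 * sigma * b ^+ 2) * x ^+ 3 +
     (kap * 4 * b / (9 * sigma) + kap * nu)) * y ^+ 3 +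
    (kap * sigma ^+ 2 / (9 * b ^+ 2) * x ^+ 3 + kap * sigma ^+ 2 * 2 * b / 9))%R.
Proof.
move=> x0 y0 b0 s0 k0.
pose H := ((x ^+ 3 + 2 * b ^+ 3) / (3 * b ^+ 2))%R.
have xH : (x <= H)%R.
  rewrite ler_pdivlMr ?mulr_gt0 ?exprn_gt0// -subr_ge0.
  have -> : (x ^+ 3 + 2 * b ^+ 3 - x * (3 * b ^+ 2) = (x - b) ^+ 2 * (x + 2 * b))%R by ring.
  by rewrite mulr_ge0 ?sqr_ge0// addr_ge0 ?mulr_ge0// ltW.
pose K := ((2 * y ^+ 3 + sigma ^+ 3) / (3 * sigma))%R.
have yK : (y ^+ 2 <= K)%R.
  rewrite ler_pdivlMr ?mulr_gt0// -subr_ge0.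
  have -> : (2 * y ^+ 3 + sigma ^+ 3 - y ^+ 2 * (3 * sigma) =
    (y - sigma) ^+ 2 * (2 * y + sigma))%R by ring.
  by rewrite mulr_ge0 ?sqr_ge0// addr_ge0 ?mulr_ge0// ltW.
have -> : (kap * y ^+ 2 * (x + nu * y) = kap * (x * y ^+ 2) + kap * nu * y ^+ 3)%R by ring.
apply: (@le_trans _ _ (kap * (H * K) + kap * nu * y ^+ 3)%R).
  by rewrite lerD2r ler_wpM2l// ler_pM// ?sqr_ge0// ltW.
rewrite /H /K le_eqVlt; apply/orP; left; apply/eqP; field.
by rewrite !gt_eqF.
Qed.

Lemma spnorm_martingale n l C (Y : nat -> T -> 'M[R]_n) q (eps sigma : R) :
  (0 < q)%N -> (0 < eps)%R -> (0 < sigma)%R ->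
  (forall k A, C k A -> d.-measurable A) ->
  (forall k w, (Y k w)^T = Y k w) ->
  mart_diff l C Y (fun M => spnorm M ^+ 3)%R (sigma ^+ 3)%R ->
  let c := ((q + q).+1%:R * sch_dim R n q ^+ 2 * sigma ^+ 2)%R in
  forall k, (k <= l)%N ->
  \int[P]_(w in A0) (sch_norm q eps (\sum_(j < k) Y j w)%R ^+ 3)%:E <=
    (Num.sqrt (sch_norm q eps (0 : 'M[R]_n) ^+ 2 + 3 / 2 * c * k%:R) ^+ 3)%:E * P A0.
Proof.
move=> q0 eps0 sigma0 Cm YT YM c.
have nu0 := sch_dim_ge0 R n q; pose nu := sch_dim R n q; rewrite -/nu in nu0.
have cE : c = ((q + q).+1%:R * nu ^+ 2 * sigma ^+ 2)%R by [].
have N00 : (0 < sch_norm q eps (0 : 'M[R]_n))%R by apply: sch_norm_gt0 => //; rewrite trmx0.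
have c0 : (0 <= c)%R := mulr_ge0 (mulr_ge0 (ler0n _ _) (sqr_ge0 _)) (sqr_ge0 _).
have sigma_ge0 := ltW sigma0.
have [b [b0 bS bE]] : exists b : nat -> R, [/\ (forall k, 0 < b k)%R,
    (forall k, b k.+1 ^+ 2 = b k ^+ 2 + 3 / 2 * c)%R &
    forall k, b k = Num.sqrt (sch_norm q eps (0 : 'M[R]_n) ^+ 2 + 3 / 2 * c * k%:R)].
  exists (fun k => Num.sqrt (sch_norm q eps (0 : 'M[R]_n) ^+ 2 + 3 / 2 * c * k%:R)).
  split=> [k|k|//]; first by rewrite sqrtr_gt0 ltr_pwDl ?exprn_gt0// !mulr_ge0.
  rewrite !sqr_sqrtr ?addr_ge0 ?sqr_ge0 ?mulr_ge0//.
  by rewrite -natr1; ring.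
have integral_fin (x : R) : x%:E * P A0 < +oo.
  by rewrite -(fineK (fin_num_measure P _ mA0)) -EFinM ltry.
suff H k : (k <= l)%N ->
    \int[P]_(w in A0) (sch_norm q eps (\sum_(j < k) Y j w)%R ^+ 3)%:E <=
    (b k ^+ 3)%:E * P A0 by move=> k kl; rewrite -bE; exact: H.
elim: k => [_|k IH kl].
  rewrite (eq_integral (fun=> (sch_norm q eps (0 : 'M[R]_n) ^+ 3)%:E)); last first.
    by move=> w _; rewrite big_ord0.
  by rewrite integral_cst// bE mulr0 addr0 sqrtr_sqr ger0_norm// ltW.
have {}IH := IH (ltnW kl).
have ST w : (\sum_(j < k) Y j w)^T = (\sum_(j < k) Y j w)%R.
  by rewrite raddf_sum/=; apply: eq_bigr => j _; exact: YT.
pose S w := (\sum_(j < k) Y j w)%R.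
have mS := partial_sum_random YM (ltnW kl); rewrite -/S in mS.
have mSC := partial_sum_adapted YM kl; rewrite -/S in mSC.
have mY := diff_random YM kl.
pose N w := sch_norm q eps (S w); pose G w := sch_pow q eps (S w).
pose N1 w := sch_norm q eps (\sum_(j < k.+1) Y j w)%R.
have N0 w : (0 < N w)%R by apply: sch_norm_gt0 => //; exact: ST.
have N10 w : (0 <= N1 w)%R by exact: powR_ge0.
have G0 w : (0 < G w)%R by apply: sch_pow_gt0 => //; exact: ST.
have mN : measurable_fun setT N by exact: measurable_sch_norm.
have mN1 : measurable_fun setT N1 by exact: (measurable_sch_norm q eps (partial_sum_random YM kl)).
have mNC : measurable_fun [set: g_sigma_algebraType (C k)] (N : g_sigma_algebraType (C k) -> R).
  exact: (@measurable_sch_norm _ (g_sigma_algebraType (C k))).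
have mGC : measurable_fun [set: g_sigma_algebraType (C k)] (G : g_sigma_algebraType (C k) -> R).
  exact: (@measurable_sch_pow _ (g_sigma_algebraType (C k))).
have NG w : (N w ^+ (q + q).+2 = G w)%R.
  by have := sch_normX q eps0 (ST w); rewrite addSn addnS.
have SN w : (spnorm (S w) <= N w)%R by exact: (spnorm_le_sch q eps0 (ST w)).
have taylor w : (N1 w ^+ 3 <= N w ^+ 3 +
    3 * (N w ^+ 3 / G w) * \tr (S w ^+ (q + q).+1 * Y k w) +
    3 / 2 * (q + q).+1%:R * nu ^+ 2 * spnorm (Y k w) ^+ 2 *
      (N w + nu * spnorm (Y k w)))%R.
  by rewrite /N1 big_ord_recr/=; exact: (sch_norm3_taylor eps0 (ST w) (YT k w) q0).
suff : \int[P]_(w in A0) (N1 w ^+ 3)%:E <= (b k.+1 ^+ 3)%:E * P A0 by [].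
have {}IH : \int[P]_(w in A0) (N w ^+ 3)%:E <= (b k ^+ 3)%:E * P A0 by exact: IH.
clearbody N G N1 S nu; clear ST N00 bE.
have mN3 : measurable_fun setT (fun w => N w ^+ 3)%R by exact: measurable_funX.
have N30 w : (0 <= N w ^+ 3)%R by rewrite exprn_ge0// ltW.
have y30 w : (0 <= spnorm (Y k w) ^+ 3)%R by rewrite exprn_ge0// spnorm_ge0.
have mY3 : measurable_fun setT (fun w => spnorm (Y k w) ^+ 3)%R.
  by apply: measurable_funX; exact: measurable_spnorm.
have IY := diff_moment_total YM kl.
pose kap := (3 / 2 * (q + q).+1%:R * nu ^+ 2)%R.
have kap0 : (0 <= kap)%R by rewrite !mulr_ge0 ?invr_ge0 ?sqr_ge0.
have bk0 := ltW (b0 k); have bk2 := sqr_ge0 (b k).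
(* Coefficients of [cubic_young] at [b k], the size predicted by the recursion. *)
pose a1 := (kap * 2 / (9 * sigma * b k ^+ 2))%R.
pose b1 := (kap * 4 * b k / (9 * sigma) + kap * nu)%R.
pose a2 := (kap * sigma ^+ 2 / (9 * b k ^+ 2))%R.
pose b2 := (kap * sigma ^+ 2 * 2 * b k / 9)%R.
have a10 : (0 <= a1)%R by rewrite divr_ge0// ?mulr_ge0// mulr_ge0.
have b10 : (0 <= b1)%R by rewrite addr_ge0// ?divr_ge0// ?mulr_ge0// mulr_ge0.
have a20 : (0 <= a2)%R by rewrite divr_ge0// ?mulr_ge0// mulr_ge0.
have b20 : (0 <= b2)%R by rewrite divr_ge0// ?mulr_ge0// mulr_ge0.
pose h1 w := (a1 * N w ^+ 3 + b1)%R.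
pose Q w := (h1 w * spnorm (Y k w) ^+ 3 + (a2 * N w ^+ 3 + b2))%R.
(* The linear term of the expansion is a trace, split into entries so that centering applies; [phi]
   collects the factor known before the draw. *)
pose L (rc : 'I_n * 'I_n) w :=
  (3 * (N w ^+ 3 / G w) * (S w ^+ (q + q).+1) rc.1 rc.2 * Y k w rc.2 rc.1)%R.
pose phi (rc : 'I_n * 'I_n) w :=
  (3 * (N w ^+ 3 / G w) * (S w ^+ (q + q).+1) rc.1 rc.2)%R.
have mphi rc : measurable_fun [set: g_sigma_algebraType (C k)] (phi rc : g_sigma_algebraType (C k) -> R).
  apply: (@measurable_funM _ (g_sigma_algebraType (C k))); last first.
    exact: (@random_mxX _ (g_sigma_algebraType (C k)) _ _ _ _ mSC).
  apply: (@measurable_funM _ (g_sigma_algebraType (C k))) => //.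
  apply: (@measurable_funM _ (g_sigma_algebraType (C k))).
    by apply: measurable_funX; exact: mNC.
  rewrite (_ : (fun _ => _) = (fun w : g_sigma_algebraType (C k) => G w `^ (-1))%R).
    exact: (measurableT_comp (measurable_powR _)).
  by apply/funext => w; rewrite powR_inv1// ltW// G0.
(* An entry of S^(2p-1) is at most N^(2p-1) = P / N, where P is [G], which cancels against N^3 / P.
   The bound makes the linear terms integrable. *)
have phi_le rc w : (`|phi rc w| <= 3 * N w ^+ 2)%R.
  rewrite /phi normrM (ger0_norm (_ : 0 <= _)%R); last first.
    by rewrite mulr_ge0// divr_ge0// ltW.
  have hX : (`|(S w ^+ (q + q).+1) rc.1 rc.2| <= N w ^+ (q + q).+1)%R.
    rewrite (le_trans (spnorm_entry _ _ _))// (le_trans (spnormX _ _))//.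
    by rewrite lerXn2r ?nnegrE ?spnorm_ge0 ?(ltW (N0 w)).
  have e0 : (0 <= 3 * (N w ^+ 3 / G w))%R by rewrite mulr_ge0// divr_ge0// ltW.
  rewrite (le_trans (ler_wpM2l e0 hX))// -NG (exprS _ (q + q).+1).
  have := N0 w; move: (N w) => x x0.
  have X0 : (x ^+ (q + q).+1 != 0)%R by rewrite expf_neq0// gt_eqF.
  move: (x ^+ (q + q).+1)%R X0 => z z0.
  by rewrite le_eqVlt; apply/orP; left; apply/eqP; field; rewrite z0 gt_eqF.
have Sum_oo : \int[P]_(w in A0) (N w ^+ 3 + spnorm (Y k w) ^+ 3)%:E < +oo.
  under eq_integral do rewrite EFinD.
  rewrite ge0_integralD//.
  - rewrite lte_add_pinfty//; first exact: le_lt_trans IH (integral_fin _).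
    exact: le_lt_trans IY (integral_fin _).
  - by move=> w _; rewrite lee_fin.
  - by apply/measurable_EFinP; apply: measurable_funTS.
  - by move=> w _; rewrite lee_fin.
  - by apply/measurable_EFinP; apply: measurable_funTS.
have iL rc : P.-integrable A0 (fun w => (L rc w)%:E).
  apply: (@integrable_dominated _ (fun w => 3 * (N w ^+ 3 + spnorm (Y k w) ^+ 3) + 0)%R).
  - apply: measurable_funM; last exact: mY.
    by move=> _ B mB; apply: (sub_gen_measurable (@Cm k)); exact: mphi.
  - by apply: measurable_funD => //; apply: measurable_funM => //; exact: measurable_funD.
  - move=> w; rewrite normrM addr0.
    apply: le_trans (ler_pM _ _ (phi_le rc w) (spnorm_entry _ _ _)) _ => //.
    have := N0 w; have := spnorm_ge0 (Y k w); move: (N w) (spnorm _) => x z z0 x0.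
    by rewrite -mulrA ler_wpM2l// sqrM_le_cube// ltW.
  - rewrite integral_affine//.
    + by rewrite mul0e adde0 lte_mul_pinfty.
    + exact: measurable_funD.
    + by move=> w; rewrite addr_ge0.
have L0 rc : \int[P]_(w in A0) (L rc w)%:E = 0.
  exact: (integral_diff_weight Cm YM kl (mphi rc) (iL rc)).
have Q0 w : (0 <= Q w)%R.
  apply: addr_ge0; last by apply: addr_ge0 => //; exact: mulr_ge0.
  by apply: mulr_ge0 => //; apply: addr_ge0 => //; exact: mulr_ge0.
have mQ : measurable_fun setT Q.
  apply: measurable_funD; last first.
    by apply: measurable_funD => //; exact: measurable_funM.
  apply: measurable_funM => //; apply: measurable_funD => //.
  exact: measurable_funM.
have step := @integral_step _ (fun w => N w ^+ 3)%R
  (fun w => N1 w ^+ 3)%R Q L.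
apply: (le_trans (step _ _ _ _ _ _ _ iL L0)).
- exact: measurable_funX.
- exact: measurable_funX.
- exact: mQ.
- by move=> w; rewrite exprn_ge0// ltW.
- by move=> w; rewrite exprn_ge0.
- by [].
- move=> w; apply: le_trans (taylor w) _.
  have -> : (\sum_rc L rc w = 3 * (N w ^+ 3 / G w) *
      \tr (S w ^+ (q + q).+1 * Y k w))%R.
    rewrite /mxtrace mulr_sumr -(pair_bigA _ (fun r c => L (r, c) w))/=.
    apply: eq_bigr => r _; rewrite mxE mulr_sumr; apply: eq_bigr => j _.
    by rewrite /L/= !mulrA.
  rewrite lerD2l -/kap.
  by apply: cubic_young => //; exact: spnorm_ge0.
have IQ : \int[P]_(w in A0) (Q w)%:E <= ((sigma ^+ 3) * (a1 * b k ^+ 3 + b1) + (a2 * b k ^+ 3 + b2))%:E * P A0.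
  have PAf : P A0 \is a fin_num by exact: fin_num_measure.
  have aff a e : (0 <= a)%R -> (0 <= e)%R ->
      \int[P]_(w in A0) (a * N w ^+ 3 + e)%:E <= (a * b k ^+ 3 + e)%:E * P A0.
    move=> a_ge0 e_ge0; rewrite integral_affine// EFinD EFinM (muleDl PAf)//.
    by rewrite leeD// -muleA lee_wpmul2l.
  rewrite /Q; under eq_integral do rewrite EFinD.
  have mh1 : measurable_fun setT h1 by apply: measurable_funD => //; exact: measurable_funM.
  have h10 w : (0 <= h1 w)%R by rewrite addr_ge0// mulr_ge0.
  rewrite ge0_integralD//; last 4 first.
  - by move=> w _; rewrite lee_fin mulr_ge0.
  - by apply/measurable_EFinP; apply: measurable_funTS; exact: measurable_funM.
  - by move=> w _; rewrite lee_fin addr_ge0// mulr_ge0.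
  - apply/measurable_EFinP; apply: measurable_funTS; apply: measurable_funD => //.
    exact: measurable_funM.
  rewrite EFinD (muleDl PAf)//.
  apply: leeD.
    apply: (@le_trans _ _ ((sigma ^+ 3)%:E * \int[P]_(w in A0) (h1 w)%:E)).
      apply: (diff_moment_weight Cm YM) => //.
      + by rewrite exprn_ge0.
      + by move=> M; rewrite exprn_ge0 ?spnorm_ge0.
      + move=> j jl; apply: measurable_funX; apply: measurable_spnorm.
        exact: (diff_random YM).
      + apply: (@measurable_funD _ (g_sigma_algebraType (C k))) => //.
        apply: (@measurable_funM _ (g_sigma_algebraType (C k))) => //.
        by apply: measurable_funX; exact: mNC.
    rewrite [X in _ <= X * _]EFinM -[leRHS]muleA.
    by apply: lee_wpmul2l; [rewrite lee_fin exprn_ge0|exact: aff].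
  exact: aff.
apply: (le_trans (leeD IH IQ)).
rewrite -(muleDl (fin_num_measure P _ mA0))//.
apply: lee_wpmul2r => //; rewrite -EFinD lee_fin.
apply: le_trans (@cubic_recursion (b k) c (nu * sigma) (b k.+1) _ _ _ _ (bS k)).
(* Because AM-GM is tight at the chosen point, the coefficients add up exactly to 3/2 c b_k + 3/2 c
   nu sigma. *)
- rewrite -addrA lerD2l le_eqVlt; apply/orP; left; apply/eqP.
  rewrite /a1 /b1 /a2 /b2 /kap cE.
  have := b0 k; move: (b k) => x x0.
  by field; rewrite !gt_eqF.
- by rewrite ltW.
- by rewrite mulr_ge0.
(* The condition 3 tau^2 <= c amounts to 3 <= 2q + 1, true since [q] is positive. *)
- rewrite cE exprMn mulrA ler_wpM2r ?sqr_ge0// ler_wpM2r ?sqr_ge0//.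
  by rewrite ler_nat ltnS -[2%N]/(1 + 1)%N leq_add.
- by rewrite ltW.
Qed.

End martingale.

(** * The sampled derivatives *)

Section sampling.
Context d (T : measurableType d) (R : realType) (P : probability T R).
Variables (G : set (set T)) (Gm : forall A, G A -> d.-measurable A).
Variables (N p q : nat) (b : T -> nat) (I : nat -> T -> 'I_N).
Variables (Z : 'I_N -> T -> 'M[R]_(p, q)) (M : T -> 'M[R]_(p, q)).
Hypothesis CS : conditional_sampling P G b I Z M.
Variable M' : T -> 'M[R]_(p, q).
Hypothesis mM' : random_mx (M' : g_sigma_algebraType G -> 'M[R]_(p, q)).
Hypothesis M'E : {ae P, forall w, M' w = M w}.
Hypothesis mM : random_mx M.
Variables (psi : 'M[R]_(p, q) -> R) (s : R).
Hypothesis psi_ge0 : forall X, 0 <= psi X.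
Hypothesis psi_random : forall d' (T' : measurableType d') (U : T' -> 'M[R]_(p, q)),
  random_mx U -> measurable_fun setT (fun w => psi (U w)).
Hypothesis psi_entry : forall (X : 'M[R]_(p, q)) i j, `|X i j| <= 1 + psi X.
Hypothesis s_ge0 : 0 <= s.
Hypothesis psi_moment : forall i, {ae P, forall w,
  (cond_exp P G (fun w => psi (Z i w - M w)) w <= s%:E)%E}.
Local Open Scope ereal_scope.

Let U j w := Z (I j w) w.

Lemma random_sub p' q' (C : set (set T)) (V : T -> 'M[R]_(p', q')) :
  (forall A, C A -> d.-measurable A) ->
  random_mx (V : g_sigma_algebraType C -> 'M[R]_(p', q')) -> random_mx V.
Proof.
by move=> Cm mV i j _ B mB; apply: (sub_gen_measurable Cm); exact: mV.
Qed.

Lemma draw_value_random j : random_mx (U j).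
Proof.
move=> r c; rewrite (_ : (fun _ => _) =
    (fun w => \sum_i \1_[set w | I j w = i] w * Z i w r c)%R).
  apply: measurable_sum => i; apply: measurable_funM; last exact: (term_random CS).
  by apply: measurable_indic; exact: (draw_random CS).
apply/funext => w; rewrite (bigD1 (I j w))//= indicE mem_set// mul1r big1 ?addr0//.
by move=> i Ii; rewrite indicE memNset ?mul0r//= => /esym/eqP; rewrite (negbTE Ii).
Qed.

(* A pi-system generating the past [G] and the first [k] sampled values. *)
Definition history k : set (set T) := [set E | exists A (B : nat -> set 'M[R]_(p, q)),
  [/\ G.-sigma.-measurable A, forall j, mx_borel (B j) &
      E = A `&` [set w | forall j, (j < k)%N -> B j (U j w)]]].

Lemma draws_measurable k (B : nat -> set 'M[R]_(p, q)) : (forall j, mx_borel (B j)) ->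
  d.-measurable [set w | forall j, (j < k)%N -> B j (U j w)].
Proof.
move=> mB; rewrite (_ : mkset _ = \bigcap_(j < k) (U j @^-1` B j))//.
apply: bigcap_measurableType => j _; apply: random_mx_preimage => //.
exact: draw_value_random.
Qed.

Lemma history_measurable k E : history k E -> d.-measurable E.
Proof.
move=> [A [B [mA mB ->]]]; apply: measurableI; first exact: sub_gen_measurable mA.
exact: draws_measurable.
Qed.

Lemma historyI k : setI_closed (history k).
Proof.
move=> _ _ [A [B [mA mB ->]]] [A' [B' [mA' mB' ->]]].
exists (A `&` A'), (fun j => B j `&` B' j); split.
- exact: (@measurableI _ (g_sigma_algebraType _)).
- by move=> j; exact: mx_borelI.
rewrite setIACA; congr (_ `&` _); apply/seteqP; split => w /=.
  by move=> [h h'] j jk; split; [exact: h|exact: h'].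
by move=> h; split => j jk; have [] := h j jk.
Qed.

Lemma historyT k : history k setT.
Proof.
exists setT, (fun=> setT); split.
- exact: (@measurableT _ (g_sigma_algebraType _)).
- by move=> j; exact: mx_borelT.
- by rewrite setTI; apply/seteqP.
Qed.

Lemma history_past k A : G.-sigma.-measurable A -> history k A.
Proof.
move=> mA; exists A, (fun=> setT); split => //; first by move=> j; exact: mx_borelT.
by rewrite [X in _ `&` X](_ : _ = setT) ?setIT//; apply/seteqP.
Qed.

Lemma history_draw j k : (j < k)%N ->
  random_mx (U j : g_sigma_algebraType (history k) -> 'M[R]_(p, q)).
Proof.
move=> jk r c _ S mS; rewrite setTI; apply: sub_sigma_algebra.
exists setT, (fun i => if i == j then [set X : 'M[R]_(p, q) | S (X r c)] else setT).
split.
- exact: (@measurableT _ (g_sigma_algebraType _)).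
- move=> i; case: ifP => _; last exact: mx_borelT.
  by apply: sub_sigma_algebra; exists r, c, S.
rewrite setTI; apply/seteqP; split => w /=.
  by move=> h i ik; case: ifPn => // /eqP ->.
by move=> /(_ j jk); rewrite eqxx.
Qed.

Lemma history_random_past k :
  random_mx (M' : g_sigma_algebraType (history k) -> 'M[R]_(p, q)).
Proof.
move=> r c _ S mS; rewrite setTI; apply: sub_sigma_algebra; apply: history_past.
by rewrite -[X in _ X]setTI; exact: mM'.
Qed.

Variables (l : nat) (A0 : set T).
Hypotheses (mA0 : G.-sigma.-measurable A0) (A0b : A0 `<=` [set w | b w = l]).

(* Under the product rule for the [l] draws, the events after the [k]-th one
   are taken to be [setT], of conditional probability one. *)
Lemma draws_cond_indep k (B : nat -> set 'M[R]_(p, q)) (Bk : set 'M[R]_(p, q)) :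
  (k < l)%N -> (forall j, mx_borel (B j)) -> mx_borel Bk ->
  {ae P, forall w, A0 w ->
    cond_prob P G ([set w | forall j, (j < k)%N -> B j (U j w)] `&` U k @^-1` Bk) w =
    cond_prob P G [set w | forall j, (j < k)%N -> B j (U j w)] w *
    cond_prob P G (U k @^-1` Bk) w}.
Proof.
move=> kl mB mBk.
pose B1 (j : 'I_l) := if (j < k)%N then B j else if j == k :> nat then Bk else setT.
pose B2 (j : 'I_l) := if (j < k)%N then B j else setT.
have mB1 j : mx_borel (B1 j).
  by rewrite /B1; case: ifP => // _; case: ifP => // _; exact: mx_borelT.
have mB2 j : mx_borel (B2 j).
  by rewrite /B2; case: ifP => // _; exact: mx_borelT.
have E1 : \bigcap_j [set w | B1 j (U j w)] =
    [set w | forall j, (j < k)%N -> B j (U j w)] `&` U k @^-1` Bk.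
  apply/seteqP; split => w /=.
    move=> h; split.
      by move=> j jk; have := h (Ordinal (ltn_trans jk kl)) Logic.I; rewrite /B1/= jk.
    by have := h (Ordinal kl) Logic.I; rewrite /B1/= ltnn eqxx.
  move=> [h hk] j _; rewrite /B1/=; case: ifPn => [/h//|_].
  by case: ifPn => // /eqP ->.
have E2 : \bigcap_j [set w | B2 j (U j w)] =
    [set w | forall j, (j < k)%N -> B j (U j w)].
  apply/seteqP; split => w /=.
    by move=> h j jk; have := h (Ordinal (ltn_trans jk kl)) Logic.I; rewrite /B2/= jk.
  by move=> h j _; rewrite /B2/=; case: ifPn => [/h//|_].
have T1 : {ae P, forall w, cond_prob P G setT w = 1}.
  by move: (cond_probE P Gm (@measurableT _ T)) (cond_exp_nnegT P Gm);
    apply: filterS2 => w ->.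
move: (sample_indep CS mB1) (sample_indep CS mB2) T1.
apply: filterS3 => w H1 H2 pT A0w; have bw := A0b A0w.
have {}H1 := H1 bw; have {}H2 := H2 bw.
rewrite -E1 -[in RHS]E2 H1 H2.
rewrite (bigD1 (Ordinal kl))//= [in RHS](bigD1 (Ordinal kl))//=.
have -> : [set x | B2 (Ordinal kl) (Z (I k x) x)] = setT.
  by apply/seteqP; split => // x _ /=; rewrite /B2/= ltnn.
rewrite pT mul1e muleC; congr (_ * _).
  apply: eq_bigr => j jk; congr (cond_prob P G _ w); apply/seteqP.
  by split => x /=; rewrite /B1 /B2; case: ifP => // _; rewrite ifN.
by congr (cond_prob P G _ w); apply/seteqP; split => x /=; rewrite /B1/= ltnn eqxx.
Qed.

Let Y k w : 'M[R]_(p, q) := (U k w - M' w)%R.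

Lemma mM'T : random_mx M'.
Proof. exact: (random_sub Gm mM'). Qed.

Lemma diff_value_random k : random_mx (Y k).
Proof. by apply: random_mxB; [exact: draw_value_random|exact: mM'T]. Qed.

Lemma join_mx_random (V : T -> 'M[R]_(p, q)) :
  random_mx (V : g_sigma_algebraType (join_mx G V) -> 'M[R]_(p, q)).
Proof.
move=> r c _ S mS; rewrite setTI; apply: sub_sigma_algebra.
exists setT, [set X : 'M[R]_(p, q) | S (X r c)]; split.
- exact: (@measurableT _ (g_sigma_algebraType _)).
- by apply: sub_sigma_algebra; exists r, c, S.
- by rewrite setTI.
Qed.

Lemma join_mx_past (V : T -> 'M[R]_(p, q)) :
  random_mx (M' : g_sigma_algebraType (join_mx G V) -> 'M[R]_(p, q)).
Proof.
move=> r c _ S mS; rewrite setTI; apply: sub_sigma_algebra.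
exists ((fun w => M' w r c) @^-1` S), setT; split => //.
- by rewrite -[X in _ X]setTI; exact: mM'.
- exact: mx_borelT.
- by rewrite preimage_setT setIT.
Qed.

Lemma join_mx_diff (V : T -> 'M[R]_(p, q)) :
  random_mx ((fun w => V w - M' w)%R : g_sigma_algebraType (join_mx G V) -> 'M[R]_(p, q)).
Proof.
apply: (@random_mxB _ (g_sigma_algebraType (join_mx G V))).
  exact: join_mx_random.
exact: join_mx_past.
Qed.

(** The moment hypothesis concerns a fixed index, whereas the drawn index may be random. The
    integral is split over its values, and [draw_indep] lets each piece use the bound for its own
    index. *)
Lemma sampled_moment k A : (k < l)%N -> G.-sigma.-measurable A -> A `<=` A0 ->
  \int[P]_(w in A) (psi (Y k w))%:E <= s%:E * P A.
Proof.
move=> kl mA AA0; have mA' := sub_gen_measurable Gm mA.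
pose E i := [set w | I k w = i].
have mE i : d.-measurable (E i) by exact: (draw_random CS).
pose g i w := psi (Z i w - M' w).
have mg i : measurable_fun setT (g i).
  by apply: psi_random; apply: random_mxB; [exact: (term_random CS)|exact: mM'T].
have sE w (h : 'I_N -> \bar R) : \sum_i ind (E i) w * h i = h (I k w).
  rewrite (bigD1 (I k w))//= /ind indicE mem_set// mul1e big1 ?adde0//.
  by move=> i Ii; rewrite indicE memNset ?mul0e//= => /esym/eqP; rewrite (negbTE Ii).
have iE (h : T -> \bar R) i : \int[P]_(w in A) (ind (E i) w * h w) =
    \int[P]_(w in A `&` E i) h w.
  rewrite (integral_ind P A) (integral_ind P (A `&` E i)).
  by apply: eq_integral => w _; rewrite indI muleA.
have -> : \int[P]_(w in A) (psi (Y k w))%:E =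
    \sum_(i < N) \int[P]_(w in A `&` E i) (g i w)%:E.
  rewrite (eq_integral (fun w => \sum_(i < N) ind (E i) w * (g i w)%:E)); last first.
    by move=> w _; rewrite (sE w (fun i => (g i w)%:E)).
  rewrite ge0_integral_sum//.
  - by apply: eq_bigr => i _; rewrite iE.
  - move=> i; apply: emeasurable_funM; apply: measurable_funTS.
      exact: measurable_ind.
    exact/measurable_EFinP.
  - by move=> i w _; apply: mule_ge0; [exact: ind_ge0|rewrite lee_fin; exact: psi_ge0].
have -> : s%:E * P A = \sum_(i < N) s%:E * P (A `&` E i).
  rewrite -(integral_cst P mA').
  rewrite (eq_integral (fun w => \sum_(i < N) ind (E i) w * s%:E)); last first.
    by move=> w _; rewrite (sE w (fun=> s%:E)).
  rewrite ge0_integral_sum//.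
  - apply: eq_bigr => i _; rewrite (iE (cst s%:E)) integral_cst//.
    exact: measurableI.
  - move=> i; apply: emeasurable_funM => //; apply: measurable_funTS.
    exact: measurable_ind.
  - by move=> i w _; apply: mule_ge0; [exact: ind_ge0|rewrite lee_fin].
apply: lee_sum => i _.
pose h w := psi (Z i w - M w).
have mh : measurable_fun setT h.
  by apply: psi_random; apply: random_mxB => //; exact: (term_random CS).
have hg : {ae P, forall w, h w = g i w}.
  by move: M'E; apply: filterS => w; rewrite /h /g => ->.
have Hh := cond_exp_nnegP P Gm mh (fun w => psi_ge0 _); have [V0 mV VI] := Hh.
(* Replacing M by [M'] keeps the version of the conditional expectation and makes the variable
   measurable for [G] and [Z i] together. *)
have Hg : is_cond_exp P G (g i) (cond_exp_nneg P G h).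
  split => // B mB; rewrite VI//; apply: ge0_ae_eq_integral.
  - exact: sub_gen_measurable Gm _ mB.
  - by apply/measurable_EFinP; exact: measurable_funTS.
  - by apply/measurable_EFinP; exact: measurable_funTS.
  - by move=> w _; rewrite lee_fin; exact: psi_ge0.
  - by move=> w _; rewrite lee_fin; exact: psi_ge0.
  - by move: hg; apply: filterS => w ->.
have mgj : measurable_fun [set: g_sigma_algebraType (join_mx G (Z i))]
    (g i : g_sigma_algebraType (join_mx G (Z i)) -> R).
  apply: (psi_random (T' := g_sigma_algebraType (join_mx G (Z i)))).
  exact: join_mx_diff.
rewrite (@cond_indep_integral _ _ _ P G Gm p q (Z i) (term_random CS i) A (E i)
  (g i) _ mA (mE i) _ mgj (fun w => psi_ge0 _) Hg); last first.
  move=> B mB; have := draw_indep CS k i mB; apply: filterS => w H Aw.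
  by apply: H; rewrite (A0b (AA0 _ Aw)).
rewrite -integral_cst; last exact: measurableI.
apply: ae_ge0_le_integral => //.
- exact: measurableI.
- by apply: measurable_funTS; exact: (is_cond_exp_measurable Gm Hh).
- by move: (cond_exp_nnegE P Gm (fun w => psi_ge0 (Z i w - M w))) (psi_moment i);
    apply: filterS2 => w <- H _.
Qed.

(** Given the past, a draw is independent of the earlier ones, so they may be added to the
    conditioning. *)
Lemma history_cond_exp k (g : T -> R) D : (k < l)%N ->
  measurable_fun [set: g_sigma_algebraType (join_mx G (U k))]
    (g : g_sigma_algebraType (join_mx G (U k)) -> R) ->
  (forall w, 0 <= g w)%R -> \int[P]_(w in A0) (g w)%:E < +oo ->
  (history k).-sigma.-measurable D ->
  \int[P]_(w in A0 `&` D) (g w)%:E = \int[P]_(w in A0 `&` D) cond_exp_nneg P G g w.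
Proof.
move=> kl mg g0 goo mD.
have mU := draw_value_random k.
have mg' : measurable_fun setT g.
  by move=> _ B mB; apply: (sub_gen_measurable (join_mx_measurable Gm mU)); exact: mg.
have Hg := cond_exp_nnegP P Gm mg' g0; have [V0 mV VI] := Hg.
have mA0' := sub_gen_measurable Gm mA0.
have iD (h : T -> \bar R) B : \int[P]_(w in A0 `&` B) h w =
    \int[P]_(w in B) (ind A0 w * h w).
  rewrite (integral_ind P (A0 `&` B)) (integral_ind P B).
  by apply: eq_integral => w _; rewrite indI [in RHS]muleA (muleC (ind A0 w)).
rewrite !iD; apply: (pi_system_integral_eq (@history_measurable k)) mD.
- by apply: emeasurable_funM; [exact: measurable_ind|exact/measurable_EFinP].
- by move=> w; rewrite mule_ge0 ?ind_ge0 ?lee_fin.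
- apply: emeasurable_funM; first exact: measurable_ind.
  exact: (is_cond_exp_measurable Gm Hg).
- by move=> w; rewrite mule_ge0 ?ind_ge0.
- by rewrite -(integral_ind P A0).
- exact: historyI.
- exact: historyT.
move=> _ [A [B [mA mB ->]]]; rewrite -!iD !setIA.
apply: (@cond_indep_integral _ _ _ P G Gm p q (U k) mU) => //.
- exact: (@measurableI _ (g_sigma_algebraType _)).
- exact: draws_measurable.
move=> Bk mBk; have := draws_cond_indep kl mB mBk.
by apply: filterS => w H [A0w _]; exact: H.
Qed.

Lemma integrable_moment k : (k < l)%N -> \int[P]_(w in A0) (psi (Y k w))%:E < +oo.
Proof.
move=> kl; apply: le_lt_trans (sampled_moment kl mA0 (@subset_refl _ _)) _.
have mA0' := sub_gen_measurable Gm mA0.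
by rewrite -(fineK (fin_num_measure P _ mA0')) -EFinM ltry.
Qed.

Lemma sampled_moment_history k D : (k < l)%N -> (history k).-sigma.-measurable D ->
  \int[P]_(w in A0 `&` D) (psi (Y k w))%:E <= s%:E * P (A0 `&` D).
Proof.
move=> kl mD; have mA0' := sub_gen_measurable Gm mA0.
have mD' := sub_gen_measurable (@history_measurable k) mD.
have mpsi : measurable_fun setT (fun w => psi (Y k w)).
  by apply: psi_random; exact: diff_value_random.
have Hg := cond_exp_nnegP P Gm mpsi (fun w => psi_ge0 _); have [V0 mV VI] := Hg.
rewrite history_cond_exp//; last 2 first.
- apply: (psi_random (T' := g_sigma_algebraType (join_mx G (U k)))).
  exact: join_mx_diff.
- exact: integrable_moment.
rewrite -integral_cst; last exact: measurableI.
apply: ae_ge0_le_integral => //.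
- exact: measurableI.
- by apply: measurable_funTS; exact: (is_cond_exp_measurable Gm Hg).
have : {ae P, forall w, A0 w -> cond_exp_nneg P G (fun w => psi (Y k w)) w <= s%:E}.
  apply: (ae_le_cst Gm) => // A mA AA0.
  by rewrite VI//; exact: sampled_moment.
by apply: filterS => w H [A0w _]; exact: H.
Qed.

Lemma sampled_mean k i j A : (k < l)%N -> G.-sigma.-measurable A -> A `<=` A0 ->
  \int[P]_(w in A) ((fun w => Y k w i j)^\+ w)%:E =
  \int[P]_(w in A) ((fun w => Y k w i j)^\- w)%:E.
Proof.
move=> kl mA AA0; have mA' := sub_gen_measurable Gm mA.
pose y w := Y k w i j; pose u w := U k w i j; pose m w := M' w i j.
have my : measurable_fun setT y by exact: diff_value_random.
have mu : measurable_fun setT u by exact: draw_value_random.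
have mm : measurable_fun setT m by exact: mM'T.
have mmG : measurable_fun [set: g_sigma_algebraType G] (m : g_sigma_algebraType G -> R) by exact: mM'.
have mup : measurable_fun setT u^\+%R by exact: measurable_funrpos.
have mun : measurable_fun setT u^\-%R by exact: measurable_funrneg.
have myp : measurable_fun setT y^\+%R by exact: measurable_funrpos.
have myn : measurable_fun setT y^\-%R by exact: measurable_funrneg.
have mmp : measurable_fun setT m^\+%R by exact: measurable_funrpos.
have mmn : measurable_fun setT m^\-%R by exact: measurable_funrneg.
have Hp := cond_exp_nnegP P Gm mup (@funrpos_ge0 _ _ u).
have Hn := cond_exp_nnegP P Gm mun (@funrneg_ge0 _ _ u).
set Vp := cond_exp_nneg P G _ in Hp; set Vn := cond_exp_nneg P G _ in Hn.
have [Vp0 mVp VpI] := Hp; have [Vn0 mVn VnI] := Hn.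
have mVpT := is_cond_exp_measurable Gm Hp; have mVnT := is_cond_exp_measurable Gm Hn.
(* [U k] need not be integrable on [A], so the parts are compared on [X <= K]
   and [K] tends to infinity. *)
pose X w := Vp w + (m^\- w)%:E; pose X' w := Vn w + (m^\+ w)%:E.
have mX : sub_measurable_fun G X.
  apply: emeasurable_funD => //; apply/measurable_EFinP.
  exact: (@measurable_funrneg _ (g_sigma_algebraType G)).
have XE : {ae P, forall w, A0 w -> X w \is a fin_num /\ X w = X' w}.
  move: M'E (sample_mean CS k i j); apply: filterS2 => w Mw H A0w.
  have {}H : Vp w - Vn w = (m w)%:E by rewrite /m Mw; apply: H; rewrite (A0b A0w).
  (* A difference equal to a real number leaves neither term infinite. *)
  have Vpf : Vp w \is a fin_num.
    by move: H (Vp0 w) (Vn0 w); case: (Vp w) => [?||]; case: (Vn w) => [?||].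
  have Vnf : Vn w \is a fin_num.
    by move: H (Vp0 w) (Vn0 w); case: (Vp w) => [?||]; case: (Vn w) => [?||].
  split; first by rewrite fin_numD Vpf.
  move: H; rewrite /X /X' -(fineK Vpf) -(fineK Vnf) -EFinB -!EFinD => -[] H.
  congr EFin; rewrite /funrneg /funrpos (maxr0E (m w)) -H.
  by move: (fine (Vp w)) (fine (Vn w)) (Num.max _ _) => x x' x''; ring.
pose AK (K : nat) := [set w | X w <= K%:R%:E] `&` A.
have mAKG K : G.-sigma.-measurable (AK K).
  apply: (@measurableI _ (g_sigma_algebraType G)) => //.
  by rewrite -[X in _ X]setTI; exact: (@measurable_lee _ (g_sigma_algebraType G)).
have mAK K := sub_gen_measurable Gm (mAKG K).
have mTS (B : set T) (h : T -> R) : measurable_fun setT h -> measurable_fun B (EFin \o h).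
  by move=> mh; apply/measurable_EFinP; exact: measurable_funTS.
have EK K : \int[P]_(w in AK K) (y^\+ w)%:E = \int[P]_(w in AK K) (y^\- w)%:E.
  have I1 : \int[P]_(w in AK K) (u^\+ w + m^\- w)%:E = \int[P]_(w in AK K) X w.
    under eq_integral do rewrite EFinD.
    rewrite ge0_integralD//; [|by move=> w _; rewrite lee_fin|exact: mTS|
      by move=> w _; rewrite lee_fin|exact: mTS].
    rewrite -(VpI _ (mAKG K)) /X ge0_integralD//; [exact: measurable_funTS|
      by move=> w _; rewrite lee_fin|exact: mTS].
  have I2 : \int[P]_(w in AK K) (u^\- w + m^\+ w)%:E = \int[P]_(w in AK K) X' w.
    under eq_integral do rewrite EFinD.
    rewrite ge0_integralD//; [|by move=> w _; rewrite lee_fin|exact: mTS|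
      by move=> w _; rewrite lee_fin|exact: mTS].
    rewrite -(VnI _ (mAKG K)) /X' ge0_integralD//; [exact: measurable_funTS|
      by move=> w _; rewrite lee_fin|exact: mTS].
  have X0 w : 0 <= X w by rewrite adde_ge0// lee_fin.
  have X'0 w : 0 <= X' w by rewrite adde_ge0// lee_fin.
  have I3 : \int[P]_(w in AK K) X w = \int[P]_(w in AK K) X' w.
    apply: ge0_ae_eq_integral => //.
    - by apply: measurable_funTS; exact: (sub_measurable_funT Gm).
    - by apply: emeasurable_funD; [exact: measurable_funTS|exact: mTS].
    - by move: XE; apply: filterS => w H [_ /AA0] /H[].
  have Xoo : \int[P]_(w in AK K) X w \is a fin_num.
    rewrite ge0_fin_numE; last by apply: integral_ge0.
    apply: (@le_lt_trans _ _ (\int[P]_(w in AK K) K%:R%:E)).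
      apply: ge0_le_integral => //.
      - by apply: measurable_funTS; exact: (sub_measurable_funT Gm).
      - by move=> w [].
    rewrite (integral_cst P (mAK K) K%:R%:E).
    apply: lte_mul_pinfty => //; rewrite ?lee_fin//.
    by rewrite (le_lt_trans (probability_le1 P (mAK K)))// ltry.
  (* The finite integral of X cancels from both sides and leaves the two parts of y. *)
  have : \int[P]_(w in AK K) ((u^\+ w + m^\- w)%:E + (y^\- w)%:E) =
      \int[P]_(w in AK K) ((u^\- w + m^\+ w)%:E + (y^\+ w)%:E).
    apply: eq_integral => w _; rewrite -!EFinD; congr EFin.
    have := maxr0_sub (u w) (m w).
    by rewrite /funrpos /funrneg /y /Y !mxE.
  rewrite !ge0_integralD//; try (by [exact: mTS|move=> w _; rewrite lee_fin ?addr_ge0|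
    apply: mTS; exact: measurable_funD]).
  rewrite I1 I2 -I3 => /(congr1 (fun x => x - \int[P]_(w in AK K) X w)).
  by rewrite !(addeC (\int[P]_(w in AK K) X w)) !addeK.
have ndAK : nondecreasing_seq AK.
  move=> K K' KK'; rewrite subsetEset => w [XK Aw]; split => //=.
  by rewrite (le_trans XK)// lee_fin ler_nat.
have L (h : T -> R) (mh : measurable_fun setT h) (h0 : forall w, (0 <= h w)%R) :=
  @ge0_nondecreasing_set_cvg_integral _ _ _ AK (EFin \o h) P ndAK mAK
    (fun K => mTS (AK K) h mh) (fun _ w _ => h0 w).
(* The truncated events exhaust [A] up to a negligible set, since X is finite almost surely on
   [A0]. *)
have UA (h : T -> R) (mh : measurable_fun setT h) (h0 : forall w, (0 <= h w)%R) :
    \int[P]_(w in A) (h w)%:E = \int[P]_(w in \bigcup_K AK K) (h w)%:E.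
  have mU := bigcup_measurable (fun K (_ : setT K) => mAK K).
  rewrite (integral_ind P A) (integral_ind P (\bigcup_K AK K)).
  have mB B : d.-measurable B -> measurable_fun setT (fun w => ind B w * (h w)%:E : \bar R).
    by move=> mB; apply: emeasurable_funM; [exact: measurable_ind|exact/measurable_EFinP].
  apply: ge0_ae_eq_integral => //; [exact: mB|exact: mB|
    by move=> w _; rewrite mule_ge0 ?ind_ge0 ?lee_fin|
    by move=> w _; rewrite mule_ge0 ?ind_ge0 ?lee_fin|].
  move: XE; apply: filterS => w H _; congr (_ * _); congr (_%:E).
  rewrite !indicE; congr (_%:R); congr (nat_of_bool _); apply/idP/idP.
    rewrite !inE => Aw; have [Xf _] := H (AA0 _ Aw).
    exists (Num.truncn (fine (X w))).+1 => //; split=> //=.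
    by rewrite -(fineK Xf) lee_fin ltW// truncnS_gt.
  by rewrite !inE => -[K _ []].
rewrite (UA _ myp (@funrpos_ge0 _ _ y)) (UA _ myn (@funrneg_ge0 _ _ y)).
rewrite -(cvg_lim _ (L _ myp (@funrpos_ge0 _ _ y)))//.
rewrite -(cvg_lim _ (L _ myn (@funrneg_ge0 _ _ y)))//.
by congr (limn _); apply/funext => K; exact: EK.
Qed.

(** On a generating event, conditional independence turns the indicator of the earlier draws into a
    weight of the past, and [sampled_mean] applies. The bound of entries by 1 + psi gives the
    finiteness needed to leave the pi-system. *)
Lemma sampled_centered k i j : (k < l)%N ->
  centered P A0 (history k) (fun w => Y k w i j).
Proof.
move=> kl D mD.
pose y w := Y k w i j.
have mU := draw_value_random k.
have my : measurable_fun setT y by exact: diff_value_random.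
have myJ : measurable_fun [set: g_sigma_algebraType (join_mx G (U k))]
    (y : g_sigma_algebraType (join_mx G (U k)) -> R) by exact: join_mx_diff.
have myp : measurable_fun setT y^\+%R by exact: measurable_funrpos.
have myn : measurable_fun setT y^\-%R by exact: measurable_funrneg.
have mA0' := sub_gen_measurable Gm mA0.
have iD (h : T -> \bar R) B : \int[P]_(w in A0 `&` B) h w =
    \int[P]_(w in B) (ind A0 w * h w).
  rewrite (integral_ind P (A0 `&` B)) (integral_ind P B).
  by apply: eq_integral => w _; rewrite indI [in RHS]muleA (muleC (ind A0 w)).
have mA (h : T -> R) : measurable_fun setT h ->
    measurable_fun setT (fun w => ind A0 w * (h w)%:E : \bar R).
  move=> mh; apply: emeasurable_funM; first exact: measurable_ind.
  exact/measurable_EFinP.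
have A_ge0 (h : T -> R) : (forall w, 0 <= h w)%R -> forall w, 0 <= ind A0 w * (h w)%:E :> \bar R.
  by move=> h0 w; rewrite mule_ge0 ?ind_ge0 ?lee_fin.
rewrite !iD; apply: (pi_system_integral_eq (@history_measurable k)) mD.
- exact: mA.
- by apply: A_ge0.
- exact: mA.
- by apply: A_ge0.
- rewrite -(integral_ind P A0).
  apply: (@le_lt_trans _ _ (\int[P]_(w in A0) (1 + psi (Y k w))%:E)).
    apply: ge0_le_integral => //.
    + by move=> w _; rewrite lee_fin.
    + by apply/measurable_EFinP; exact: measurable_funTS.
    + by apply/measurable_EFinP; apply: measurable_funTS; apply: measurable_funD => //;
        apply: psi_random; exact: diff_value_random.
    + move=> w _; rewrite lee_fin (le_trans _ (psi_entry (Y k w) i j))//.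
      by rewrite /funrpos ge_max normr_ge0 ler_norm.
  under eq_integral do rewrite EFinD.
  rewrite ge0_integralD//.
  + rewrite lte_add_pinfty//; last exact: integrable_moment.
    by rewrite integral_cst// mul1e (le_lt_trans (probability_le1 _ _))// ltry.
  + by move=> w _; rewrite lee_fin.
  + by apply/measurable_EFinP; apply: measurable_funTS; apply: psi_random;
      exact: diff_value_random.
- exact: historyI.
- exact: historyT.
move=> _ [A [B [mAG mB ->]]]; rewrite -!iD !setIA.
set D' := [set w | _]; have mD' : d.-measurable D' by exact: draws_measurable.
have mA0A : G.-sigma.-measurable (A0 `&` A).
  exact: (@measurableI _ (g_sigma_algebraType _)).
have ci Bk : mx_borel Bk -> {ae P, forall w, (A0 `&` A) w ->
    cond_prob P G (D' `&` U k @^-1` Bk) w =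
    cond_prob P G D' w * cond_prob P G (U k @^-1` Bk) w}.
  move=> mBk; have := draws_cond_indep kl mB mBk.
  by apply: filterS => w H [A0w _]; exact: H.
have [pD0 mpD _] := cond_exp_nneg_indP P Gm mD'.
set pD := cond_exp_nneg P G _ in pD0 mpD.
have W (h : T -> R) :
    measurable_fun [set: g_sigma_algebraType (join_mx G (U k))]
      (h : g_sigma_algebraType (join_mx G (U k)) -> R) -> (forall w, 0 <= h w)%R ->
    \int[P]_(w in A0 `&` A `&` D') (h w)%:E =
    \int[P]_w ((ind A w * pD w) * (ind A0 w * (h w)%:E)).
  move=> mh h0; rewrite (@cond_indep_weight _ _ _ P G Gm p q (U k) mU _ D' h)//.
  apply: eq_integral => w _; rewrite indI muleC.
  rewrite -/pD (muleC (ind A0 w : \bar R) (ind A w)) muleCA !muleA.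
  by rewrite (muleC (ind A w : \bar R) (ind A0 w)).
rewrite !W//; last 2 first.
- exact: (@measurable_funrneg _ (g_sigma_algebraType _)).
- exact: (@measurable_funrpos _ (g_sigma_algebraType _)).
apply: (eq_integral_weight Gm).
- exact: mA.
- by apply: A_ge0.
- exact: mA.
- by apply: A_ge0.
- by apply: sub_measurable_funM => //; exact: sub_measurable_ind.
- by move=> w; rewrite mule_ge0 ?ind_ge0.
move=> E mE; rewrite -!iD; apply: sampled_mean => //.
exact: (@measurableI _ (g_sigma_algebraType _)).
Qed.

Lemma sampling_mart_diff : mart_diff P A0 l history Y psi s.
Proof.
split.
- by move=> k _; exact: diff_value_random.
- move=> j k jk _; apply: (@random_mxB _ (g_sigma_algebraType (history k))).
    exact: history_draw.
  exact: history_random_past.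
- by move=> k kl i j; exact: sampled_centered.
- by move=> k kl D mD; exact: sampled_moment_history.
Qed.

End sampling.

(** * Derivatives of a finite sum *)

Lemma mulmx_hess (R : realType) n (f : 'rV[R]_n -> R) x (v : 'rV[R]_n) :
  differentiable (grad f) x -> v *m hess f x = 'D_v (grad f) x.
Proof. by move=> df; have := deriveEjacobian v df; move=> /esym. Qed.

Section derivatives_of_finite_sum.
Variables (R : realType) (n N : nat) (g : 'I_N -> 'rV[R]_n -> R) (c : R).
Hypothesis g2 : forall i, twice_differentiable (g i).
Let G x := c * \sum_i g i x.

(** With its analogue for the Hessian, transfers measurability and symmetry from the terms to the
    exact derivatives. *)
Lemma grad_finite_sum x : grad G x = c *: \sum_i grad (g i) x.
Proof.
apply/rowP => j; rewrite /grad !mxE summxE.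
have dg i : derivable (g i) x (delta_mx 0 j).
  by apply: diff_derivable; have [] := g2 i x.
rewrite (_ : G = c \*: \sum_i g i); last first.
  by apply/funext => z; rewrite /G fct_sumE.
rewrite deriveZ; last exact: derivable_sum.
rewrite derive_sum//; congr (_ * _); apply: eq_bigr => i _; by rewrite mxE.
Qed.

Lemma hess_finite_sum x : hess G x = c *: \sum_i hess (g i) x.
Proof.
have dg i : differentiable (grad (g i)) x by have [] := g2 i x.
have GE : grad G = c \*: \sum_i grad (g i).
  by apply/funext => z; rewrite grad_finite_sum fct_sumE.
have dG : differentiable (grad G) x.
  by rewrite GE; apply: differentiableZ; exact: differentiable_sum.
have dv i v : derivable (grad (g i)) x v by exact: diff_derivable.
have DG v : 'D_v (grad G) x = c *: \sum_i 'D_v (grad (g i)) x.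
  by rewrite GE deriveZ ?derive_sum//; exact: derivable_sum.
apply/row_matrixP => j; rewrite !rowE -scalemxAr mulmx_sumr.
apply: etrans (mulmx_hess (delta_mx 0 j) dG) _.
apply: etrans (DG (delta_mx 0 j)) _; apply: (congr1 ( *:%R c)).
by apply: eq_bigr => i _; apply: esym; exact: (mulmx_hess (delta_mx 0 j) (dg i)).
Qed.

End derivatives_of_finite_sum.

(** Allows strict slack in the batch estimates: room for the regularization, and a positive radius
    even when the variance bound is zero. *)
Lemma lee_cube_limit (R : realType) (x : \bar R) (r c : R) :
  0 <= r -> 0 <= c <= 1 ->
  (forall r', r < r' -> (x <= (r' ^+ 3)%:E * c%:E)%E) -> (x <= (r ^+ 3)%:E * c%:E)%E.
Proof.
move=> r0 /andP[c0 c1] H; apply/lee_addgt0Pr => e e0.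
have p0 : 0 <= r ^+ 3 + e by rewrite addr_ge0 ?exprn_ge0// ltW.
pose r' := (r ^+ 3 + e) `^ 3^-1.
have r'3 : r' ^+ 3 = r ^+ 3 + e.
  by rewrite -powR_mulrn ?powR_ge0// -powRrM mulVf ?powRr1.
apply: (le_trans (H r' _)).
  by rewrite -(@ltr_pXn2r _ 3)// ?nnegrE ?powR_ge0// r'3 ltrDl.
by rewrite r'3 -EFinM -EFinD lee_fin mulrDl lerD2l -[leRHS]mulr1 ler_wpM2l// ltW.
Qed.

Lemma measurable_cond_exp d (T : measurableType d) (R : realType)
    (P : probability T R) (G : set (set T)) (Gm : forall A, G A -> d.-measurable A)
    (u : T -> R) : measurable_fun setT u -> sub_measurable_fun G (cond_exp P G u).
Proof.
move=> mu.
have [_ mp _] := cond_exp_nnegP P Gm (measurable_funrpos mu) (@funrpos_ge0 _ _ u).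
have [_ mn _] := cond_exp_nnegP P Gm (measurable_funrneg mu) (@funrneg_ge0 _ _ u).
exact: emeasurable_funB.
Qed.

(** * Moment bounds for batch means *)

Section batch.
Context d (T : measurableType d) (R : realType) (P : probability T R).
Variables (G : set (set T)) (Gm : forall A, G A -> d.-measurable A).

Lemma lee_cube_limit_prob (x : \bar R) (r : R) A : measurable A -> 0 <= r ->
  (forall r', r < r' -> (x <= (r' ^+ 3)%:E * P A)%E) -> (x <= (r ^+ 3)%:E * P A)%E.
Proof.
move=> mA r0; rewrite -(fineK (fin_num_measure P _ mA)); apply: lee_cube_limit => //.
by rewrite fine_ge0// -lee_fin fineK ?fin_num_measure// probability_le1.
Qed.

Section mean.
Variables (N p q : nat) (b : T -> nat) (I : nat -> T -> 'I_N).
Variables (Z : 'I_N -> T -> 'M[R]_(p, q)) (M : T -> 'M[R]_(p, q)).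
Hypothesis CS : conditional_sampling P G b I Z M.

(** Batches are nonempty, so the conditional mean of draw 0 equals M almost surely, and it is
    measurable for the past by construction. *)
Lemma mean_version : exists M' : T -> 'M[R]_(p, q),
  random_mx (M' : g_sigma_algebraType G -> 'M[R]_(p, q)) /\
  {ae P, forall w, M' w = M w}.
Proof.
pose C r c := cond_exp P G (fun w => Z (I 0%N w) w r c).
exists (fun w => \matrix_(r, c) fine (C r c w)); split.
  move=> r c; under eq_fun do rewrite mxE.
  apply: (measurableT_comp (f := fine)); first exact: fine_measurable.
  apply: (@measurable_cond_exp _ _ _ P _ Gm (fun w => Z (I 0%N w) w r c)).
  exact: (draw_value_random CS).
have : {ae P, forall w r c, C r c w = (M w r c)%:E}.
  apply: filter_forall => r; apply: filter_forall => c.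
  move: (sample_mean CS 0 r c); apply: filterS => w; apply.
  exact: size_gt0 CS w.
by apply: filterS => w H; apply/matrixP => r c; rewrite mxE H.
Qed.

Lemma batch_mean_random : random_mx (batch_mean b I Z).
Proof.
pose V l w := (l%:R^-1 *: \sum_(j < l) Z (I j w) w : 'M[R]_(p, q)).
have mV l : random_mx (V l).
  apply: random_mxZ => //; apply: (random_mx_sum (U := fun j w => Z (I j w) w)) => j _.
  exact: (draw_value_random CS).
move=> r c _ B mB; rewrite setTI.
rewrite (_ : _ @^-1` B = \bigcup_l ([set w | b w = l] `&` (fun w => V l w r c) @^-1` B)).
  apply: bigcup_measurable => l _; apply: measurableI.
    exact: (sub_gen_measurable Gm (size_past CS l)).
  by rewrite -[X in _ X]setTI; exact: mV.
apply/seteqP; split => w /=; first by exists (b w).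
by move=> [l _ [/= <-]].
Qed.

Lemma batch_meanB l (M' : T -> 'M[R]_(p, q)) w : b w = l -> M' w = M w ->
  M w - batch_mean b I Z w = - l%:R^-1 *: \sum_(j < l) (Z (I j w) w - M' w).
Proof.
move=> bl M'w; have l0 : (l%:R : R) != 0 by rewrite pnatr_eq0 -lt0n -bl (size_gt0 CS).
rewrite /batch_mean bl scaleNr sumrB scalerBr sumr_const card_ord.
rewrite -[M' w *+ l]scaler_nat scalerA.
by rewrite mulVf// scale1r M'w opprB.
Qed.

End mean.

(** Tangent line of the concave function u^(3/4) of u = x^2 at u = r^4. *)
Lemma sqrt_cube_tangent (x r : R) : 0 <= x -> 0 < r ->
  Num.sqrt x ^+ 3 <= 3 / (4 * r) * x ^+ 2 + r ^+ 3 / 4.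
Proof.
move=> x0 r0; have t0 := sqrtr_ge0 x; rewrite -{2}(sqr_sqrtr x0).
move: (Num.sqrt x) t0 => t t0; rewrite -subr_ge0.
rewrite (_ : _ - _ = (t - r) ^+ 2 * (3 * t ^+ 2 + 2 * t * r + r ^+ 2) / (4 * r)); last first.
  by field; rewrite gt_eqF.
apply: divr_ge0; last by rewrite mulr_ge0// ltW.
by apply: mulr_ge0; [exact: sqr_ge0|nra].
Qed.

Section vector.
Variables (N n : nat) (b : T -> nat) (I : nat -> T -> 'I_N).
Variables (Z : 'I_N -> T -> 'rV[R]_n) (M : T -> 'rV[R]_n) (sigma : R).
Hypothesis CS : conditional_sampling P G b I Z M.
Hypothesis mM : random_mx M.
Hypothesis sigma_moment : forall i, {ae P, forall w,
  (cond_exp P G (fun w => enorm (Z i w - M w) ^+ 2)%R w <= (sigma ^+ 2)%:E)%E}.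

Lemma vector_batch_integral l A (r : R) :
  G.-sigma.-measurable A -> A `<=` [set w | b w = l] ->
  Num.sqrt (Num.sqrt (sigma ^+ 2 / l%:R)) < r ->
  (\int[P]_(w in A) (Num.sqrt (enorm (M w - batch_mean b I Z w)) ^+ 3)%:E
    <= (r ^+ 3)%:E * P A)%E.
Proof.
move=> mA Ab vr; have mA' := sub_gen_measurable Gm mA.
have [l0|l0] := posnP l.
  have -> : A = set0.
    by apply/seteqP; split => // w /Ab/=; rewrite l0 => bw; have := size_gt0 CS w; rewrite bw.
  by rewrite integral_set0 measure0 mule0.
have r0 : 0 < r by apply: le_lt_trans vr; exact: sqrtr_ge0.
have lR : (l%:R : R) != 0 by rewrite pnatr_eq0 -lt0n.
have vr4 : sigma ^+ 2 / l%:R <= r ^+ 4.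
  have v0 : 0 <= sigma ^+ 2 / l%:R by rewrite divr_ge0 ?sqr_ge0.
  rewrite -[leLHS](sqr_sqrtr v0) -[Num.sqrt _](sqr_sqrtr (sqrtr_ge0 _)) -exprM.
  by rewrite lerXn2r ?nnegrE ?sqrtr_ge0// ltW.
have [M' [mM' M'E]] := mean_version CS.
pose Y j w := Z (I j w) w - M' w.
have YM : mart_diff P A l (history G I Z) Y (fun v => enorm v ^+ 2) (sigma ^+ 2).
  apply: (sampling_mart_diff Gm CS mM' M'E mM) => //.
  - by move=> X; rewrite sqr_ge0.
  - by move=> d' T' V mV; apply: measurable_funX; exact: measurable_enorm.
  - move=> X i j; rewrite (ord1 i); apply: (le_trans (enorm_entry X j)).
    by have := sqr_ge0 (enorm X - 1); rewrite sqrrB expr1n mulr1; have := enorm_ge0 X; nra.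
  - exact: sqr_ge0.
have HM := enorm_martingale mA' (history_measurable Gm CS) YM (sqr_ge0 _) (leqnn l).
have mS : random_mx (fun w => \sum_(j < l) Y j w).
  by apply: (random_mx_sum (U := Y)) => j jl; exact: (diff_random YM).
have mB : random_mx (fun w => M w - batch_mean b I Z w).
  by apply: random_mxB => //; exact: (batch_mean_random CS).
pose h w := 3 / (4 * r) * (l%:R^-1 ^+ 2 * enorm (\sum_(j < l) Y j w) ^+ 2) + r ^+ 3 / 4.
have mh : measurable_fun setT h.
  apply: measurable_funD => //; apply: measurable_funM => //; apply: measurable_funM => //.
  by apply: measurable_funX; exact: measurable_enorm.
have c0 : 0 <= 3 / (4 * r) * l%:R^-1 ^+ 2.
  by rewrite mulr_ge0 ?sqr_ge0 ?divr_ge0 ?mulr_ge0// ltW.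
have h0 w : 0 <= h w.
  rewrite /h mulrA; apply: addr_ge0; first by apply: mulr_ge0 => //; exact: sqr_ge0.
  by apply: divr_ge0 => //; apply: exprn_ge0; exact: ltW.
apply: (@le_trans _ _ (\int[P]_(w in A) (h w)%:E)%E).
  apply: ae_ge0_le_integral => //.
  - apply/measurable_EFinP; apply: measurable_funTS; apply: measurable_funX.
    apply: (@measurableT_comp _ _ _ _ _ _ (@Num.sqrt R)); last exact: measurable_enorm.
    by apply: continuous_measurable_fun; exact: sqrt_continuous.
  - by move=> w _; rewrite lee_fin.
  - by apply/measurable_EFinP; exact: measurable_funTS.
  move: M'E; apply: filterS => w M'w Aw; rewrite lee_fin.
  rewrite (batch_meanB CS (Ab _ Aw) M'w).
  have := sqrt_cube_tangent (enorm_ge0 (- l%:R^-1 *: \sum_(j < l) (Z (I j w) w - M' w))) r0.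
  rewrite [in X in _ <= X -> _]enormZ exprMn normrN real_normK ?num_real//.
under eq_integral do rewrite /h mulrA EFinD EFinM.
rewrite ge0_integralD//; last 3 first.
- by move=> w _; rewrite -EFinM lee_fin mulr_ge0 ?sqr_ge0.
- by apply/measurable_EFinP; apply: measurable_funTS; apply: measurable_funM => //;
    apply: measurable_funX; exact: measurable_enorm.
- by move=> w _; rewrite lee_fin divr_ge0 ?exprn_ge0// ltW.
rewrite ge0_integralZl//; last 2 first.
- by apply/measurable_EFinP; apply: measurable_funTS; apply: measurable_funX; exact: measurable_enorm.
- by move=> w _; rewrite lee_fin sqr_ge0.
rewrite integral_cst//; move: HM.
set J := (\int[P]_(w in A) _)%E => HM.
apply: (@le_trans _ _ ((3 / (4 * r) * l%:R^-1 ^+ 2)%:E * ((l%:R * sigma ^+ 2)%:E * P A) +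
  (r ^+ 3 / 4)%:E * P A)%E).
  by rewrite leeD2r// lee_wpmul2l.
rewrite muleA -EFinM -ge0_muleDl ?lee_fin//; last 2 first.
- by rewrite mulr_ge0// mulr_ge0 ?sqr_ge0.
- by rewrite divr_ge0 ?exprn_ge0// ltW.
rewrite lee_wpmul2r// -EFinD lee_fin.
have -> : 3 / (4 * r) * l%:R^-1 ^+ 2 * (l%:R * sigma ^+ 2) = 3 / (4 * r) * (sigma ^+ 2 / l%:R).
  by field; rewrite lR gt_eqF.
(* Tangency at r^4, an upper bound of the variance of the mean, makes the two terms add up to
   r^3. *)
apply: (@le_trans _ _ (3 / (4 * r) * r ^+ 4 + r ^+ 3 / 4)).
  by rewrite lerD2r ler_wpM2l// divr_ge0 ?mulr_ge0// ltW.
by rewrite le_eqVlt; apply/orP; left; apply/eqP; field; rewrite gt_eqF.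
Qed.

Lemma vector_batch_moment : {ae P, forall w,
  (cond_exp P G (fun w => enorm (M w - batch_mean b I Z w) `^ (3 / 2))%R w
    <= (Num.sqrt (Num.sqrt (sigma ^+ 2 / (b w)%:R)) ^+ 3)%:E)%E}.
Proof.
have -> : (fun w => enorm (M w - batch_mean b I Z w) `^ (3 / 2)) =
    (fun w => Num.sqrt (enorm (M w - batch_mean b I Z w)) ^+ 3).
  apply/funext => w; rewrite -powR12_sqrt ?enorm_ge0// -powR_mulrn ?powR_ge0// -powRrM.
  by rewrite mulrC.
apply: (cond_exp_le_piecewise Gm (B := fun l => Num.sqrt (Num.sqrt (sigma ^+ 2 / l%:R)) ^+ 3)).
- apply: measurable_funX; apply: (@measurableT_comp _ _ _ _ _ _ (@Num.sqrt R)).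
    by apply: continuous_measurable_fun; exact: sqrt_continuous.
  by apply: measurable_enorm; apply: random_mxB => //; exact: (batch_mean_random CS).
- by move=> w; rewrite exprn_ge0// sqrtr_ge0.
- by move=> l; rewrite exprn_ge0// sqrtr_ge0.
- exact: size_past CS.
move=> l A mA Ab; apply: (lee_cube_limit_prob (sub_gen_measurable Gm mA)).
  exact: sqrtr_ge0.
by move=> r; exact: vector_batch_integral.
Qed.

End vector.

Section matrix.
Variables (N n : nat) (b : T -> nat) (I : nat -> T -> 'I_N).
Variables (Z : 'I_N -> T -> 'M[R]_n) (M : T -> 'M[R]_n) (sigma : R).
Hypothesis CS : conditional_sampling P G b I Z M.
Hypothesis mM : random_mx M.
Hypothesis ZT : forall i w, (Z i w)^T = Z i w.
Hypothesis MT : forall w, (M w)^T = M w.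
Hypothesis n_gt0 : (0 < n)%N.
Hypothesis sigma_ge0 : 0 <= sigma.
Hypothesis sigma_moment : forall i, {ae P, forall w,
  (cond_exp P G (fun w => spnorm (Z i w - M w) ^+ 3)%R w <= (sigma ^+ 3)%:E)%E}.

(** A version agrees with the symmetric M only almost surely, while the matrix estimates need
    symmetry at every outcome; hence the symmetrization. *)
Lemma mean_version_sym : exists M' : T -> 'M[R]_n,
  [/\ random_mx (M' : g_sigma_algebraType G -> 'M[R]_n),
      {ae P, forall w, M' w = M w} & forall w, (M' w)^T = M' w].
Proof.
have [M' [mM' M'E]] := mean_version CS.
exists (fun w => 2^-1 *: (M' w + (M' w)^T)); split.
- apply: (@random_mxZ _ (g_sigma_algebraType G) _ _ _ (fun=> 2^-1)) => //.
  apply: (@random_mxD _ (g_sigma_algebraType G)) => // i j.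
  by under eq_fun do rewrite mxE; exact: mM'.
- move: M'E; apply: filterS => w ->; rewrite MT -mulr2n -[M w *+ 2]scaler_nat scalerA.
  by rewrite mulVf ?scale1r.
- by move=> w; rewrite linearZ/= linearD/= trmxK addrC.
Qed.

Let K q : R := 3 / 2 * (q + q).+1%:R * sch_dim R n q ^+ 2.

Lemma matrix_batch_integral q l A (r : R) : (0 < q)%N ->
  G.-sigma.-measurable A -> A `<=` [set w | b w = l] ->
  Num.sqrt (K q * sigma ^+ 2 / l%:R) < r ->
  (\int[P]_(w in A) (spnorm (M w - batch_mean b I Z w) ^+ 3)%:E
    <= (r ^+ 3)%:E * P A)%E.
Proof.
move=> q0 mA Ab vr; have mA' := sub_gen_measurable Gm mA.
have [l0|l0] := posnP l.
  have -> : A = set0.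
    by apply/seteqP; split => // w /Ab/=; rewrite l0 => bw; have := size_gt0 CS w; rewrite bw.
  by rewrite integral_set0 measure0 mule0.
have r0 : 0 < r by apply: le_lt_trans vr; exact: sqrtr_ge0.
have lR : 0 < (l%:R : R) by rewrite ltr0n.
have n0 : 0 < (n%:R : R) by rewrite ltr0n.
have K0 : 0 < K q by rewrite /K !mulr_gt0// powR_gt0.
have vr2 : K q * sigma ^+ 2 < r ^+ 2 * l%:R.
  have v0 : 0 <= K q * sigma ^+ 2 / l%:R.
    by rewrite divr_ge0 ?ler0n// mulr_ge0 ?sqr_ge0// ltW.
  rewrite -ltr_pdivrMr// -[ltLHS](sqr_sqrtr v0).
  by rewrite ltr_pXn2r ?nnegrE ?sqrtr_ge0// ltW.
(* [tau] replaces [sigma], which may be zero, and leaves room for the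
   regularization of the Schatten norm. *)
pose tau := Num.sqrt ((sigma ^+ 2 + r ^+ 2 * l%:R / K q) / 2).
have t20 : 0 < (sigma ^+ 2 + r ^+ 2 * l%:R / K q) / 2.
  by rewrite divr_gt0// ltr_wpDl ?sqr_ge0// divr_gt0// mulr_gt0// exprn_gt0.
have tau0 : 0 < tau by rewrite sqrtr_gt0.
have tau2 : tau ^+ 2 = (sigma ^+ 2 + r ^+ 2 * l%:R / K q) / 2 by rewrite sqr_sqrtr// ltW.
have Ktau : K q * tau ^+ 2 < r ^+ 2 * l%:R.
  rewrite tau2 (_ : K q * _ = (K q * sigma ^+ 2 + r ^+ 2 * l%:R) / 2); last first.
    by field; rewrite gt_eqF.
  by move: vr2; lra.
have sigma_tau : sigma <= tau.
  rewrite -(@ler_pXn2r _ 2)// ?nnegrE ?(ltW tau0)// tau2.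
  have : sigma ^+ 2 <= r ^+ 2 * l%:R / K q by rewrite ler_pdivlMr// mulrC ltW.
  by lra.
clearbody tau.
(* Chosen so that the recursion, started from [delta], ends after [l] steps at exactly (r l)^2;
   [eps] is delta^p, which makes the squared norm of 0 equal to [delta]. *)
pose delta := (r ^+ 2 * l%:R - K q * tau ^+ 2) * l%:R.
have delta0 : 0 < delta by rewrite mulr_gt0// subr_gt0.
pose eps := Num.sqrt delta ^+ (q.+1 + q.+1).
have eps0 : 0 < eps by rewrite exprn_gt0// sqrtr_gt0.
have norm0 : sch_norm q eps (0 : 'M[R]_n) ^+ 2 = delta.
  rewrite /sch_norm /sch_pow expr0n/= mxtrace0 add0r /eps.
  have -> : (Num.sqrt delta ^+ (q.+1 + q.+1)) `^ (q.+1 + q.+1)%:R^-1 = Num.sqrt delta.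
    by rewrite -powR_mulrn ?sqrtr_ge0// -powRrM mulfV ?pnatr_eq0// powRr1 ?sqrtr_ge0.
  by rewrite sqr_sqrtr// ltW.
clearbody eps.
have [M' [mM' M'E M'T]] := mean_version_sym.
pose Y j w := Z (I j w) w - M' w.
have YT j w : (Y j w)^T = Y j w by rewrite linearB/= ZT M'T.
have YM : mart_diff P A l (history G I Z) Y (fun v => spnorm v ^+ 3) (tau ^+ 3).
  apply: (sampling_mart_diff Gm CS mM' M'E mM) => //.
  - by move=> X; rewrite exprn_ge0// spnorm_ge0.
  - by move=> d' T' V mV; apply: measurable_funX; exact: measurable_spnorm.
  - move=> X i j; apply: (le_trans (spnorm_entry X i j)).
    have := spnorm_ge0 X; move: (spnorm X) => x x0.
    have : 0 <= (x - 1) ^+ 2 * (x + 2) by rewrite mulr_ge0 ?sqr_ge0// addr_ge0.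
    rewrite (_ : _ * _ = x ^+ 3 - 3 * x + 2); last by ring.
    by have := exprn_ge0 3 x0; lra.
  - by rewrite exprn_ge0// ltW.
  - move=> i; move: (sigma_moment i); apply: filterS => w /le_trans; apply.
    by rewrite lee_fin lerXn2r// nnegrE// ltW.
have := spnorm_martingale mA' q0 eps0 tau0 (history_measurable Gm CS) YT YM (leqnn l).
rewrite [X in Num.sqrt (X + _)]norm0.
have -> : delta + 3 / 2 * ((q + q).+1%:R * sch_dim R n q ^+ 2 * tau ^+ 2) * l%:R = (r * l%:R) ^+ 2.
  by rewrite /delta /K; move: (sch_dim _ _ _) (_.+1%:R) => x y; ring.
rewrite sqrtr_sqr ger0_norm; last by rewrite mulr_ge0// ltW.
move=> HM.
have mS : random_mx (fun w => \sum_(j < l) Y j w).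
  by apply: (random_mx_sum (U := Y)) => j jl; exact: (diff_random YM).
have ST w : (\sum_(j < l) Y j w)^T = \sum_(j < l) Y j w.
  by rewrite linear_sum/=; apply: eq_bigr => j _; rewrite YT.
have mB : random_mx (fun w => M w - batch_mean b I Z w).
  by apply: random_mxB => //; exact: (batch_mean_random CS).
have mN : measurable_fun setT (fun w => sch_norm q eps (\sum_(j < l) Y j w)).
  exact: measurable_sch_norm.
apply: (@le_trans _ _ (\int[P]_(w in A)
    ((l%:R^-1 ^+ 3)%:E * (sch_norm q eps (\sum_(j < l) Y j w) ^+ 3)%:E))%E).
  apply: ae_ge0_le_integral => //.
  - by move=> w _; rewrite lee_fin exprn_ge0// spnorm_ge0.
  - apply/measurable_EFinP; apply: measurable_funTS; apply: measurable_funX.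
    exact: measurable_spnorm.
  - by move=> w _; rewrite -EFinM lee_fin mulr_ge0// exprn_ge0 ?powR_ge0.
  - apply/measurable_EFinP; apply: measurable_funTS; apply: measurable_funM => //.
    exact: measurable_funX.
  move: M'E; apply: filterS => w M'w Aw; rewrite -EFinM lee_fin.
  rewrite (batch_meanB CS (Ab _ Aw) M'w) spnormZ normrN ger0_norm ?invr_ge0 ?ler0n//.
  rewrite exprMn ler_wpM2l ?exprn_ge0 ?invr_ge0 ?ler0n// lerXn2r ?nnegrE ?spnorm_ge0 ?powR_ge0//.
  exact: (spnorm_le_sch q eps0 (ST w)).
rewrite ge0_integralZl//; last 2 first.
- by apply/measurable_EFinP; apply: measurable_funTS; exact: measurable_funX.
- by move=> w _; rewrite lee_fin exprn_ge0// powR_ge0.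
apply: (@le_trans _ _ ((l%:R^-1 ^+ 3)%:E * (((r * l%:R) ^+ 3)%:E * P A))%E).
  by rewrite lee_wpmul2l// lee_fin exprn_ge0// invr_ge0.
rewrite muleA -EFinM exprMn mulrCA -exprMn mulVf ?gt_eqF// expr1n mulr1//.
Qed.

Lemma matrix_batch_moment q : (0 < q)%N -> {ae P, forall w,
  (cond_exp P G (fun w => spnorm (M w - batch_mean b I Z w) ^+ 3)%R w
    <= (Num.sqrt (3 / 2 * (q + q).+1%:R * sch_dim R n q ^+ 2 * sigma ^+ 2 / (b w)%:R) ^+ 3)%:E)%E}.
Proof.
move=> q0.
apply: (cond_exp_le_piecewise Gm (B := fun l => Num.sqrt (K q * sigma ^+ 2 / l%:R) ^+ 3)).
- apply: measurable_funX; apply: measurable_spnorm.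
  by apply: random_mxB => //; exact: (batch_mean_random CS).
- by move=> w; rewrite exprn_ge0// spnorm_ge0.
- by move=> l; rewrite exprn_ge0// sqrtr_ge0.
- exact: size_past CS.
move=> l A mA Ab; apply: (lee_cube_limit_prob (sub_gen_measurable Gm mA)).
  exact: sqrtr_ge0.
by move=> r; exact: matrix_batch_integral.
Qed.

End matrix.
End batch.

(** * Constants *)

Section constants.
Context (R : realType).

(** From 1 - x <= e^(-x). It yields rational bounds such as e <= (6/5)^6 < 3 and e^(3/5) <= (10/9)^6
    < 2. *)
Lemma expR_mulrn_le (x c : R) k : 0 <= c -> 1 <= c * (1 - x) -> expR (x * k%:R) <= c ^+ k.
Proof.
move=> c0 cx; rewrite mulrC expRM_natl lerXn2r// ?nnegrE ?expR_ge0//.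
rewrite -[x in expR x]opprK expRN -[leLHS]mul1r ler_pdivrMr ?expR_gt0//.
by rewrite (le_trans cx)// ler_wpM2l// expR_ge1Dx.
Qed.

Lemma expR1_le3 : expR 1 <= 3 :> R.
Proof.
have := @expR_mulrn_le 6^-1 (6 / 5) 6; rewrite mulVf// => H.
by apply: le_trans (H _ _) _; lra.
Qed.

Lemma expR1_ge : 244 / 100 <= expR 1 :> R.
Proof.
have -> : (1 : R) = 4%:R * 4^-1 by rewrite mulfV.
rewrite expRM_natl (@le_trans _ _ ((1 + 4^-1) ^+ 4))//; first by lra.
by rewrite lerXn2r ?nnegrE ?expR_ge0 ?expR_ge1Dx//; lra.
Qed.

Lemma ln2_ge : 3 / 5 <= ln 2 :> R.
Proof.
rewrite -[leLHS]expRK ler_ln ?posrE ?expR_gt0//.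
have := @expR_mulrn_le 10^-1 (10 / 9) 6; rewrite (_ : 10^-1 * 6%:R = 3 / 5 :> R); last by lra.
by move=> H; apply: le_trans (H _ _) _; lra.
Qed.

Lemma sqr_sch_dim n q : sch_dim R n q ^+ 2 = n%:R `^ q.+1%:R^-1.
Proof.
rewrite /sch_dim -powR_mulrn ?powR_ge0// -powRrM; congr (_ `^ _).
by rewrite addnn -mul2n natrM invfM mulrAC mulVf ?mul1r.
Qed.

(* For [n >= 3] the exponent [q + 1 = floor (ln n) + 1] gives
   [n `^ (1 / (q + 1)) <= e]; for [n = 2], [q = 1] and [sqrt 2 < e ln 2]. *)
Lemma schatten_exponent n : (2 <= n)%N -> exists2 q, (0 < q)%N &
  3 / 2 * (q + q).+1%:R * sch_dim R n q ^+ 2 <= 9 / 2 * (expR 1 * ln n%:R).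
Proof.
move=> n2; have [->|n3] : n = 2%N \/ (3 <= n)%N by lia.
  exists 1%N => //; rewrite sqr_sch_dim.
  (* The product 1.464 of the rational lower bounds for e and ln 2 still exceeds the square root of
     2. *)
  have : (2 : R) `^ 2^-1 <= 244 / 100 * (3 / 5).
    have c0 : 0 <= 244 / 100 * (3 / 5) :> R by lra.
    rewrite powR12_sqrt// -(@ler_pXn2r _ 2) ?nnegrE ?sqrtr_ge0 ?c0//.
    by rewrite sqr_sqrtr; lra.
  have : 244 / 100 * (3 / 5) <= expR 1 * ln 2 :> R.
    by apply: ler_pM; [lra|lra|exact: expR1_ge|exact: ln2_ge].
  by move: (_ `^ _) (expR 1 * _) => u v; lra.
have n0 : (0 : R) < n%:R by rewrite ltr0n; lia.
have ln1 : 1 <= ln n%:R :> R.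
  rewrite -[leLHS]expRK ler_ln ?posrE ?expR_gt0// (le_trans expR1_le3)//.
  by rewrite ler_nat.
have /andP[q1 q2] := truncn_itv (ltW (lt_le_trans ltr01 ln1)).
set q := Num.truncn _ in q1 q2.
exists q; first by rewrite truncn_gt0.
rewrite sqr_sch_dim; have : (n%:R : R) `^ q.+1%:R^-1 <= expR 1.
  rewrite /powR gt_eqF// ler_expR mulrC ler_pdivrMr ?ltr0n// mul1r.
  exact: ltW.
have e0 := expR_gt0 (1 : R).
move: (_ `^ _) (expR 1) e0 => u v v0 uv.
apply: (@le_trans _ _ (3 / 2 * (q + q).+1%:R * v)).
  by rewrite ler_wpM2l// mulr_ge0.
rewrite (mulrC v) mulrA (ler_wpM2r (ltW v0))//.
(* Both q and 1 are at most ln n, so 2q + 1 <= 3 ln n; with the factor 3/2 this gives the constant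
   9/2. *)
have -> : (q + q).+1%:R = q%:R + q%:R + 1 :> R by rewrite -natrD natr1.
by move: ln1 q1; lra.
Qed.
End constants.

(** * Accuracy of the sampled gradient and Hessian *)

Theorem theorem4p1
  (R : realType) (d dy da : measure_display)
  (T : measurableType d) (P : probability T R)
  (Y : measurableType dy) (A : measurableType da)
  (n N m k : nat) (n_ge2 : (2 <= n)%N) (N_ge1 : (1 <= N)%N) (m_ge1 : (1 <= m)%N)
  (* finite-sum objective with random data *)
  (phi : 'I_N -> 'rV[R]_n -> Y -> A -> R)
  (y : 'I_N -> T -> Y) (a : 'I_N -> T -> A)
  (phi_diff : forall i u v, twice_differentiable (fun x => phi i x u v))
  (data_iid : iid P (fun i w => (a i w, y i w)))
  (f : T -> 'rV[R]_n -> R)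
  (f_def : forall w, f w = finite_sum phi (y ^~ w) (a ^~ w))
  (* the algorithm *)
  (sigma0 theta1 kappaD : R) (sigma0_gt0 : 0 < sigma0) (theta1_gt1 : 1 < theta1)
  (kappaD_gt0 : 0 < kappaD)
  (gbar : nat -> T -> 'rV[R]_n) (Hbar : nat -> T -> 'M[R]_n)
  (X S : nat -> T -> 'rV[R]_n) (Sigma : nat -> T -> R)
  (run : stoffar2 f sigma0 theta1 gbar Hbar X S Sigma)
  (xi_past : measurable_fun [set: g_sigma_algebraType (past gbar Hbar k)]
               (xi m S k : g_sigma_algebraType (past gbar Hbar k) -> R))
  (xi_gt0 : {ae P, forall w, 0 < xi m S k w})
  (* sampling at iteration k *)
  (gradi : 'I_N -> T -> 'rV[R]_n) (hessi : 'I_N -> T -> 'M[R]_n)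
  (gradi_def : forall i w,
     gradi i w = grad (fun x => phi i x (y i w) (a i w)) (X k w))
  (hessi_def : forall i w,
     hessi i w = hess (fun x => phi i x (y i w) (a i w)) (X k w))
  (hessi_sym : forall i w, (hessi i w)^T = hessi i w)
  (bg bH : T -> nat) (Bg BH : nat -> T -> 'I_N)
  (sampling_g : conditional_sampling P (past gbar Hbar k) bg Bg gradi
                  (fun w => grad (f w) (X k w)))
  (sampling_H : conditional_sampling P (past gbar Hbar k) bH BH hessi
                  (fun w => hess (f w) (X k w)))
  (gbar_k : forall w, gbar k w = batch_mean bg Bg gradi w)
  (Hbar_k : forall w, Hbar k w = batch_mean bH BH hessi w)
  (* moment bounds *)
  (sigma_g sigma_H : R) (sigma_g_ge0 : 0 <= sigma_g) (sigma_H_ge0 : 0 <= sigma_H)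
  (moment_g : forall i, {ae P, forall w,
     (cond_exp P (past gbar Hbar k)
        (fun w => enorm (gradi i w - grad (f w) (X k w)) ^+ 2)%R w
      <= (sigma_g ^+ 2)%:E)%E})
  (moment_H : forall i, {ae P, forall w,
     (cond_exp P (past gbar Hbar k)
        (fun w => spnorm (hessi i w - hess (f w) (X k w)) ^+ 3)%R w
      <= (sigma_H ^+ 3)%:E)%E})
  (* batch sizes *)
  (bg_large : {ae P, forall w,
     sigma_g ^+ 2 / (kappaD `^ (4 / 3) * xi m S k w `^ (4 / 3)) <= (bg w)%:R})
  (bH_large : {ae P, forall w,
     9 * sigma_H ^+ 2 * expR 1 * ln n%:R /
       (2 * kappaD `^ (2 / 3) * xi m S k w `^ (2 / 3)) <= (bH w)%:R}) :
  {ae P, forall w,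
     (cond_exp P (past gbar Hbar k)
        (fun w => enorm (grad (f w) (X k w) - gbar k w) `^ (3 / 2))%R w
      <= (kappaD * xi m S k w)%:E)%E} /\
  {ae P, forall w,
     (cond_exp P (past gbar Hbar k)
        (fun w => spnorm (hess (f w) (X k w) - Hbar k w) ^+ 3)%R w
      <= (kappaD * xi m S k w)%:E)%E}.
Proof.
set E := past gbar Hbar k; set F := fun w => grad (f w) (X k w).
set H := fun w => hess (f w) (X k w).
have Gm B : E B -> d.-measurable B.
  move=> [j jk [] [D mD <-]]; rewrite setTI; apply: random_mx_preimage mD.
    exact: (grad_random run).
  exact: (hess_random run).
have FE w : F w = N%:R^-1 *: \sum_i gradi i w.
  rewrite /F f_def; apply: etrans (grad_finite_sum (g := fun i x => phi i x (y i w) (a i w))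
    N%:R^-1 (fun i => phi_diff i _ _) (X k w)) _.
  by congr (_ *: _); apply: eq_bigr => i _; rewrite gradi_def.
have HE w : H w = N%:R^-1 *: \sum_i hessi i w.
  rewrite /H f_def; apply: etrans (hess_finite_sum (g := fun i x => phi i x (y i w) (a i w))
    N%:R^-1 (fun i => phi_diff i _ _) (X k w)) _.
  by congr (_ *: _); apply: eq_bigr => i _; rewrite hessi_def.
have random_mean p q (Z : 'I_N -> T -> 'M[R]_(p, q)) (V : T -> 'M[R]_(p, q)) :
    (forall i, random_mx (Z i)) -> (forall w, V w = N%:R^-1 *: \sum_i Z i w) -> random_mx V.
  move=> mZ VE r c; under eq_fun do rewrite VE mxE summxE.
  by apply: measurable_funM => //; apply: measurable_sum => i; exact: mZ.
have mF : random_mx F by exact: random_mean (term_random sampling_g) FE.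
have mH : random_mx H by exact: random_mean (term_random sampling_H) HE.
have HT w : (H w)^T = H w.
  by rewrite HE linearZ/= linear_sum/=; congr (_ *: _); apply: eq_bigr.
have size_large (x t L : R) (v : nat) : 0 < L -> (0 < v)%N ->
    x / (kappaD `^ t * L `^ t) <= v%:R -> x / v%:R <= (kappaD * L) `^ t.
  move=> L0 v0; rewrite (powRM _ (ltW kappaD_gt0) (ltW L0)) => h.
  by rewrite ler_pdivrMr ?ltr0n// mulrC -ler_pdivrMr// mulr_gt0 ?powR_gt0.
have sqrt_powR (c t : R) : Num.sqrt (c `^ t) = c `^ (t / 2).
  by rewrite -powR12_sqrt ?powR_ge0// -powRrM.
have cube_powR (c : R) : 0 <= c -> (c `^ 3^-1) ^+ 3 = c.
  by move=> c0; rewrite -powR_mulrn ?powR_ge0// -powRrM mulVf ?powRr1.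
split.
  move: (vector_batch_moment Gm sampling_g mF moment_g) bg_large xi_gt0.
  apply: filterS3 => w Hw bw xw.
  have c0 : 0 <= kappaD * xi m S k w by rewrite ltW// mulr_gt0.
  have -> : (fun w => enorm (grad (f w) (X k w) - gbar k w) `^ (3 / 2)) =
      (fun w => enorm (F w - batch_mean bg Bg gradi w) `^ (3 / 2)).
    by apply/funext => z; rewrite gbar_k.
  apply: le_trans Hw _; rewrite lee_fin -[leRHS]cube_powR//.
  rewrite lerXn2r ?nnegrE ?sqrtr_ge0 ?powR_ge0//.
  (* Two square roots bring the exponent 4/3 of the batch condition down to 1/3, whose cube is
     kappaD xi; for the Hessian one root does the same with 2/3. *)
  have -> : 3^-1 = 4 / 3 / 2 / 2 :> R by field.
  rewrite -!sqrt_powR !ler_wsqrtr//; apply: size_large => //.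
  exact: (size_gt0 sampling_g).
have [q q0 qn] := schatten_exponent R n_ge2.
move: (matrix_batch_moment Gm sampling_H mH hessi_sym HT (ltnW n_ge2) sigma_H_ge0 moment_H q0).
move=> mom; move: mom bH_large xi_gt0.
apply: filterS3 => w Hw bw xw.
have c0 : 0 <= kappaD * xi m S k w by rewrite ltW// mulr_gt0.
have -> : (fun w => spnorm (hess (f w) (X k w) - Hbar k w) ^+ 3) =
    (fun w => spnorm (H w - batch_mean bH BH hessi w) ^+ 3).
  by apply/funext => z; rewrite Hbar_k.
apply: le_trans Hw _; rewrite lee_fin -[leRHS]cube_powR//.
rewrite lerXn2r ?nnegrE ?sqrtr_ge0 ?powR_ge0//.
have -> : 3^-1 = 2 / 3 / 2 :> R by field.
rewrite -sqrt_powR ler_wsqrtr//.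
apply: (@le_trans _ _ (9 / 2 * (expR 1 * ln n%:R) * sigma_H ^+ 2 / (bH w)%:R)).
  by rewrite ler_wpM2r ?invr_ge0 ?ler0n// ler_wpM2r ?sqr_ge0.
apply: size_large => //; first exact: (size_gt0 sampling_H).
apply: le_trans bw; rewrite le_eqVlt; apply/orP; left; apply/eqP; field.
by rewrite !gt_eqF ?powR_gt0.
Qed.
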